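(* Let $E_0,F_0\in BV(\Omega,\{0,1\})$ be nonempty and bounded, and let $\beta_1,\beta_2\in L^\infty(\partial\Omega)$ satisfy $\|\beta_i\|_\infty\le1-2\kappa$, $i=1,2$, for some $\kappa\in(0,\frac12]$. Assume $E_0\subseteq F_0$ and $\beta_1\le\beta_2$. If $E_*(t)$ and $F_*(t)$ are minimal GMMs, starting from $E_0$ (with $\beta=\beta_1$) and from $F_0$ (with $\beta=\beta_2$) respectively, associated to the same diverging sequence $\{\lambda_j\}$, then $E_*(t)\subseteq F_*(t)$ for all $t\ge0$. Analogously, if $E^*(t)$ and $F^*(t)$ are the corresponding maximal GMMs associated to the same diverging sequence $\{\lambda_j'\}$, then $E^*(t)\subseteq F^*(t)$ for all $t\ge0$.
   Context: Let $n\ge1$, $\Omega=\mathbb R^n\times(0,+\infty)\subset\mathbb R^{n+1}$, and identify $\partial\Omega$ with $\mathbb R^n$. $BV(\Omega,\{0,1\})$ is the collection of measurable $E\subseteq\Omega$ with $\chi_E\in BV(\Omega)$, and $P(E,\Omega)=\int_\Omega|D\chi_E|$. Each set is identified with its set of points of Lebesgue density one. On $\partial\Omega$, $\chi_E$ denotes the trace of $E$. $[s]$ is the integer part of $s$. Capillary functional: $\mathcal C_\beta(E,\Omega)=P(E,\Omega)-\int_{\partial\Omega}\beta\chi_E\,d\mathcal H^n$. For $F\subseteq\Omega$, $d_F(x)=\mathrm{dist}(x,\Omega\cap\partial F)$ (distance from the empty set is $+\infty$), and for $\lambda\ge1$ $$\mathcal A_\beta(E,F,\lambda)=\mathcal C_\beta(E,\Omega)+\lambda\int_{E\Delta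 F}d_F\,dx,$$ the integral being $0$ if $|E\Delta F|=0$. Maximal and minimal minimizers: if $G\in BV(\Omega,\{0,1\})$ is bounded and $\|\beta\|_\infty\le1-2\kappa$, $\kappa\in(0,\frac12]$, there exist unique minimizers $G_\lambda^*$ (the maximal minimizer) and $G_{\lambda *}$ (the minimal minimizer) of $\mathcal A_\beta(\cdot,G,\lambda)$ in $BV(\Omega,\{0,1\})$ such that every minimizer $G_\lambda$ satisfies $G_{\lambda *}\subseteq G_\lambda\subseteq G_\lambda^*$ (for $G=\emptyset$ the only minimizer is $\emptyset$). Maximal and minimal GMM: set $E_\lambda(0)^*=E_0$ and, for $k\ge1$, let $E_\lambda(k)^*$ be the maximal minimizer of $\mathcal A_\beta(\cdot,E_\lambda(k-1)^*,\lambda)$. If $\{\lambda_j\}$ is a diverging sequence such that the limits $E^*(t)=\lim_{j}E_{\lambda_j}([\lambda_jt])^*$ exist in $L^1(\Omega)$ for all $t\ge0$, then $t\mapsto E^*(t)$ is called the maximal GMM (starting from $E_0$) associated to $\{\lambda_j\}$. The minimal GMM $t\mapsto E_*(t)$ associated to $\{\lambda_j\}$ is defined in the same way with minimal minimizers $E_\lambda(k)_*$ of $\mathcal A_\beta(\cdot,E_\lambda(k-1)_*,\lambda)$, $E_\lambda(0)_*=E_0$. *)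

(* Defs.v *)
From HB Require Import structures.
From mathcomp Require Import all_boot all_order all_algebra.
From mathcomp Require Import all_classical all_reals all_analysis.

Set Implicit Arguments.
Unset Strict Implicit.
Unset Printing Implicit Defensive.

Import Order.TTheory GRing.Theory Num.Theory.
Import numFieldNormedType.Exports.

Local Open Scope classical_set_scope.
Local Open Scope ring_scope.

(* The sigma-algebra generated by the coordinate maps is the Borel sigma-algebra
   of R^m. *)
Definition rV_display : measure_display.
Proof. by []. Qed.

Section measurable_rV.
Context {R : realType}.
Variable m : nat.

Let coors : 'I_m -> 'rV[R]_m -> R := fun i x => x ord0 i.

Let rV_set0 : g_sigma_preimage coors set0.
Proof. exact: sigma_algebra0. Qed.

Let rV_setC A : g_sigma_preimage coors A -> g_sigma_preimage coors (~` A).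
Proof. exact: sigma_algebraC. Qed.

Let rV_bigcup (F : (set 'rV[R]_m)^nat) :
  (forall i, g_sigma_preimage coors (F i)) ->
  g_sigma_preimage coors (\bigcup_i (F i)).
Proof. exact: sigma_algebra_bigcup. Qed.

HB.instance Definition _ := @isMeasurable.Build rV_display
  'rV[R]_m (g_sigma_preimage coors) rV_set0 rV_setC rV_bigcup.

End measurable_rV.

Section lebesgue_measure_rV.
Context {R : realType}.

(* The identification of R^m x R with R^(m+1); the extra coordinate is last. *)
Definition rV_snoc m (p : 'rV[R]_m * R) : 'rV[R]_m.+1 :=
  \row_i oapp (p.1 ord0) p.2 (unlift ord_max i).

Lemma measurable_coor m (i : 'I_m) :
  measurable_fun [set: 'rV[R]_m] (fun x : 'rV[R]_m => x ord0 i).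
Proof.
move=> _ Y mY; rewrite setTI; apply: sub_sigma_algebra => /=.
rewrite -bigcup_seq/=; exists i => /=; first by rewrite mem_index_enum.
by exists Y => //; rewrite setTI.
Qed.

Lemma measurable_rVP d (T : measurableType d) m (f : T -> 'rV[R]_m) :
  (forall i, measurable_fun [set: T] (fun x => f x ord0 i)) ->
  measurable_fun [set: T] f.
Proof.
move=> mf; suff : g_sigma_preimage (fun i x => (f x : 'rV[R]_m) ord0 i)
    `<=` @measurable _ T.
  move=> prefS _ A mA; apply: prefS.
  have -> : (fun (i : 'I_m) x => f x ord0 i) =
      (fun i => (fun v : 'rV[R]_m => v ord0 i) \o f) by [].
  by rewrite g_sigma_preimage_comp; exists A.
apply: smallest_sub; first exact: sigma_algebra_measurable.
rewrite -bigcup_seq/=; apply: bigcup_sub => i _.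
by move=> A [B mB <-]; exact: mf.
Qed.

Lemma measurable_rV_snoc m :
  measurable_fun [set: 'rV[R]_m * R] (@rV_snoc m).
Proof.
apply: measurable_rVP => i.
rewrite (_ : (fun _ => _) =
  fun p : 'rV[R]_m * R => oapp (p.1 ord0) p.2 (unlift ord_max i)); last first.
  by apply/funext => p; rewrite mxE.
case: (unlift ord_max i) => [j|] /=; last exact: measurable_snd.
exact: (measurableT_comp (@measurable_coor m j) measurable_fst).
Qed.

HB.instance Definition _ m :=
  isMeasurableFun.Build _ _ _ _ (@rV_snoc m) (@measurable_rV_snoc m).

Definition rV_unsnoc m (v : 'rV[R]_m.+1) : 'rV[R]_m * R :=
  (\row_j v ord0 (lift ord_max j), v ord0 ord_max).

Lemma rV_snocK m : cancel (@rV_snoc m) (@rV_unsnoc m).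
Proof.
move=> [x s]; congr (_, _); last by rewrite mxE unlift_none.
by apply/rowP => j; rewrite !mxE liftK.
Qed.

Lemma measurable_rV_unsnoc m : measurable_fun [set: 'rV[R]_m.+1] (@rV_unsnoc m).
Proof.
apply/measurable_fun_pairP; split; last exact: measurable_coor.
apply: measurable_rVP => i.
rewrite (_ : (fun _ => _) = fun v : 'rV[R]_m.+1 => v ord0 (lift ord_max i)).
  exact: measurable_coor.
by apply/funext => v; rewrite /= mxE.
Qed.

Section step.
Variables (m : nat) (mu : {sigma_finite_measure set 'rV[R]_m -> \bar R}).

Definition lebesgue_step : set 'rV[R]_m.+1 -> \bar R :=
  pushforward (mu \x (@lebesgue_measure R))%E (@rV_snoc m).

Let step0 : lebesgue_step set0 = 0%E.
Proof. by rewrite /lebesgue_step /pushforward preimage_set0 measure0. Qed.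

Let step_ge0 A : (0 <= lebesgue_step A)%E.
Proof. by rewrite /lebesgue_step /pushforward. Qed.

Let step_sigma_additive : semi_sigma_additive lebesgue_step.
Proof.
have mpre A : measurable A -> measurable (@rV_snoc m @^-1` A).
  by move=> mA; rewrite -[X in measurable X]setTI; exact: measurable_rV_snoc.
move=> F mF tF mUF; rewrite /lebesgue_step /pushforward preimage_bigcup.
apply: measure_semi_sigma_additive.
- by move=> k; exact: mpre.
- apply/trivIsetP => /= i j _ _ ij; rewrite -preimage_setI.
  by move/trivIsetP : tF => /(_ _ _ _ _ ij) ->//; rewrite preimage_set0.
- by rewrite -preimage_bigcup; exact: mpre.
Qed.

HB.instance Definition _ := isMeasure.Build _ _ _ lebesgue_step
  step0 step_ge0 step_sigma_additive.

Let step_sigma_finite : sigma_finite setT lebesgue_step.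
Proof.
have /sigma_finiteP[F [TF ndF Foo]] := sigma_finiteT mu.
have /sigma_finiteP[G [TG ndG Goo]] := sigma_finiteT (@lebesgue_measure R).
exists (fun i => @rV_unsnoc m @^-1` (F i `*` G i)).
  apply/esym; rewrite -subTset => v _.
  have [i _ Fi] : (\bigcup_i F i) (rV_unsnoc v).1 by rewrite -TF.
  have [j _ Gj] : (\bigcup_i G i) (rV_unsnoc v).2 by rewrite -TG.
  exists (maxn i j) => //; split.
    by move: Fi; exact/subsetPset/ndF/leq_maxl.
  by move: Gj; exact/subsetPset/ndG/leq_maxr.
move=> i; have [mF Fi] := Foo i; have [mG Gi] := Goo i.
have mFG : measurable (F i `*` G i) by exact: measurableX.
split; first by rewrite -[X in measurable X]setTI; exact: measurable_rV_unsnoc.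
rewrite /lebesgue_step /pushforward -comp_preimage.
rewrite (_ : _ \o _ = id) ?preimage_id; last first.
  by apply/funext => p; exact: rV_snocK.
by rewrite product_measure1E// lte_mul_pinfty// ge0_fin_numE.
Qed.

HB.instance Definition _ := Measure_isSigmaFinite.Build _ _ _ lebesgue_step
  step_sigma_finite.

End step.

(* Lebesgue measure on R^m, as an m-fold product measure; R^0 is a point, of
   mass 1. *)
Fixpoint lebesgue_rV m : {sigma_finite_measure set 'rV[R]_m -> \bar R} :=
  if m is m'.+1 then lebesgue_step (lebesgue_rV m') else \d_(0 : 'rV[R]_0).

End lebesgue_measure_rV.

Section euclidean.
Context {R : realType}.

(* The library norm on 'rV[R]_m is the sup norm (same topology, same bounded
   sets), hence the Euclidean norm is introduced separately. *)
Definition enorm m (x : 'rV[R]_m) : R := Num.sqrt (\sum_(i < m) x ord0 i ^+ 2).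

Definition eball m (x : 'rV[R]_m) (r : R) : set 'rV[R]_m :=
  [set y | enorm (y - x) < r].

(* Euclidean distance to a set, +oo for the empty set. *)
Definition edist_set m (x : 'rV[R]_m) (A : set 'rV[R]_m) : \bar R :=
  ereal_inf [set (enorm (y - x))%:E | y in A].

Definition boundary m (A : set 'rV[R]_m) : set 'rV[R]_m :=
  closure A `\` interior A.

Definition density_one m (A : set 'rV[R]_m) : set 'rV[R]_m :=
  [set x | fine (lebesgue_rV m (A `&` eball x r)) /
           fine (lebesgue_rV m (eball x r)) @[r --> 0^'+] --> (1 : R)].

(* Continuous first-order partial derivatives. *)
Definition C1 m p (phi : 'rV[R]_m -> 'rV[R]_p) : Prop :=
  forall i : 'I_m,
    (forall x, derivable phi x (delta_mx ord0 i)) /\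
    continuous (fun x => 'D_(delta_mx ord0 i) phi x).

Definition divergence m (phi : 'rV[R]_m -> 'rV[R]_m) (x : 'rV[R]_m) : R :=
  \sum_(i < m) ('D_(delta_mx ord0 i) phi x) ord0 i.

Definition test_field m (U : set 'rV[R]_m) (phi : 'rV[R]_m -> 'rV[R]_m) : Prop :=
  [/\ C1 phi,
      compact (closure [set x | phi x != 0]),
      closure [set x | phi x != 0] `<=` U &
      forall x, enorm (phi x) <= 1].

(* \int_U |D u| *)
Definition total_variation m (U : set 'rV[R]_m) (u : 'rV[R]_m -> R) : \bar R :=
  ereal_sup [set (\int[lebesgue_rV m]_(x in U) (u x * divergence phi x)%:E)%E
            | phi in test_field U].

Definition BV m (U : set 'rV[R]_m) (u : 'rV[R]_m -> R) : Prop :=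
  (lebesgue_rV m).-integrable U (EFin \o u) /\
  (total_variation U u < +oo)%E.

End euclidean.

Section capillary.
Context {R : realType}.
Variable n : nat.

Definition Omega : set 'rV[R]_n.+1 := [set x | 0 < x ord0 ord_max].

(* The inclusion of R^n as the boundary of Omega. *)
Definition bd (y : 'rV[R]_n) : 'rV[R]_n.+1 := rV_snoc (y, 0).

Definition perimeter (E : set 'rV[R]_n.+1) : \bar R :=
  total_variation Omega \1_E.

(* The trace of u at bd y is the real a with
   r^-(n+1) * \int_(Omega /\ B_r(bd y)) |u - a| --> 0 as r --> 0+; for u in
   BV(Omega) such an a exists for almost every y, and it is unique. The value at
   the other points is irrelevant, and taken to be 0. *)
Definition trace (u : 'rV[R]_n.+1 -> R) (y : 'rV[R]_n) : R :=
  xget 0 [set a : R |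
    ((r ^- n.+1)%:E *
      \int[lebesgue_rV n.+1]_(x in Omega `&` eball (bd y) r) `|u x - a|%:E)%E
    @[r --> 0^'+] --> (0 : \bar R)%E].

(* Sets are represented by their set of points of density one, so that a.e.
   inclusion becomes inclusion; the boundary in A_functional below is that of
   this representative. *)
Definition BV_set (E : set 'rV[R]_n.+1) : Prop :=
  [/\ measurable E, E `<=` Omega, BV Omega \1_E & density_one E = E].

Definition C_functional (beta : 'rV[R]_n -> R) (E : set 'rV[R]_n.+1) : \bar R :=
  (perimeter E - \int[lebesgue_rV n]_y (beta y * trace \1_E y)%:E)%E.

Definition A_functional (beta : 'rV[R]_n -> R) (E F : set 'rV[R]_n.+1)
    (lambda : R) : \bar R :=
  (C_functional beta E +
   lambda%:E *
     \int[lebesgue_rV n.+1]_(x in E `+` F) edist_set x (Omega `&` boundary F))%E.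

Definition minimizer (beta : 'rV[R]_n -> R) (lambda : R)
    (G E : set 'rV[R]_n.+1) : Prop :=
  BV_set E /\
  forall H, BV_set H ->
    (A_functional beta E G lambda <= A_functional beta H G lambda)%E.

Definition minimal_minimizer (beta : 'rV[R]_n -> R) (lambda : R)
    (G E : set 'rV[R]_n.+1) : Prop :=
  minimizer beta lambda G E /\
  forall H, minimizer beta lambda G H -> E `<=` H.

Definition maximal_minimizer (beta : 'rV[R]_n -> R) (lambda : R)
    (G E : set 'rV[R]_n.+1) : Prop :=
  minimizer beta lambda G E /\
  forall H, minimizer beta lambda G H -> H `<=` E.

(* [step lambda G E] : E is a successor of G with parameter lambda. *)
Definition discrete_flow (step : R -> set 'rV[R]_n.+1 -> set 'rV[R]_n.+1 -> Prop)
    (lambda : R) (E0 : set 'rV[R]_n.+1) (E : nat -> set 'rV[R]_n.+1) : Prop :=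
  E 0 = E0 /\ forall k, step lambda (E k) (E k.+1).

Definition diverging (lambda : nat -> R) : Prop :=
  (forall j, 1 <= lambda j) /\ lambda j @[j --> \oo] --> +oo.

Definition L1_limit (A : nat -> set 'rV[R]_n.+1) (B : set 'rV[R]_n.+1) : Prop :=
  (\int[lebesgue_rV n.+1]_(x in Omega) `|\1_(A j) x - \1_B x|%:E)%E
    @[j --> \oo] --> (0 : \bar R)%E.

(* E t matters for 0 <= t only. *)
Definition GMM (step : R -> set 'rV[R]_n.+1 -> set 'rV[R]_n.+1 -> Prop)
    (E0 : set 'rV[R]_n.+1) (lambda : nat -> R) (E : R -> set 'rV[R]_n.+1) :
    Prop :=
  diverging lambda /\
  exists2 Ed : nat -> nat -> set 'rV[R]_n.+1,
    forall j, discrete_flow step (lambda j) E0 (Ed j) &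
    forall t, 0 <= t ->
      [/\ measurable (E t), E t `<=` Omega, density_one (E t) = E t &
          L1_limit (fun j => Ed j (Num.truncn (lambda j * t))) (E t)].

Definition minimal_GMM (beta : 'rV[R]_n -> R) := GMM (minimal_minimizer beta).

Definition maximal_GMM (beta : 'rV[R]_n -> R) := GMM (maximal_minimizer beta).

(* beta is in L^oo(boundary of Omega), with norm at most c. *)
Definition Linfty_le (beta : 'rV[R]_n -> R) (c : R) : Prop :=
  measurable_fun setT beta /\
  ('N[lebesgue_rV n]_(+oo%E) [EFin \o beta] <= c%:E)%E.

End capillary.

(* Main.v *)
From HB Require Import structures.
Require Import Defs.
From mathcomp Require Import all_boot all_order all_algebra.
From mathcomp Require Import all_classical all_reals all_analysis.
From mathcomp Require Import measurable_realfun ess_sup_inf.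
From mathcomp Require Import ring lra.

(** Comparison of one step: let [E `<=` F], let [E'] minimize the functional with
    data [(beta1, E)] and [F'] the one with data [(beta2, F)]. The sum of the two
    functionals does not increase when [(E', F')] is replaced by
    [(E' `&` F', E' `|` F')], so the intersection and the union are again
    minimizers, and minimality of [E'], or maximality of [F'], gives [E' `<=` F'].
    Induction on the steps and passage to the limit in L^1 give the theorem.
    Three terms have to be compared.
    - Perimeter. Test [E' `&` F'] with a field [phi] and [E' `|` F'] with [psi]; up to
      mollification these are combined into one field for [E'] and one for [F'].
    - Trace. By slicing in the last coordinate, almost every vertical line is, near
      the boundary, a.e. inside or a.e. outside a set of finite perimeter. Hence
      the trace is a.e. an indicator, and intersections and unions pass to it.
    - Distance. A segment joining a point of [E] to the boundary of [F] meets the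
      boundary of [E], and a segment joining a point outside [F] to the boundary of
      [E] meets the boundary of [F]; so the distances to the two boundaries compare
      the right way on [E] and outside [F]. *)

Set Implicit Arguments.
Unset Strict Implicit.
Unset Printing Implicit Defensive.

Import Order.TTheory GRing.Theory Num.Theory.
Import numFieldNormedType.Exports.

Local Open Scope classical_set_scope.
Local Open Scope ring_scope.

(** * Lebesgue measure on R^m *)

(** The functionals take extended real values, since the distance to an empty boundary is [+oo].
    Cancelling in the inequality for the sum therefore requires that both minimizers have finite
    values; comparing them with the previous set, whose own distance term is 0, provides this. For
    the perimeter, the natural pair of fields involves [\1_E] and [\1_F] and is discontinuous. Only
    [\1_F] is mollified: the discontinuous field that remains is paired with the gradient of the
    mollification, where measurability suffices. The limit needs a.e. convergence of mollified
    indicators, hence Lebesgue's density theorem for [lebesgue_rV], hence outer regularity and a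
    covering argument. [trace] is a choice, with no evident measurability, so it is traded for the
    measurable [trace_set]. As [beta] is merely bounded, integrability of the trace term also asks
    that this set have finite measure; slicing gives that too. Sets that consist of their
    density-one points are stable under intersection, but a union has to be replaced by its
    [density_one]. This alters only the first argument of the functional, by a null set, and keeps
    its value. *)

Section rV_borel.
Context {R : realType}.
Implicit Types m : nat.

(** Positivity of [r] matters when [m = 0]: the right side is then vacuously true, while balls of
    nonpositive radius are empty. *)
Lemma rV_ballP m (x y : 'rV[R]_m) (r : R) : 0 < r ->
  ball x r y <-> forall i, `|x ord0 i - y ord0 i| < r.
Proof.
move=> r0; split => [[_ xy] i|xy]; first exact: xy.
by split => // i j; rewrite (ord1 i); exact: xy.
Qed.

Lemma rV_norm_lt m (x : 'rV[R]_m) (r : R) : 0 < r ->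
  `|x| < r <-> forall i, `|x ord0 i| < r.
Proof.
move=> r0; have := rV_ballP x 0 r0; rewrite -ball_normE /= subr0 => ->.
by split => + i => /(_ i); rewrite mxE subr0.
Qed.

Lemma rV_norm_ge m (x : 'rV[R]_m) i : `|x ord0 i| <= `|x|.
Proof.
apply/ler_addgt0Pr => e e0; apply/ltW.
have x0 : 0 < `|x| + e by rewrite (le_lt_trans (normr_ge0 x))// ltrDl.
by apply: (rV_norm_lt x x0).1; rewrite ltrDl.
Qed.

Lemma rV_norm_le m (x : 'rV[R]_m) (r : R) : 0 <= r ->
  (forall i, `|x ord0 i| <= r) -> `|x| <= r.
Proof.
move=> r0 xr; apply/ler_addgt0Pr => e e0; apply/ltW/rV_norm_lt.
  by rewrite ltr_wpDl.
by move=> i; rewrite (le_lt_trans (xr i))// ltrDl.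
Qed.

Lemma ball0_rV m (x : 'rV[R]_m) (r : R) : r <= 0 -> ball x r = set0.
Proof.
by move=> r0; apply/seteqP; split => // y [] /lt_le_trans/(_ r0); rewrite ltxx.
Qed.

Lemma measurable_rV_ball m (x : 'rV[R]_m) (r : R) : measurable (ball x r).
Proof.
have [r0|r0] := ltP 0 r; last by rewrite ball0_rV//; exact: measurable0.
rewrite (_ : ball x r = \big[setI/setT]_(i <- index_enum 'I_m)
    ((fun y : 'rV[R]_m => y ord0 i) @^-1` ball (x ord0 i) r)).
  apply: bigsetI_measurable => i _; rewrite -[X in measurable X]setTI.
  by apply: measurable_coor => //; exact: measurable_ball.
rewrite -bigcap_seq; apply/seteqP; split => y.
  by move/(rV_ballP _ _ r0) => xy i _; exact: xy.
by move=> H; apply/(rV_ballP _ _ r0) => i; apply: H; rewrite /= mem_index_enum.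
Qed.

(** Makes countable families of balls available, both for the measurability of open sets and for the
    covering in the density theorem. *)
Lemma rat_ball_between m (x : 'rV[R]_m) (r s : R) : 0 < r -> r < s ->
  exists (c : 'rV[rat]_m) (q : rat),
    [/\ ball (map_mx (ratr : rat -> R) c) (ratr q) x,
        ball x r `<=` ball (map_mx (ratr : rat -> R) c) (ratr q)
    & ball (map_mx (ratr : rat -> R) c) (ratr q) `<=` ball x s] /\ (r < ratr q) && (ratr q < s).
Proof.
(* The rational centre is off by less than [d] in each coordinate and the radius lies between
   [r + d] and [r + 2 d], so the rational ball contains [ball x r] and stays inside
   [ball x (r + 3 d)], where [r + 3 d < s]. *)
move=> r0 rs; pose d := (s - r) / 4.
have d0 : 0 < d by rewrite /d divr_gt0// subr_gt0.
have [q] := @rat_in_itvoo R (r + d) (r + d + d) ltac:(by rewrite ltrDl).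
rewrite in_itv/= => /andP[q1 q2].
have /choice[c cP] : forall i : 'I_m, exists c : rat, `|x ord0 i - ratr c| < d.
  move=> i; have [c] := @rat_in_itvoo R (x ord0 i - d) (x ord0 i + d) ltac:(lra).
  by rewrite in_itv/= => /andP[c1 c2]; exists c; rewrite ltr_norml; apply/andP; split; lra.
have q0 : 0 < ratr q :> R by lra.
exists (\row_i c i), q; split; last by apply/andP; split; rewrite /d in q1 q2 *; lra.
split.
- by apply/rV_ballP => // i; rewrite !mxE distrC (lt_trans (cP i))//; lra.
- move=> y /(rV_ballP _ _ r0) xy; apply/rV_ballP => // i; rewrite !mxE.
  have := cP i; have := xy i; rewrite !ltr_norml => /andP[a1 a2] /andP[b1 b2].
  by apply/andP; split; lra.
- move=> y /(rV_ballP _ _ q0) xy; apply/rV_ballP => [|i]; first exact: lt_trans rs.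
  have := cP i; have := xy i; rewrite !mxE !ltr_norml => /andP[a1 a2] /andP[b1 b2].
  by rewrite /d in q1 q2 b1 b2 *; apply/andP; split; lra.
Qed.

Lemma open_measurable_rV m (U : set 'rV[R]_m) : open U -> measurable U.
Proof.
move=> oU; pose B (p : 'rV[rat]_m * rat) : set 'rV[R]_m :=
  ball (map_mx (ratr : rat -> R) p.1) (ratr p.2).
rewrite (_ : U = \bigcup_p (if `[< B p `<=` U >] then B p else set0)).
  apply: countable_bigcupT_measurable => [|p]; first exact: countableP.
  by case: ifPn => _; [exact: measurable_rV_ball|exact: measurable0].
apply/seteqP; split => [x Ux|x [p _]]; last by case: ifPn => // /asboolP; apply.
have /nbhs_ballP[e /= e0 eU] : nbhs x U by exact: open_nbhs_nbhs.
have [c [q [[qx _ cq] _]]] :=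
  @rat_ball_between _ x (e / 2) e ltac:(lra) ltac:(lra).
by exists (c, q) => //; case: ifPn => // /asboolP; case => y /cq/eU.
Qed.

Lemma closed_measurable_rV m (U : set 'rV[R]_m) : closed U -> measurable U.
Proof.
move=> cU; rewrite -(setCK U); apply: measurableC; apply: open_measurable_rV.
exact: closed_openC.
Qed.

Lemma continuous_measurable_rV m (f : 'rV[R]_m -> R) :
  continuous f -> measurable_fun setT f.
Proof.
move=> /continuousP cf; apply: (measurability _ (RGenOpens.measurableE R)).
move=> _ [_ [a [b ->] <-]]; rewrite setTI; apply: open_measurable_rV.
exact/cf/interval_open.
Qed.

Lemma ge0_integral_rVS m (f : 'rV[R]_m.+1 -> \bar R) :
  measurable_fun setT f -> (forall x, (0 <= f x)%E) ->
  (\int[lebesgue_rV m.+1]_x f x =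
   \int[lebesgue_rV m]_y \int[lebesgue_measure]_s f (rV_snoc (y, s)))%E.
Proof.
move=> mf f0; rewrite /= /lebesgue_step.
rewrite ge0_integral_pushforward//=; last exact: measurable_rV_snoc.
rewrite preimage_setT fubini_tonelli1//=.
exact: measurableT_comp mf (@measurable_rV_snoc _ _).
Qed.

Lemma lebesgue_rVS m (A : set 'rV[R]_m.+1) : measurable A ->
  (lebesgue_rV m.+1 A =
   \int[lebesgue_rV m]_y lebesgue_measure [set s | A (rV_snoc (y, s))])%E.
Proof.
move=> mA; rewrite /= /lebesgue_step /pushforward /product_measure1/=.
apply: eq_integral => y _; congr (lebesgue_measure _).
by apply/seteqP; split => s; rewrite /xsection/= inE.
Qed.

(** Balls of the library norm are cubes, hence products of intervals. Covering arguments and kernels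
    below use these balls because their measure is explicit; Euclidean balls are compared with them
    when needed. *)
Lemma lebesgue_rV_ball m (x : 'rV[R]_m) (r : R) : 0 < r ->
  lebesgue_rV m (ball x r) = ((2 * r) ^+ m)%:E.
Proof.
move=> r0; elim: m x => [|m IH] x.
  by rewrite /= diracE mem_set// (thinmx0 x); exact: ballxx.
have -> : lebesgue_rV m.+1 (ball x r) =
    (lebesgue_rV m \x lebesgue_measure)%E (@rV_snoc R m @^-1` ball x r) by [].
rewrite (_ : _ @^-1` _ = ball (rV_unsnoc x).1 r `*` ball (x ord0 ord_max) r).
  rewrite product_measure1E; [|exact: measurable_rV_ball|exact: measurable_ball].
  rewrite [X in (X * _)%E]IH [X in (_ * X)%E](_ : _ = (r *+ 2)%:E).
    by rewrite -EFinM exprSr -[r *+ 2]mulr_natl.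
  by apply: lebesgue_measure_ball; exact: ltW.
apply/seteqP; split => [[y s]|[y s]] /=.
  move=> /(rV_ballP _ _ r0) xy; split.
    apply/rV_ballP => // i; have := xy (lift ord_max i).
    by rewrite /rV_snoc !mxE liftK.
  by have := xy ord_max; rewrite /rV_snoc mxE unlift_none.
move=> [/(rV_ballP _ _ r0) xy xs]; apply/rV_ballP => // i.
rewrite /rV_snoc mxE; case: unliftP => [j ->|->] /=; last exact: xs.
by have := xy j; rewrite mxE.
Qed.

Lemma lebesgue_measure_shift (a : R) (A : set R) : measurable A ->
  lebesgue_measure ((fun s => s + a) @^-1` A) = lebesgue_measure A.
Proof.
move=> mA; have mf : measurable_fun setT
  ((fun s => s + a) : measurableTypeR R -> measurableTypeR R).
  by apply: measurable_funD.
pose f : {mfun measurableTypeR R >-> measurableTypeR R} :=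
  HB.pack (fun s : R => s + a) (isMeasurableFun.Build _ _ _ _ _ mf).
apply/esym; apply: (@lebesgue_measure_unique _ (pushforward lebesgue_measure f)) => //.
move=> _ [[x y] _ <-] /=.
rewrite /pushforward (_ : _ @^-1` _ = `](x - a), (y - a)]%classic).
  by rewrite !lebesgue_measure_itv/= !lte_fin ltrD2r -!EFinD opprB addrA subrK.
by apply/seteqP; split => s; rewrite /= !in_itv/= lerBrDr ltrBlDr.
Qed.

Lemma measurable_rV_shift m (v : 'rV[R]_m) :
  measurable_fun setT (fun x : 'rV[R]_m => x + v).
Proof.
apply: measurable_rVP => i.
apply: (eq_measurable_fun (fun x : 'rV[R]_m => x ord0 i + v ord0 i)).
  by move=> x _; rewrite mxE.
by apply: measurable_funD => //; exact: measurable_coor.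
Qed.

(** Induction on the dimension: on each slice the last coordinate is shifted by invariance on the
    line, and the base is shifted by the induction hypothesis, read as an equality of measures with
    a pushforward. *)
Lemma lebesgue_rV_shift m (v : 'rV[R]_m) (A : set 'rV[R]_m) : measurable A ->
  lebesgue_rV m ((fun x => x + v) @^-1` A) = lebesgue_rV m A.
Proof.
elim: m v A => [|m IH] v A mA.
  by congr (lebesgue_rV 0 _); apply/seteqP; split => x /=;
    rewrite (thinmx0 (x + v)) (thinmx0 x).
have mvA : measurable ((fun x => x + v) @^-1` A).
  by rewrite -[X in measurable X]setTI; exact: measurable_rV_shift.
pose w := (rV_unsnoc v).1; pose a := v ord0 ord_max.
have snocD y s : rV_snoc (y, s) + v = rV_snoc (y + w, s + a).
  apply/rowP => i; rewrite !mxE; case: unliftP => [j ->|->] //=.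
  by rewrite !mxE.
have mg : measurable_fun setT
    (fun y => lebesgue_measure [set s | A (rV_snoc (y, s))]).
  have := @measurable_fun_xsection _ _ _ _ _ (@lebesgue_measure R)
    (@rV_snoc R m @^-1` A).
  rewrite (_ : _ \o _ = fun y => lebesgue_measure [set s | A (rV_snoc (y, s))]).
    by apply; rewrite -[X in measurable X]setTI; exact: measurable_rV_snoc.
  by apply/funext => y /=; congr (lebesgue_measure _); apply/seteqP; split => s;
    rewrite /xsection/= inE.
rewrite !lebesgue_rVS//.
transitivity (\int[pushforward (lebesgue_rV m) (fun y : 'rV[R]_m => y + w)%R]_y
    lebesgue_measure [set s | A (rV_snoc (y, s))])%E.
  rewrite ge0_integral_pushforward//=; last exact: measurable_rV_shift.
  rewrite preimage_setT; apply: eq_integral => y _ /=.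
  rewrite -(@lebesgue_measure_shift a [set s | A (rV_snoc (y + w, s))]); last first.
    have : measurable (@rV_snoc R m @^-1` A).
      by rewrite -[X in measurable X]setTI; exact: measurable_rV_snoc.
    move=> /(measurable_xsection (y + w)); congr measurable.
    by apply/seteqP; split => s; rewrite /xsection/= inE.
  by congr (lebesgue_measure _); apply/seteqP; split => s /=; rewrite snocD.
apply: eq_measure_integral => [|mw B mB _]; first exact: measurable_rV_shift.
exact: IH.
Qed.

Lemma ge0_integral_rV_shift m (v : 'rV[R]_m) (f : 'rV[R]_m -> \bar R) :
  measurable_fun setT f -> (forall x, (0 <= f x)%E) ->
  (\int[lebesgue_rV m]_x f (x + v)%R = \int[lebesgue_rV m]_x f x)%E.
Proof.
move=> mf f0; transitivity
    (\int[pushforward (lebesgue_rV m) (fun y : 'rV[R]_m => y + v)%R]_y f y)%E.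
  by rewrite ge0_integral_pushforward//=; exact: measurable_rV_shift.
apply: eq_measure_integral => [|mv B mB _]; first exact: measurable_rV_shift.
exact: lebesgue_rV_shift.
Qed.

Lemma integral_rV_shift m (v : 'rV[R]_m) (f : 'rV[R]_m -> \bar R) :
  measurable_fun setT f ->
  (\int[lebesgue_rV m]_x f (x + v)%R = \int[lebesgue_rV m]_x f x)%E.
Proof.
move=> mf; rewrite [LHS]integralE [RHS]integralE; congr (_ - _)%E.
  rewrite -(@ge0_integral_rV_shift _ v f^\+%E)//; first by apply: eq_integral => x _; rewrite ?funeposE ?funenegE.
  exact: measurable_funepos.
rewrite -(@ge0_integral_rV_shift _ v f^\-%E)//; first by apply: eq_integral => x _; rewrite ?funeposE ?funenegE.
exact: measurable_funeneg.
Qed.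

End rV_borel.

(** * Outer regularity of finite Borel measures on R^m *)

Section regularity.
Context {R : realType} {m : nat}.
Local Open Scope ereal_scope.

Lemma measure_bigcap_lt d (T : measurableType d) (nu : {measure set T -> \bar R})
    (F : nat -> set T) (a : \bar R) :
  nu setT < +oo -> (forall n, measurable (F n)) -> (forall n, F n.+1 `<=` F n) ->
  nu (\bigcap_n F n) < a -> exists N, nu (F N) < a.
Proof.
move=> nufin mF dF Fa.
have : nu (F n) @[n --> \oo] --> nu (\bigcap_n F n).
  apply: nonincreasing_cvg_mu => //.
  - by rewrite (le_lt_trans _ nufin)// le_measure ?inE.
  - exact: bigcap_measurable.
  - by apply/nonincreasing_seqP => n; exact/subsetPset.
move=> /(_ [set y | y < a]) []; last by move=> N _ /(_ N (leqnn _)); exists N.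
by apply: open_nbhs_nbhs; split => //; exact: open_ereal_lt_ereal.
Qed.

Definition half_space (p : 'I_m * R) : set 'rV[R]_m :=
  [set x | (p.2 < x ord0 p.1)%R].

Lemma measurable_sub_half_spaces :
  @measurable _ 'rV[R]_m `<=` <<s range half_space >>.
Proof.
apply: smallest_sub; first exact: smallest_sigma_algebra.
rewrite -bigcup_seq/=; apply: bigcup_sub => i _ _ [Y mY <-].
have : measurable_fun setT ((fun x : 'rV[R]_m => x ord0 i) :
    g_sigma_algebraType (range half_space) -> R).
  apply: (measurability _ (RGenOInfty.measurableE R)).
  move=> _ [_ [a ->] <-]; rewrite setTI; apply: sub_sigma_algebra.
  by exists (i, a) => //; apply/seteqP; split => x; rewrite /= in_itv/= andbT.
by apply.
Qed.

(** The sets with the two-sided property [P], a closed set inside and an open set outside with small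
    difference, form a sigma-algebra that contains the half-spaces. Both sides are needed for
    stability under complements, which exchange them. *)
Lemma outer_regular (nu : {measure set 'rV[R]_m -> \bar R}) (A : set 'rV[R]_m) :
  nu setT < +oo -> measurable A -> forall e : R, (0 < e)%R ->
  exists2 U, open U & A `<=` U /\ nu (U `\` A) <= e%:E.
Proof.
move=> nufin mA.
pose P (B : set 'rV[R]_m) := forall e : R, (0 < e)%R ->
  exists U C, [/\ open U, closed C, C `<=` B, B `<=` U & nu (U `\` C) < e%:E].
suff : P A.
  move=> PA e /PA[U [C [oU cC CA AU UC]]]; exists U => //; split => //.
  rewrite (le_trans _ (ltW UC))// le_measure ?inE//; last exact: setDS.
    by apply: measurableD => //; exact: open_measurable_rV.
  by apply: measurableD; [exact: open_measurable_rV|exact: closed_measurable_rV].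
move: A mA; apply: (subset_trans measurable_sub_half_spaces).
have fin B : measurable B -> nu B < +oo.
  by move=> mB; rewrite (le_lt_trans _ nufin)// le_measure ?inE.
apply: smallest_sub; last first.
  move=> _ [[i a] _ <-] e e0.
  (* These closed half-spaces exhaust the open one, so the differences decrease to the empty set. *)
  pose C n : set 'rV[R]_m := [set x | (a + n.+1%:R^-1 <= x ord0 i)%R].
  pose H := half_space (i, a).
  have ci : continuous (fun x : 'rV[R]_m => x ord0 i) by exact: coord_continuous.
  have oH : open H.
    by move/continuousP : ci => /(_ [set y | (a < y)%R] (@open_gt _ a)).
  have cC n : closed (C n).
    by move/continuous_closedP : ci =>
      /(_ [set y | (a + n.+1%:R^-1 <= y)%R] (@closed_ge _ _)).
  have mHC n : measurable (H `\` C n).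
    by apply: measurableD; [exact: open_measurable_rV|exact: closed_measurable_rV].
  have [||N HN] := @measure_bigcap_lt _ _ nu (fun n => H `\` C n) e%:E nufin mHC.
  - move=> n; apply: setDS => x /=; apply: le_trans.
    by rewrite lerD2l lef_pV2 ?posrE// ler_nat.
  - rewrite (_ : \bigcap_n _ = set0) ?measure0 ?lte_fin//.
    apply/seteqP; split => // x Hx; have [/= ax _] := Hx 0%N I.
    have xa0 : (0 < x ord0 i - a)%R by rewrite subr_gt0.
    have [n _ /(_ n (leqnn _)) /= nxa] := near_infty_natSinv_lt (PosNum xa0).
    by have [_ []] := Hx n I; rewrite /C /= addrC -lerBrDr ltW.
  - exists H, (C N); split => // x /=; apply: lt_le_trans.
    by rewrite ltrDl.
split.
- by move=> e e0; exists set0, set0; split; rewrite ?setD0 ?measure0 ?lte_fin//; exact: closed0.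
- move=> B PB e /PB[U [C [oU cC CB BU UC]]]; exists (~` C), (~` U); split.
  + exact: closed_openC.
  + exact: open_closedC.
  + by rewrite setTD; exact: subsetC.
  + by rewrite setTD; exact: subsetC.
  + by rewrite setDE setCK setIC -setDE.
- move=> F PF e e0.
  have e2 n : (0 < e / 2 / (2 ^ n.+1)%:R)%R by rewrite !divr_gt0// ltr0n expn_gt0.
  have /choice[UC HUC] : forall n, exists UC : set 'rV[R]_m * set 'rV[R]_m,
      [/\ open UC.1, closed UC.2, UC.2 `<=` F n, F n `<=` UC.1 &
        nu (UC.1 `\` UC.2) < (e / 2 / (2 ^ n.+1)%:R)%:E].
    by move=> n; have [U [C H]] := PF n _ (e2 n); exists (U, C).
  (* A countable union of closed sets need not be closed, so the inner approximation is a finite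
     union [D N]. The geometric errors add up to [e / 2] for the whole union, and continuity from
     above, where finiteness of [nu] enters, then provides an [N] with error below [e]. *)
  pose U := \bigcup_n (UC n).1; pose D N := \big[setU/set0]_(n < N) (UC n).2.
  have oU : open U by apply: bigcup_open => n _; have [] := HUC n.
  have cD N : closed (D N) by apply: closed_bigsetU => n _; have [] := HUC n.
  have mU := open_measurable_rV oU; have mD N := closed_measurable_rV (cD N).
  have mUC n : measurable ((UC n).1 `\` (UC n).2).
    have [? ? _ _ _] := HUC n.
    by apply: measurableD; [exact: open_measurable_rV|exact: closed_measurable_rV].
  have UD : nu (\bigcap_N (U `\` D N)) <= (e / 2)%:E.
    apply: (@le_trans _ _ (\sum_(n <oo) nu ((UC n).1 `\` (UC n).2))).
      apply: measure_sigma_subadditive => //.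
        by apply: bigcap_measurable => // N _; exact: measurableD.
      move=> x UDx; have [[n _ Un] _] := UDx 0%N I.
      exists n => //; split => //; have [_ nD] := UDx n.+1 I.
      by move=> Cx; apply: nD; rewrite /D -(bigcup_mkord _ (fun n => (UC n).2)); exists n => //=.
    have e20 : (0 <= e / 2)%R by rewrite divr_ge0// ltW.
    have := @epsilon_trick R (fun=> 0) (e / 2)%R xpredT (fun=> lexx _) e20.
    rewrite [X in _ <= X + _]eseries0// add0e; apply: le_trans; apply: lee_nneseries => // n _.
    by rewrite add0e; have [_ _ _ _ /ltW] := HUC n.
  have [|||N HN] := @measure_bigcap_lt _ _ nu (fun N => U `\` D N) e%:E nufin.
  - by move=> N; exact: measurableD.
  - by move=> N; apply: setDS; rewrite /D big_ord_recr; exact: subsetUl.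
  - by rewrite (le_lt_trans UD)// lte_fin ltr_pdivrMr// ltr_pMr// ltr1n.
  exists U, (D N); split => //.
  + rewrite /D -(bigcup_mkord _ (fun n => (UC n).2)) => x [n _ Cx]; exists n => //.
    by have [_ _ + _ _] := HUC n; exact.
  + by apply: subset_bigcup => n _; have [_ _ _ + _] := HUC n.
Qed.

End regularity.

(** * Covering by cubes and Lebesgue's density theorem *)

Section density.
Context {R : realType} {m : nat}.
Local Open Scope ereal_scope.

Lemma argmax_seq (T : eqType) (f : T -> R) (s : seq T) : s != [::] ->
  exists2 p, p \in s & forall q, q \in s -> (f q <= f p)%R.
Proof.
elim: s => // x [_ _|y s /(_ isT)[p ps pmax] _].
  by exists x; rewrite ?mem_head// => q; rewrite inE => /eqP ->.
have [xp|px] := leP (f x) (f p).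
  by exists p => [|q]; rewrite inE; [rewrite ps orbT|case/orP => [/eqP ->//|/pmax]].
exists x; first exact: mem_head.
by move=> q; rewrite inE => /orP[/eqP ->//|/pmax /le_trans]; apply; exact: ltW.
Qed.

(* Vitali's greedy selection, carried out on the measures: the largest ball [p]
   absorbs every ball it meets into its 3-fold dilation, and the remaining
   balls lie in [E `\` p]. *)
Lemma vitali_measure_le (mu nu : {measure set 'rV[R]_m -> \bar R}) (K : \bar R)
    (s : seq ('rV[R]_m * R)) (E : set 'rV[R]_m) :
  0 <= K -> measurable E ->
  (forall p, p \in s -> [/\ (0 < p.2)%R, ball p.1 p.2 `<=` E &
    mu (ball p.1 (3 * p.2)%R) <= K * nu (ball p.1 p.2)]) ->
  mu (\bigcup_(p in [set` s]) ball p.1 p.2) <= K * nu E.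
Proof.
move=> K0; have [n] := ubnP (size s); elim: n => // n IH in s E *.
rewrite ltnS => sn mE sE.
have mB (t : seq ('rV[R]_m * R)) : measurable (\bigcup_(p in [set` t]) ball p.1 p.2).
  by rewrite bigcup_seq; apply: bigsetU_measurable => p _; exact: measurable_rV_ball.
have [->|s0] := eqVneq s [::].
  rewrite (_ : \bigcup_(p in _) _ = set0); first by rewrite measure0 mule_ge0.
  by apply/seteqP; split => // x [].
have [p ps pmax] := argmax_seq (fun p => p.2) s0.
have [p0 pE pK] := sE _ ps.
pose t := [seq q <- s | `[< ball p.1 p.2 `&` ball q.1 q.2 = set0 >]].
have ts : (size t < n)%N.
  rewrite (leq_trans _ sn)// size_filter -(count_predC (fun q => `[< ball p.1 p.2 `&` ball q.1 q.2 = set0 >]) s).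
  rewrite -[X in (X < _)%N]addn0 ltn_add2l -has_count; apply/hasP; exists p => //=.
  apply/asboolPn => /seteqP[+ _] => /(_ p.1); apply.
  by split; exact: ballxx.
have mp := measurable_rV_ball p.1 p.2.
have : mu (\bigcup_(q in [set` t]) ball q.1 q.2) <= K * nu (E `\` ball p.1 p.2).
  apply: IH => //; first exact: measurableD.
  move=> q; rewrite mem_filter => /andP[/asboolP pq /sE[? qE ?]]; split => //.
  move=> x qx; split; first exact: qE.
  by move=> px; move/seteqP : pq => [+ _] => /(_ x); apply.
move=> IHt.
have : mu (\bigcup_(q in [set` s]) ball q.1 q.2) <=
    mu (ball p.1 (3 * p.2)%R) + mu (\bigcup_(q in [set` t]) ball q.1 q.2).
  apply: (@le_trans _ _ (mu (ball p.1 (3 * p.2)%R `|`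
      \bigcup_(q in [set` t]) ball q.1 q.2))); last first.
    by apply: measureU2 => //; exact: measurable_rV_ball.
  rewrite le_measure ?inE//; first by apply: measurableU => //; exact: measurable_rV_ball.
  move=> x [q /= qs qx].
  have [pq|/eqP/set0P[z [pz qz]]] :=
      pselect (ball p.1 p.2 `&` ball q.1 q.2 = set0).
    by right; exists q => //=; rewrite mem_filter qs andbT; exact/asboolP.
  left; have qp : (q.2 <= p.2)%R by exact: pmax.
  move: pz qz qx; rewrite -!ball_normE/= => pz qz qx.
  rewrite (_ : p.1 - x = (p.1 - z) - (q.1 - z) + (q.1 - x))%R; last by rewrite opprB !addrA !subrK.
  have := ler_normD (p.1 - z - (q.1 - z))%R (q.1 - x)%R.
  have := ler_normB (p.1 - z)%R (q.1 - z)%R.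
  by lra.
move=> /le_trans; apply; apply: (le_trans (leeD pK IHt)).
rewrite -ge0_muleDr//; apply: lee_wpmul2l => //.
rewrite -measureU//; last 2 first.
  exact: measurableD.
  by apply/seteqP; split => // x [] ? [].
by rewrite setDUK.
Qed.

(** Density zero with respect to cubes. Comparing with [r ^+ m] instead of the measure of the ball
    changes [e] by the factor [2 ^+ m] only, and avoids a quotient of extended reals. *)
Definition zero_density (A : set 'rV[R]_m) (x : 'rV[R]_m) :=
  forall e : R, (0 < e)%R -> exists2 d : R, (0 < d)%R &
    forall r, (0 < r < d)%R -> lebesgue_rV m (A `&` ball x r) <= (e * r ^+ m)%:E.

Lemma negligible_approx (mu : {measure set 'rV[R]_m -> \bar R}) (Z : set 'rV[R]_m) :
  (forall e : R, (0 < e)%R -> exists2 W, measurable W & Z `<=` W /\ mu W <= e%:E) ->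
  mu.-negligible Z.
Proof.
move=> HZ; have /choice[W HW] : forall n, exists W,
    [/\ measurable W, Z `<=` W & mu W <= (n.+1%:R^-1)%R%:E].
  move=> n; have [|W mW [ZW We]] := HZ (n.+1%:R^-1)%R; first by rewrite invr_gt0.
  by exists W.
have mW : measurable (\bigcap_n W n).
  by apply: bigcap_measurable => // n _; have [] := HW n.
exists (\bigcap_n W n); split => //; last first.
  by move=> x Zx n _; have [_ + _] := HW n; exact.
apply/eqP; rewrite -measure_le0; apply/lee_addgt0Pr => e e0; rewrite add0e.
have [n _ /(_ n (leqnn _)) /= ne] := near_infty_natSinv_lt (PosNum e0).
have [mWn _ Wn] := HW n.
have ne' : (n.+1%:R^-1)%R%:E <= e%:E by rewrite lee_fin ltW.
apply: le_trans (le_trans Wn ne').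
by rewrite le_measure ?inE//; exact: bigcap_inf.
Qed.

(** Lebesgue's density theorem. [Z N k] collects the points of [A] in a bounded cube around which
    the complement occupies more than [r ^+ m / k.+1] at arbitrarily small scales [r]. Outer
    regularity puts [A], inside that cube, into an open set with little room outside [A]; the Vitali
    estimate, applied to the measure restricted to the complement of [A], bounds the cover of
    [Z N k] by [K] times that room. *)
Lemma zero_density_setC (A : set 'rV[R]_m) : measurable A ->
  {ae lebesgue_rV m, forall x, A x -> zero_density (~` A) x}.
Proof.
move=> mA; pose mu := @lebesgue_rV R m.
pose Z (N k : nat) := [set x | [/\ A x, ball 0%R N.+1%:R x &
  forall d : R, (0 < d)%R -> exists2 r, (0 < r < d)%R &
    (k.+1%:R^-1 * r ^+ m)%R%:E < mu (~` A `&` ball x r)]].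
suff negZ N k : mu.-negligible (Z N k).
  have := negligible_bigcup (fun N => negligible_bigcup (negZ N)).
  apply: negligibleS => x /= /not_implyP[Ax].
  move=> /existsNP[e /not_implyP[e0 He]].
  exists (Num.truncn `|x|) => //.
  have [k _ /(_ k (leqnn _)) /= ke] := near_infty_natSinv_lt (PosNum e0).
  exists k => //; split => //.
    by rewrite -ball_normE /= sub0r normrN truncnS_gt.
  move=> d d0; apply: contrapT => Hr; apply: He; exists d => // r /andP[r0 rd].
  rewrite leNgt; apply/negP => He; apply: Hr; exists r; first by rewrite r0.
  by apply: le_lt_trans He; rewrite lee_fin ler_wpM2r// ?exprn_ge0 ?ltW.
apply: negligible_approx => e e0.
pose Q := ball (0%R : 'rV[R]_m) N.+1%:R.
have mQ : measurable Q by exact: measurable_rV_ball.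
have oQ : open Q by exact: ball_open.
pose nu := mrestr mu mQ.
pose K : R := (12 ^+ m * k.+1%:R)%R.
have K0 : (0 < K)%R by rewrite mulr_gt0// exprn_gt0.
have [|||U oU [AU Ue]] := @outer_regular _ m nu (A `&` Q) _ _ (e / K)%R.
- by rewrite /nu /= /mrestr setTI lebesgue_rV_ball// ltry.
- exact: measurableI.
- exact: divr_gt0.
have {}Ue : mu ((U `&` Q) `\` A) <= (e / K)%:E.
  move: Ue; rewrite /nu /= /mrestr; congr (mu _ <= _).
  apply/seteqP; split => x /=; tauto.
pose E := U `&` Q.
have oE : open E by exact: openI.
have mE := open_measurable_rV oE.
pose nA := mrestr mu (measurableC mA).
pose B (p : 'rV[rat]_m * rat) : set 'rV[R]_m :=
  ball (map_mx (ratr : rat -> R) p.1) (ratr p.2).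
pose J (p : 'rV[rat]_m * rat) := `[< [/\ (0 < (ratr p.2 : R))%R, B p `<=` E &
  mu (ball (map_mx (ratr : rat -> R) p.1) (3 * ratr p.2)%R) <= K%:E * nA (B p)] >].
(* The Vitali estimate concerns finite families: admissible rational balls are enumerated through
   [pickle], and the bound passes to the increasing union of the [G n]. *)
pose s n : seq ('rV[R]_m * R) :=
  [seq (map_mx (ratr : rat -> R) p.1, ratr p.2) |
    p <- pmap unpickle (iota 0 n) & J p].
pose G n := \bigcup_(p in [set` s n]) ball p.1 p.2.
have mG n : measurable (G n).
  by rewrite /G bigcup_seq; apply: bigsetU_measurable => p _; exact: measurable_rV_ball.
have Ge n : mu (G n) <= e%:E.
  apply: (@le_trans _ _ (K%:E * nA E)).
    apply: vitali_measure_le => //; first by rewrite lee_fin ltW.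
    by move=> p /mapP[q]; rewrite mem_filter => /andP[/asboolP[? ? ?] _] ->.
  rewrite (_ : e%:E = K%:E * (e / K)%:E).
    by apply: lee_wpmul2l; [rewrite lee_fin ltW|exact: Ue].
  by rewrite -EFinM mulrC divfK ?gt_eqF.
exists (\bigcup_n G n); first exact: bigcup_measurable.
split.
  move=> x [Ax Qx xbad].
  have /nbhs_ballP[d /= d0 dE] : nbhs x E.
    by apply: open_nbhs_nbhs; split => //; split => //; exact: AU.
  (* Half of [d], since the rational ball found inside [ball x (2 * r)] has to stay in [E]. *)
  have [|r /andP[r0 rd] rA] := xbad (d / 2)%R; first by rewrite divr_gt0.
  have [|c [q [[qx rq qr] /andP[q1 q2]]]] := @rat_ball_between _ m x r (2 * r)%R r0; first by lra.
  have q0 : (0 < ratr q :> R)%R by lra.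
  have Jp : J (c, q).
    apply/asboolP; split => //=.
      by apply: subset_trans qr _; apply: subset_trans dE; apply: le_ball; lra.
    rewrite [X in X <= _]lebesgue_rV_ball; last by lra.
    apply: (@le_trans _ _ (K%:E * (k.+1%:R^-1 * r ^+ m)%R%:E)).
      have -> : K%:E * (k.+1%:R^-1 * r ^+ m)%R%:E = ((12 * r) ^+ m)%:E.
        by rewrite -EFinM /K mulrA mulfK ?gt_eqF// exprMn.
      by rewrite lee_fin lerXn2r ?nnegrE; lra.
    apply: lee_wpmul2l; first by rewrite lee_fin ltW.
    apply: (le_trans (ltW rA)); rewrite /nA /= /mrestr setIC.
    rewrite le_measure ?inE//; [| |exact: setSI].
      by apply: measurableI; [exact: measurable_rV_ball|exact: measurableC].
    by apply: measurableI; [exact: measurable_rV_ball|exact: measurableC].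
  exists (pickle (c, q)).+1 => //; exists (map_mx (ratr : rat -> R) c, ratr q) => //.
  apply/mapP; exists (c, q) => //; rewrite mem_filter Jp andTb mem_pmap; apply/mapP.
  exists (pickle (c, q)); last by rewrite pickleK.
  by rewrite mem_iota add0n ltnSn.
have cG : mu (G n) @[n --> \oo] --> mu (\bigcup_n G n).
  apply: nondecreasing_cvg_mu => //; first exact: bigcup_measurable.
  apply/nondecreasing_seqP => n; apply/subsetPset => x [p /= ps px]; exists p => //=.
  move/mapP : ps => [q]; rewrite mem_filter => /andP[Jq qn] ->.
  apply/mapP; exists q => //; rewrite mem_filter Jq andTb.
  move: qn; rewrite !mem_pmap => /mapP[i]; rewrite mem_iota => /andP[_ ni] ->.
  apply: map_f; rewrite mem_iota; apply/andP; split=> //.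
  by apply: (leq_trans ni); rewrite !add0n.
rewrite [leLHS](_ : _ = limn (fun n => mu (G n))).
  by apply: lime_le; [apply/cvg_ex; eexists; exact: cG|exact: nearW].
by apply/esym/cvg_lim.
Qed.

End density.

(** * Mollification *)

Section bump.
Context {R : realType}.
Implicit Types s t h : R.

Definition clip s : R := if s <= -1 then -1 else if 1 <= s then 1 else s.

Lemma clip_bound s : -1 <= clip s <= 1.
Proof.
by rewrite /clip; case: (leP s (-1)); case: (leP 1 s) => *; apply/andP; split; lra.
Qed.

Lemma clipN s : clip (- s) = - clip s.
Proof.
by rewrite /clip; case: (leP (- s) (-1)); case: (leP 1 (- s));
  case: (leP s (-1)); case: (leP 1 s) => *; lra.
Qed.

Lemma clip_lip s t : `|clip s - clip t| <= `|s - t|.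
Proof.
have H (x y : R) : x <= y -> clip x <= clip y <= clip x + (y - x).
  rewrite /clip => xy; apply/andP; split; case: (leP x (-1)); case: (leP 1 x);
  case: (leP y (-1)); case: (leP 1 y) => *; lra.
case: (leP s t) => st.
  rewrite (@ler0_norm _ (s - t)) ?subr_le0//; have /andP[a b] := H _ _ st.
  by rewrite ler_norml; apply/andP; split; lra.
rewrite (@gtr0_norm _ (s - t)) ?subr_gt0//; have /andP[a b] := H _ _ (ltW st).
by rewrite ler_norml; apply/andP; split; lra.
Qed.

(* The C^{1,1} bump (1 - s^2)^2 on [-1, 1], extended by 0. *)
Definition bump s : R := (1 - clip s ^+ 2) ^+ 2.

Definition dbump s : R := - (4 * clip s * (1 - clip s ^+ 2)).

Lemma bump_ge0 s : 0 <= bump s. Proof. exact: sqr_ge0. Qed.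

Lemma bump_le1 s : bump s <= 1.
Proof.
rewrite /bump; have /andP[w1 w2] := clip_bound s; have u0 := sqr_ge0 (clip s).
have u1 : clip s ^+ 2 <= 1 by nra.
by move: (clip s ^+ 2) u0 u1 => u u0 u1; nra.
Qed.

Lemma bumpN s : bump (- s) = bump s.
Proof. by rewrite /bump clipN sqrrN. Qed.

Lemma dbumpN s : dbump (- s) = - dbump s.
Proof. by rewrite /dbump clipN sqrrN mulrN mulNr. Qed.

Lemma bump_eq0 s : 1 <= `|s| -> bump s = 0.
Proof.
rewrite ler_normr /bump /clip => /orP[s1|s1]; case: (leP s (-1)); case: (leP 1 s) => *;
  rewrite ?expr1n ?sqrrN ?expr1n ?subrr ?expr0n//; lra.
Qed.

Lemma bump_ge_half s : `|s| <= 1 / 2 -> 1 / 2 <= bump s.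
Proof.
rewrite ler_norml => /andP[s1 s2]; rewrite /bump /clip.
by case: (leP s (-1)); case: (leP 1 s) => *; nra.
Qed.

Lemma dbump_bound s : `|dbump s| <= 4.
Proof.
rewrite /dbump normrN; have /andP[w1 w2] := clip_bound s; have u0 := sqr_ge0 (clip s).
have u1 : clip s ^+ 2 <= 1 by nra.
move: (clip s ^+ 2) u0 u1 => u u0 u1; rewrite ler_norml.
have v0 : 0 <= 1 - u by lra.
have p1 := mulr_ge0 v0 (_ : 0 <= 1 - clip s); have p2 := mulr_ge0 v0 (_ : 0 <= 1 + clip s).
have {}p1 := p1 ltac:(lra); have {}p2 := p2 ltac:(lra).
by apply/andP; split; lra.
Qed.

Lemma bump_lip s t : `|bump s - bump t| <= 8 * `|s - t|.
Proof.
apply: le_trans (_ : 8 * `|clip s - clip t| <= _); last by rewrite ler_pM2l// clip_lip.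
rewrite /bump; have /andP[] := clip_bound s; have /andP[] := clip_bound t.
move: (clip s) (clip t) => w z *.
rewrite (_ : _ - _ = (z + w) * (2 - w ^+ 2 - z ^+ 2) * (z - w)); last by ring.
rewrite normrM (distrC w) ler_wpM2r//.
by rewrite ler_norml; apply/andP; split; nra.
Qed.

Lemma dbump_lip s t : `|dbump s - dbump t| <= 16 * `|s - t|.
Proof.
apply: le_trans (_ : 16 * `|clip s - clip t| <= _); last by rewrite ler_pM2l// clip_lip.
rewrite /dbump; have /andP[] := clip_bound s; have /andP[] := clip_bound t.
move: (clip s) (clip t) => w z *.
rewrite (_ : _ - _ = 4 * (w ^+ 2 + w * z + z ^+ 2 - 1) * (w - z)); last by ring.
rewrite normrM ler_wpM2r//.
by rewrite ler_norml; apply/andP; split; nra.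
Qed.

(** A quadratic remainder with a constant uniform in [s], across the gluing points -1 and 1 as well.
    Such a bound can be integrated against a kernel, which lets convolutions be differentiated under
    the integral sign. *)
Lemma bump_taylor s h : `|bump (s + h) - bump s - h * dbump s| <= 24 * h ^+ 2.
Proof.
pose w := clip s; pose d := clip (s + h) - w.
have dh : d ^+ 2 <= h ^+ 2.
  rewrite -(real_normK (num_real d)) -(real_normK (num_real h)) lerXn2r ?nnegrE//.
  by have := clip_lip (s + h) s; rewrite addrAC subrr add0r.
have w1 : -1 <= w <= 1 by exact: clip_bound.
have d2 : -2 <= d <= 2.
  by have := clip_bound (s + h); rewrite /d; move: w1 => /andP[? ?] /andP[? ?]; apply/andP; split; lra.
(* With [w] the clipped argument and [d] its increment, the first summand is the exact Taylor
   remainder of the polynomial [(1 - w ^+ 2) ^+ 2]; the second one corrects for [d] differing from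
   [h]. *)
have -> : bump (s + h) - bump s - h * dbump s =
    d ^+ 2 * (6 * w ^+ 2 - 2 + 4 * w * d + d ^+ 2) + dbump s * (d - h).
  by rewrite /bump (_ : clip (s + h) = w + d) /dbump -/w /d; ring.
have A : `|d ^+ 2 * (6 * w ^+ 2 - 2 + 4 * w * d + d ^+ 2)| <= 16 * h ^+ 2.
  rewrite normrM (ger0_norm (sqr_ge0 d)) mulrC.
  apply: ler_pM => //; first exact: sqr_ge0.
  move: w1 d2 => /andP[? ?] /andP[? ?].
  by rewrite ler_norml; apply/andP; split; nra.
(* If [s] is clipped, [dbump s = 0]. If only [s + h] is, then [s] is within [|h|] of 1 or -1, where
   [dbump] vanishes linearly ([K1], [K2]). Otherwise [d = h]. *)
have B : `|dbump s * (d - h)| <= 8 * h ^+ 2.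
  have W (v : R) : -1 <= v <= 1 -> `|v| <= 1 by rewrite ler_norml.
  have K1 : `|dbump s| <= 8 * (1 - w).
    rewrite (_ : dbump s = w * (- (4 * (1 + w) * (1 - w)))); last by rewrite /dbump -/w; ring.
    rewrite normrM normrN; apply: le_trans (ler_piMl (normr_ge0 _) (W _ w1)) _.
    by move: w1 => /andP[? ?]; rewrite ger0_norm; nra.
  have K2 : `|dbump s| <= 8 * (1 + w).
    rewrite (_ : dbump s = w * (- (4 * (1 - w) * (1 + w)))); last by rewrite /dbump -/w; ring.
    rewrite normrM normrN; apply: le_trans (ler_piMl (normr_ge0 _) (W _ w1)) _.
    by move: w1 => /andP[? ?]; rewrite ger0_norm; nra.
  rewrite normrM; have := normr_ge0 (dbump s); have h0 := sqr_ge0 h.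
  move: K1 K2; rewrite {A dh d2 w1} /d /w; move: `|dbump s| => K; rewrite /clip.
  case: (leP s (-1)) => s1; [|case: (leP 1 s) => s2].
  - by move=> K1 K2 K0; rewrite (_ : K = 0) ?mul0r; lra.
  - by move=> K1 K2 K0; rewrite (_ : K = 0) ?mul0r; lra.
  case: (leP (s + h) (-1)) => s3; [|case: (leP 1 (s + h)) => s4] => K1 K2 K0.
  - by rewrite ger0_norm; [nra|lra].
  - by rewrite ler0_norm; [nra|lra].
  - by rewrite (_ : s + h - s - h = 0) ?normr0 ?mulr0; [lra|ring].
by rewrite (le_trans (ler_normD _ _))//; lra.
Qed.

End bump.

Section kernel.
Context {R : realType} {m : nat}.
Implicit Types (x y : 'rV[R]_m) (e : R).

(** The factors are replaced one at a time, and all the others have absolute value at most 1. This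
    is the reason for the normalization of the kernel factors. *)
Lemma prod_dist_le (I : Type) (s : seq I) (a b : I -> R) :
  (forall i, `|a i| <= 1) -> (forall i, `|b i| <= 1) ->
  `|\prod_(i <- s) a i - \prod_(i <- s) b i| <= \sum_(i <- s) `|a i - b i|.
Proof.
move=> a1 b1; elim: s => [|i s IH]; first by rewrite !big_nil subrr normr0.
rewrite !big_cons; set A := \prod_(_ <- _) _; set B := \prod_(_ <- _) _.
rewrite (_ : _ - _ = (a i - b i) * A + b i * (A - B)); last by ring.
rewrite (le_trans (ler_normD _ _))// lerD//; rewrite normrM.
  rewrite ler_piMr// /A normr_prod; apply: prodr_ile1 => j _.
  by rewrite normr_ge0 a1.
by rewrite (le_trans _ IH)// ler_piMl.
Qed.

Definition rho e x : R := \prod_j bump (x ord0 j / e).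

(* [4 / e * drho1 e i] is the [i]-th partial derivative of [rho e]; all factors
   of [drho1] have absolute value at most 1. *)
Definition drho1 e (i : 'I_m) x : R :=
  \prod_j (if j == i then dbump (x ord0 j / e) / 4 else bump (x ord0 j / e)).

Definition drho e i x := 4 / e * drho1 e i x.

Lemma rho_ge0 e x : 0 <= rho e x.
Proof. by apply: prodr_ge0 => j _; exact: bump_ge0. Qed.

Lemma rho_le1 e x : rho e x <= 1.
Proof. by apply: prodr_ile1 => j _; rewrite bump_ge0 bump_le1. Qed.

Lemma rhoN e x : rho e (- x) = rho e x.
Proof. by apply: eq_bigr => j _; rewrite mxE mulNr bumpN. Qed.

Lemma drhoN e i x : drho e i (- x) = - drho e i x.
Proof.
rewrite /drho -mulrN; congr (_ * _); rewrite /drho1 (bigD1 i)//= [in RHS](bigD1 i)//=.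
rewrite !eqxx (_ : (- x) ord0 i / e = - (x ord0 i / e)); last by rewrite mxE mulNr.
have -> : \prod_(j < m | j != i) (if j == i then dbump ((- x) ord0 j / e) / 4
    else bump ((- x) ord0 j / e)) = \prod_(j < m | j != i)
    (if j == i then dbump (x ord0 j / e) / 4 else bump (x ord0 j / e)).
  by apply: eq_bigr => j /negbTE ->; rewrite mxE mulNr bumpN.
by rewrite dbumpN !mulNr.
Qed.

Lemma rho_eq0 e x : 0 < e -> e <= `|x| -> rho e x = 0.
Proof.
move=> e0; have [xe|] := pselect (forall i, `|x ord0 i| < e).
  by move/(rV_norm_lt _ e0) : xe => /lt_geF ->.
move=> /existsNP[i /negP]; rewrite -leNgt => ei _.
rewrite /rho (bigD1 i)//= bump_eq0 ?mul0r// normrM normfV (gtr0_norm e0).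
by rewrite ler_pdivlMr// mul1r.
Qed.

Lemma rho_ge e x : 0 < e -> `|x| < e / 2 -> (1 / 2) ^+ m <= rho e x.
Proof.
move=> e0 xe; rewrite -[in X in X <= _](card_ord m) -prodr_const.
apply: ler_prod => j _; rewrite divr_ge0//=; apply: bump_ge_half.
rewrite normrM normfV (gtr0_norm e0) ler_pdivrMr//.
by rewrite (le_trans (rV_norm_ge x j))//; lra.
Qed.

Let bump1 (t : R) : `|bump t| <= 1.
Proof. by rewrite ger0_norm ?bump_ge0 ?bump_le1. Qed.

Let dbump1 (t : R) : `|dbump t / 4| <= 1.
Proof. by rewrite normrM normfV (@ger0_norm _ 4)// ler_pdivrMr// mul1r dbump_bound. Qed.

Lemma drho1_bound e i x : `|drho1 e i x| <= 1.
Proof.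
rewrite normr_prod; apply: prodr_ile1 => j _; rewrite normr_ge0/=.
by case: ifPn => _.
Qed.

Lemma drho_bound e i x : 0 < e -> `|drho e i x| <= 4 / e.
Proof.
move=> e0; have e4 : 0 <= 4 / e by rewrite divr_ge0// ltW.
by rewrite normrM ger0_norm// ler_piMr ?drho1_bound.
Qed.

Lemma rV_div_dist e x y j : 0 < e ->
  `|x ord0 j / e - y ord0 j / e| <= `|x - y| / e.
Proof.
move=> e0; rewrite -mulrBl normrM normfV (gtr0_norm e0) ler_pM2r ?invr_gt0//.
by have := rV_norm_ge (x - y) j; rewrite !mxE.
Qed.

Lemma rho_lip e x y : 0 < e -> `|rho e x - rho e y| <= (8 * m%:R / e) * `|x - y|.
Proof.
move=> e0; rewrite (le_trans (prod_dist_le _ _ _))//.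
apply: (@le_trans _ _ (\sum_(j < m) 8 / e * `|x - y|)).
  apply: ler_sum => j _; rewrite (le_trans (bump_lip _ _))//.
  by have := rV_div_dist x y j e0; lra.
by rewrite sumr_const card_ord -mulr_natr; lra.
Qed.

Lemma drho_lip e i x y : 0 < e ->
  `|drho e i x - drho e i y| <= (4 / e) * (8 * m%:R / e) * `|x - y|.
Proof.
move=> e0; have e4 : 0 <= 4 / e by rewrite divr_ge0// ltW.
rewrite -mulrBr normrM (ger0_norm e4) -mulrA; apply: ler_wpM2l => //.
rewrite (le_trans (prod_dist_le _ _ _))//.
- by move=> j; case: ifPn.
- by move=> j; case: ifPn.
apply: (@le_trans _ _ (\sum_(j < m) 8 / e * `|x - y|)).
  apply: ler_sum => j _; have := rV_div_dist x y j e0; case: ifPn => _ H.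
    rewrite -mulrBl normrM normfV (@ger0_norm _ 4)// ler_pdivrMr//.
    have H0 : 0 <= `|x - y| / e by rewrite divr_ge0// ltW.
    by rewrite (le_trans (dbump_lip _ _))//; lra.
  by rewrite (le_trans (bump_lip _ _))//; lra.
by rewrite sumr_const card_ord -mulr_natr; lra.
Qed.

(** Only the factor of index [i] moves, by [h / e] in its own variable, so the one-dimensional
    estimate carries over. *)
Lemma rho_taylor e i x h : 0 < e ->
  `|rho e (h *: delta_mx ord0 i + x) - rho e x - h * drho e i x| <=
  24 / e ^+ 2 * h ^+ 2.
Proof.
move=> e0; rewrite /drho /drho1 /rho (bigD1 i)//= [X in _ - X - _](bigD1 i)//=.
rewrite [X in _ * (_ * X)](bigD1 i)//= eqxx.
rewrite [X in _ * X - _ - _](eq_bigr (fun j => bump (x ord0 j / e))); last first.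
  by move=> j ji; rewrite !mxE eqxx (negbTE ji) mulr0 add0r.
rewrite [X in _ - _ * (_ * (_ * X))](eq_bigr (fun j => bump (x ord0 j / e))); last first.
  by move=> j /negbTE ->.
set P := \prod_(_ | _) _; rewrite !mxE !eqxx mulr1.
rewrite (_ : _ - _ - _ = (bump (x ord0 i / e + h / e) - bump (x ord0 i / e) -
    h / e * dbump (x ord0 i / e)) * P); last first.
  by rewrite [h + _]addrC mulrDl; field; rewrite gt_eqF.
rewrite normrM; apply: (@le_trans _ _ (24 * (h / e) ^+ 2)); last first.
  by rewrite exprMn exprVn; lra.
rewrite -[leRHS]mulr1; apply: ler_pM => //; first exact: bump_taylor.
by rewrite normr_prod; apply: prodr_ile1 => j _; rewrite normr_ge0 bump1.
Qed.

Lemma lip_continuous (f : 'rV[R]_m -> R) (C : R) :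
  (forall x y, `|f x - f y| <= C * `|x - y|) -> continuous f.
Proof.
move=> fC x; apply/(@cvgrPdist_lt R R _ (nbhs x) (nbhs_filter x)) => eps eps0.
have C0 : 0 < `|C| + 1 by rewrite ltr_wpDl.
near=> y; rewrite (le_lt_trans (fC x y))//.
apply: (@le_lt_trans _ _ ((`|C| + 1) * `|x - y|)).
  by rewrite ler_wpM2r// (le_trans (ler_norm _))// lerDl.
rewrite mulrC -ltr_pdivlMr//.
have : ball x (eps / (`|C| + 1)) y by near: y; apply: nbhsx_ballx; rewrite divr_gt0.
by rewrite -ball_normE.
Unshelve. all: by end_near.
Qed.

Lemma continuous_rho e : 0 < e -> continuous (rho e).
Proof. by move=> e0; apply: lip_continuous => x y; exact: rho_lip. Qed.

Lemma continuous_drho e i : 0 < e -> continuous (drho e i).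
Proof. by move=> e0; apply: lip_continuous => x y; exact: drho_lip. Qed.

End kernel.

(** * Integrals of real-valued functions and bounded kernels *)

Section integral_aux.
Context {R : realType} d (T : measurableType d) (mu : {measure set T -> \bar R}).
Implicit Types f g K : T -> R.

Lemma EFin_Rintegral D f : measurable D -> mu.-integrable D (EFin \o f) ->
  (\int[mu]_(x in D) f x)%:E = (\int[mu]_(x in D) (f x)%:E)%E.
Proof. by move=> mD fi; rewrite /Rintegral fineK//; exact: integrable_fin_num. Qed.

Lemma Rintegral_sum (I : Type) (s : seq I) (f : I -> T -> R) :
  (forall i, mu.-integrable setT (EFin \o f i)) ->
  \int[mu]_x (\sum_(i <- s) f i x) = \sum_(i <- s) \int[mu]_x f i x.
Proof.
move=> fi; elim: s => [|i s IH].
  by rewrite big_nil; under eq_Rintegral do rewrite big_nil; rewrite Rintegral_cst// mul0r.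
rewrite big_cons -IH -RintegralD//; first by apply: eq_Rintegral => x _; rewrite big_cons.
apply: (eq_integrable _ (fun x => (\sum_(i <- s) (f i x)%:E)%E)) => //.
  by move=> x _; rewrite /= sumEFin.
by apply: (@integrable_sum _ _ _ mu setT measurableT I s xpredT (fun i x => (f i x)%:E)) => j _; exact: fi.
Qed.

Lemma integrable_kernel K g (C : R) : measurable_fun setT K ->
  (forall x, `|K x| <= C) -> mu.-integrable setT (EFin \o g) ->
  mu.-integrable setT (EFin \o (fun x => K x * g x)).
Proof.
move=> mK KC gi; apply: (eq_integrable _ ((EFin \o K) \* (EFin \o g))%E) => //.
apply: integrableMr => //; exists C; split; first exact: num_real.
by move=> M CM x _ /=; rewrite (le_trans (KC x))// ltW.
Qed.

Lemma Rintegral_kernel_le K g (C : R) : measurable_fun setT K ->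
  (forall x, `|K x| <= C) -> mu.-integrable setT (EFin \o g) ->
  `|\int[mu]_x (K x * g x)| <= C * \int[mu]_x `|g x|.
Proof.
move=> mK KC gi; have Kgi := integrable_kernel mK KC gi.
have gi' : mu.-integrable setT (EFin \o (fun x => `|g x|)) by exact: integrable_norm.
rewrite (le_trans (le_normr_Rintegral _ Kgi))// -RintegralZl//.
apply: le_Rintegral => //; first exact: (integrable_norm Kgi).
  apply: (eq_integrable _ (fun x => C%:E * `|g x|%:E)%E) => //.
  exact: integrableZl.
by move=> x _; rewrite normrM ler_wpM2r.
Qed.

Lemma integrable_indic_lty (A : set T) : measurable A -> (mu A < +oo)%E ->
  mu.-integrable setT (EFin \o (\1_A : T -> R)).
Proof.
move=> mA Aoo; apply/integrableP; split; first by apply/measurable_EFinP; exact: measurable_indic.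
rewrite (eq_integral (fun x => (\1_A x)%:E)) ?integral_indic ?setIT//.
by move=> x _; rewrite /= ger0_norm.
Qed.

Lemma integrable_scale (c : R) f : mu.-integrable setT (EFin \o f) ->
  mu.-integrable setT (EFin \o (fun x => c * f x)).
Proof.
move=> fi; apply: (eq_integrable _ (fun x => c%:E * (f x)%:E)%E) => //.
exact: integrableZl.
Qed.

Lemma integrable_Rsum (I : Type) (s : seq I) (f : I -> T -> R) :
  (forall i, mu.-integrable setT (EFin \o f i)) ->
  mu.-integrable setT (EFin \o (fun x => \sum_(i <- s) f i x)).
Proof.
move=> fi; apply: (eq_integrable _ (fun x => (\sum_(i <- s) (f i x)%:E)%E)) => //.
  by move=> x _; rewrite /= sumEFin.
by apply: (@integrable_sum _ _ _ mu setT measurableT I s xpredT (fun i x => (f i x)%:E)) => j _; exact: fi.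
Qed.

Lemma integrable_add f g : mu.-integrable setT (EFin \o f) ->
  mu.-integrable setT (EFin \o g) ->
  mu.-integrable setT (EFin \o (fun x => f x + g x)).
Proof. by move=> fi gi; exact: (integrableD _ fi gi). Qed.

Lemma integrable_sub f g : mu.-integrable setT (EFin \o f) ->
  mu.-integrable setT (EFin \o g) ->
  mu.-integrable setT (EFin \o (fun x => f x - g x)).
Proof. by move=> fi gi; exact: (integrableB _ fi gi). Qed.

End integral_aux.

(** * Mollification: derivatives, integration by parts, convergence *)

Section mollifier.
Context {R : realType} {m : nat}.
Local Notation mu := (@lebesgue_rV R m).
Implicit Types (x y : 'rV[R]_m) (e : R) (g eta : 'rV[R]_m -> R).

Lemma measurable_rV_sub_pair :
  measurable_fun setT (fun p : 'rV[R]_m * 'rV[R]_m => p.1 - p.2).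
Proof.
apply: measurable_rVP => i.
apply: (eq_measurable_fun (fun p : 'rV[R]_m * 'rV[R]_m => p.1 ord0 i - p.2 ord0 i)).
  by move=> p _; rewrite !mxE.
by apply: measurable_funB; apply: (measurableT_comp (measurable_coor i));
  [exact: measurable_fst|exact: measurable_snd].
Qed.

Lemma measurable_rV_subl x : measurable_fun setT (fun y : 'rV[R]_m => x - y).
Proof.
apply: measurable_rVP => i.
apply: (eq_measurable_fun (fun y : 'rV[R]_m => x ord0 i - y ord0 i)).
  by move=> p _; rewrite !mxE.
by apply: measurable_funB => //; exact: measurable_coor.
Qed.

Lemma measurable_rho e : 0 < e -> measurable_fun setT (@rho R m e).
Proof. by move=> e0; apply: continuous_measurable_rV; exact: continuous_rho. Qed.

Lemma rho_integrable e : 0 < e -> mu.-integrable setT (EFin \o rho e).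
Proof.
move=> e0; have mB := measurable_rV_ball (0 : 'rV[R]_m) e.
apply: (@le_integrable _ _ _ _ _ _ _ (EFin \o \1_(ball (0 : 'rV[R]_m) e))) => //.
- by apply/measurable_EFinP; exact: measurable_rho.
- move=> x _; rewrite /= lee_fin (ger0_norm (rho_ge0 _ _)) indicE ger0_norm//.
  have [xe|xe] := ltP `|x| e; last by rewrite rho_eq0.
  by rewrite mem_set ?rho_le1// -ball_normE /= sub0r normrN.
- by apply: integrable_indic_lty => //; rewrite [X in (X < _)%E]lebesgue_rV_ball// ltry.
Qed.

Definition mass e : R := \int[mu]_x rho e x.

(** On the ball of radius [e / 2], of measure [e ^+ m], the kernel is at least [(1 / 2) ^+ m]. The
    resulting bound [(2 / e) ^+ m] for the normalized kernel has the order of the inverse of the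
    measure of its support, which lets densities control mollifications. *)
Lemma mass_ge e : 0 < e -> (e / 2) ^+ m <= mass e.
Proof.
move=> e0; rewrite -lee_fin /mass EFin_Rintegral//; last exact: rho_integrable.
have e20 : 0 < e / 2 by rewrite divr_gt0.
have mB := measurable_rV_ball (0 : 'rV[R]_m) (e / 2).
have mr := measurable_rho e0.
have h1 : (((e / 2) ^+ m)%:E <=
    \int[mu]_(x in ball (0%R : 'rV[R]_m) (e / 2)%R) ((1 / 2) ^+ m)%:E)%E.
  rewrite integral_cst// [X in (_ * X)%E]lebesgue_rV_ball// -EFinM -exprMn lee_fin.
  by rewrite lerXn2r ?nnegrE; lra.
have h2 : (\int[mu]_(x in ball (0%R : 'rV[R]_m) (e / 2)%R) ((1 / 2) ^+ m)%:E <=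
    \int[mu]_(x in ball (0%R : 'rV[R]_m) (e / 2)%R) (rho e x)%:E)%E.
  apply: ge0_le_integral => //.
  - by apply/measurable_EFinP; exact: measurable_funTS.
  - by move=> x; rewrite -ball_normE /= sub0r normrN => xe; rewrite lee_fin rho_ge.
apply: (le_trans h1 (le_trans h2 _)); apply: ge0_subset_integral => //.
- exact/measurable_EFinP.
- by move=> x _; rewrite lee_fin rho_ge0.
Qed.

Lemma mass_gt0 e : 0 < e -> 0 < mass e.
Proof. by move=> e0; rewrite (lt_le_trans _ (mass_ge e0))// exprn_gt0// divr_gt0. Qed.

Definition nrho e x := rho e x / mass e.

Definition ndrho e i x := drho e i x / mass e.

Lemma nrho_ge0 e x : 0 < e -> 0 <= nrho e x.
Proof. by move=> e0; rewrite divr_ge0 ?rho_ge0// ltW// mass_gt0. Qed.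

Lemma nrho_le e x : 0 < e -> nrho e x <= (2 / e) ^+ m.
Proof.
move=> e0; rewrite /nrho ler_pdivrMr ?mass_gt0//; apply: (le_trans (rho_le1 _ _)).
rewrite -ler_pdivrMl ?exprn_gt0 ?divr_gt0// mulr1 -exprVn invfM invrK mulrC.
exact: mass_ge.
Qed.

Lemma measurable_nrho_sub e x : 0 < e -> measurable_fun setT (fun y => nrho e (x - y)).
Proof.
move=> e0; apply: measurable_funM => //.
exact: (measurableT_comp (measurable_rho e0) (measurable_rV_subl x)).
Qed.

Lemma nrho_sub_integrable e x : 0 < e ->
  mu.-integrable setT (EFin \o (fun y => nrho e (x - y))).
Proof.
move=> e0; apply/integrableP; split.
  by apply/measurable_EFinP; exact: measurable_nrho_sub.
have mr : measurable_fun setT (fun y : 'rV[R]_m => `|(nrho e y)%:E|%E).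
  by apply: measurableT_comp => //; apply/measurable_EFinP; apply: measurable_funM => //; exact: measurable_rho.
have : mu.-integrable setT (EFin \o nrho e).
  apply: (eq_integrable _ (fun y => (mass e)^-1%:E * (rho e y)%:E)%E) => //.
    by move=> y _; rewrite /= -EFinM mulrC.
  by apply: integrableZl => //; exact: rho_integrable.
move=> /integrableP[_]; have <- := ge0_integral_rV_shift (- x) mr (fun y => abse_ge0 _).
by under eq_integral => y _ do rewrite /nrho -rhoN opprD opprK addrC.
Qed.

Lemma nrho_sub_integral e x : 0 < e -> \int[mu]_y nrho e (x - y) = 1.
Proof.
move=> e0; have me := mass_gt0 e0.
have -> : \int[mu]_y nrho e (x - y) = \int[mu]_y nrho e y.
  rewrite /Rintegral -(integral_rV_shift (- x) (f := fun y => (nrho e y)%:E)).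
    by congr fine; apply: eq_integral => y _; rewrite /nrho -rhoN opprD opprK addrC.
  by apply/measurable_EFinP; apply: measurable_funM => //; exact: measurable_rho.
rewrite /nrho; under eq_Rintegral do rewrite mulrC.
by rewrite RintegralZl ?mulVf ?gt_eqF//; exact: rho_integrable.
Qed.

Lemma measurable_ndrho e i : 0 < e -> measurable_fun setT (@ndrho e i).
Proof.
move=> e0; apply: measurable_funM => //.
by apply: continuous_measurable_rV; exact: continuous_drho.
Qed.

Lemma measurable_ndrho_sub e i x : 0 < e ->
  measurable_fun setT (fun y => ndrho e i (x - y)).
Proof.
by move=> e0; exact: (measurableT_comp (measurable_ndrho i e0) (measurable_rV_subl x)).
Qed.

Lemma ndrho_bound e i x : 0 < e -> `|ndrho e i x| <= 4 / e / mass e.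
Proof.
move=> e0; have me := mass_gt0 e0; rewrite normrM normfV (gtr0_norm me).
by rewrite ler_pM2r ?invr_gt0// drho_bound.
Qed.

Definition moll e g x : R := \int[mu]_y (nrho e (x - y) * g y).

Definition dmoll e i g x : R := \int[mu]_y (ndrho e i (x - y) * g y).

Let nrho_norm e x : 0 < e -> `|nrho e x| <= (2 / e) ^+ m.
Proof. by move=> e0; rewrite ger0_norm ?nrho_le ?nrho_ge0. Qed.

Lemma moll_integrable e g x : 0 < e -> mu.-integrable setT (EFin \o g) ->
  mu.-integrable setT (EFin \o (fun y => nrho e (x - y) * g y)).
Proof.
move=> e0; apply: integrable_kernel; first exact: measurable_nrho_sub.
by move=> y; exact: nrho_norm.
Qed.

Lemma dmoll_integrable e i g x : 0 < e -> mu.-integrable setT (EFin \o g) ->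
  mu.-integrable setT (EFin \o (fun y => ndrho e i (x - y) * g y)).
Proof.
move=> e0; apply: integrable_kernel; first exact: measurable_ndrho_sub.
by move=> y; exact: ndrho_bound.
Qed.

Lemma dmoll_lip e i g : 0 < e -> mu.-integrable setT (EFin \o g) ->
  exists C, forall x y, `|dmoll e i g x - dmoll e i g y| <= C * `|x - y|.
Proof.
move=> e0 gi; have me := mass_gt0 e0.
pose L := (4 / e) * (8 * m%:R / e) / mass e.
exists (L * \int[mu]_z `|g z|) => x y.
rewrite /dmoll -RintegralB; [|by []|exact: dmoll_integrable|exact: dmoll_integrable].
under eq_Rintegral do rewrite -mulrBl.
rewrite mulrAC; apply: Rintegral_kernel_le => //.
  by apply: measurable_funB; exact: measurable_ndrho_sub.
move=> z; rewrite /ndrho -mulrBl normrM normfV (gtr0_norm me) /L [leRHS]mulrAC.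
rewrite ler_pM2r ?invr_gt0//.
by rewrite (le_trans (drho_lip _ _ _ e0))// opprB addrA subrK.
Qed.

Lemma moll_lip e g : 0 < e -> mu.-integrable setT (EFin \o g) ->
  exists C, forall x y, `|moll e g x - moll e g y| <= C * `|x - y|.
Proof.
move=> e0 gi; have me := mass_gt0 e0.
pose L := (8 * m%:R / e) / mass e.
exists (L * \int[mu]_z `|g z|) => x y.
rewrite /moll -RintegralB; [|by []|exact: moll_integrable|exact: moll_integrable].
under eq_Rintegral do rewrite -mulrBl.
rewrite mulrAC; apply: Rintegral_kernel_le => //.
  by apply: measurable_funB; exact: measurable_nrho_sub.
move=> z; rewrite /nrho -mulrBl normrM normfV (gtr0_norm me) /L [leRHS]mulrAC.
rewrite ler_pM2r ?invr_gt0//.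
by rewrite (le_trans (rho_lip _ _ e0))// opprB addrA subrK.
Qed.

(** The partial derivatives are explicit data, so that those of mollifications and products are
    given by formulas. Continuity of [f] itself is not included and is supplied separately. *)
Definition pC1 (f : 'rV[R]_m -> R) (df : 'I_m -> 'rV[R]_m -> R) :=
  forall i, continuous (df i) /\
  forall x, is_derive x (delta_mx ord0 i : 'rV[R]_m) f (df i x).

Lemma is_derive_taylor (f : 'rV[R]_m -> R) x (v : 'rV[R]_m) (d C : R) :
  (forall h, `|f (h *: v + x) - f x - h * d| <= C * h ^+ 2) -> is_derive x v f d.
Proof.
move=> H; have fd : h^-1 *: ((f \o shift x) (h *: v) - f x) @[h --> 0^'] --> d.
  apply/cvgrPdist_lt => eps eps0; have C0 : 0 < `|C| + 1 by rewrite ltr_wpDl.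
  have e0 : 0 < eps / (`|C| + 1) by rewrite divr_gt0.
  near=> h; have h0 : h != 0 by near: h; exact: nbhs_dnbhs_neq.
  have he : `|h| < eps / (`|C| + 1) by near: h; exact: dnbhs0_lt.
  rewrite /= distrC (_ : _ - d = h^-1 * (f (h *: v + x) - f x - h * d)); last first.
    by rewrite /shift /= mulrBr mulKf.
  rewrite normrM normfV mulrC ltr_pdivrMr ?normr_gt0// (le_lt_trans (H h))//.
  rewrite -(real_normK (num_real h)) expr2 mulrA ltr_pM2r ?normr_gt0//.
  apply: (@le_lt_trans _ _ ((`|C| + 1) * `|h|)); last by rewrite mulrC -ltr_pdivlMr.
  by rewrite ler_wpM2r// (le_trans (ler_norm _))// lerDl.
by split; [apply/cvg_ex; exists d|exact: cvg_lim].
Unshelve. all: by end_near. Qed.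

(** The uniform quadratic remainder of the kernel, integrated against [g], is a quadratic remainder
    for the convolution; no limit is exchanged with the integral. *)
Lemma moll_pC1 e g : 0 < e -> mu.-integrable setT (EFin \o g) ->
  pC1 (moll e g) (fun i => dmoll e i g).
Proof.
move=> e0 gi i; split.
  by have [C HC] := dmoll_lip i e0 gi; exact: lip_continuous HC.
move=> x; have me := mass_gt0 e0.
apply: (@is_derive_taylor _ _ _ _ (24 / e ^+ 2 / mass e * \int[mu]_z `|g z|)) => h.
have i1 := moll_integrable (h *: delta_mx ord0 i + x) e0 gi.
have i2 := moll_integrable x e0 gi; have i3 := dmoll_integrable i x e0 gi.
rewrite /moll /dmoll -RintegralZl// -RintegralB//.
have i4 : mu.-integrable setT (EFin \o (fun y => h * (ndrho e i (x - y) * g y))).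
  apply: (eq_integrable _ (fun y => h%:E * (ndrho e i (x - y) * g y)%:E)%E) => //.
  exact: integrableZl.
rewrite -RintegralB//; last first.
  apply: (eq_integrable _ ((EFin \o (fun y => nrho e (h *: delta_mx ord0 i + x - y) * g y)%R)
    \- (EFin \o (fun y => nrho e (x - y) * g y)%R))%E) => //.
  exact: integrableB.
under eq_Rintegral do rewrite mulrA -mulrBl -mulrBl.
rewrite [leRHS]mulrAC; apply: Rintegral_kernel_le => //.
  apply: measurable_funB; first by apply: measurable_funB; exact: measurable_nrho_sub.
  by apply: measurable_funM => //; exact: measurable_ndrho_sub.
move=> y; rewrite /nrho /ndrho mulrA -mulrBl -mulrBl normrM normfV (gtr0_norm me).
rewrite [leRHS]mulrAC ler_pM2r ?invr_gt0//.
by rewrite -[in rho e (_ + _ - y)]addrA; exact: rho_taylor.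
Qed.

Lemma continuous_moll e g : 0 < e -> mu.-integrable setT (EFin \o g) ->
  continuous (moll e g).
Proof. by move=> e0 gi; have [C] := moll_lip e0 gi; exact: lip_continuous. Qed.

Lemma moll_ge0 e g x : 0 < e -> (forall y, 0 <= g y) -> 0 <= moll e g x.
Proof.
by move=> e0 g0; apply: Rintegral_ge0 => y _; rewrite mulr_ge0// nrho_ge0.
Qed.

Lemma moll_le1 e g x : 0 < e -> mu.-integrable setT (EFin \o g) ->
  (forall y, g y <= 1) -> moll e g x <= 1.
Proof.
move=> e0 gi g1; rewrite -(nrho_sub_integral x e0); apply: le_Rintegral => //.
- exact: moll_integrable.
- exact: nrho_sub_integrable.
- by move=> y _; rewrite ler_piMr// nrho_ge0.
Qed.

Lemma moll_neq0 e g x : 0 < e -> moll e g x != 0 ->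
  exists2 y, g y != 0 & `|x - y| < e.
Proof.
move=> e0; apply: contraNP => /forall2NP H; apply/eqP.
rewrite /moll (_ : (fun y => _) = cst 0) ?Rintegral_cst ?mul0r//.
apply/funext => y /=; have [/negP|/negP] := H y; first by rewrite negbK => /eqP ->; rewrite mulr0.
by rewrite -leNgt => ey; rewrite /nrho rho_eq0// !mul0r.
Qed.

(** An integration by parts in which neither [g] nor [eta] is differentiable: the derivative sits on
    the kernel and is odd, so exchanging the integrals moves it to the other function with a
    sign. *)
Lemma dmoll_fubini e i g eta : 0 < e -> mu.-integrable setT (EFin \o g) ->
  mu.-integrable setT (EFin \o eta) ->
  \int[mu]_x (eta x * dmoll e i g x) = \int[mu]_y (g y * - dmoll e i eta y).
Proof.
move=> e0 gi ei; have me := mass_gt0 e0.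
pose F (p : 'rV[R]_m * 'rV[R]_m) := (eta p.1 * (ndrho e i (p.1 - p.2) * g p.2))%:E.
have mg : measurable_fun setT g by apply/measurable_EFinP; case/integrableP : gi.
have meta : measurable_fun setT eta by apply/measurable_EFinP; case/integrableP : ei.
have mF : measurable_fun setT F.
  apply/measurable_EFinP; apply: measurable_funM.
    by apply: (measurableT_comp meta); exact: measurable_fst.
  apply: measurable_funM; last by apply: (measurableT_comp mg); exact: measurable_snd.
  exact: (measurableT_comp (measurable_ndrho i e0) measurable_rV_sub_pair).
have iF : (mu \x mu)%E.-integrable setT F.
  apply/integrable12ltyP => //.
  apply: (@le_lt_trans _ _ (\int[mu]_x (`|eta x| * (4 / e / mass e * \int[mu]_y `|g y|))%:E)%E).
    apply: ge0_le_integral => //.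
    - by move=> x _; apply: integral_ge0.
    - have mF' : measurable_fun setT (fun p => `|F p|%E) by exact: measurableT_comp.
      exact: (measurable_fun_fubini_tonelli_F _ mF' (fun=> abse_ge0 _)).
    - by apply/measurable_EFinP; apply: measurable_funM => //; exact: measurableT_comp.
    move=> x _; rewrite EFinM.
    have -> : (fun y => `|F (x, y)|%E) = (fun y => `|eta x|%:E * `|ndrho e i (x - y) * g y|%:E)%E.
      by apply/funext => y; rewrite /F /= normrM.
    have Ki := dmoll_integrable i x e0 gi.
    rewrite ge0_integralZl//; last first.
      by apply/measurable_EFinP; apply: measurableT_comp => //; apply/measurable_EFinP; case/integrableP : Ki.
    apply: lee_wpmul2l => //; rewrite -EFin_Rintegral//; last exact: (integrable_norm Ki).
    rewrite lee_fin -RintegralZl//; last exact: integrable_norm.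
    apply: le_Rintegral => //; first exact: (integrable_norm Ki).
      apply: (eq_integrable _ (fun y => (4 / e / mass e)%:E * `|g y|%:E)%E) => //.
      by apply: integrableZl => //; exact: (integrable_norm gi).
    by move=> y _; rewrite normrM ler_wpM2r// ndrho_bound.
  rewrite (eq_integral (fun x => (4 / e / mass e * \int[mu]_y `|g y|)%:E * `|eta x|%:E)%E); last first.
    by move=> x _; rewrite -EFinM mulrC.
  have ei' := integrable_norm ei.
  by rewrite integralZl// -EFin_Rintegral// -EFinM ltry.
have := Fubini iF; rewrite /F /=.
have -> : (\int[mu]_x \int[mu]_y (eta x * (ndrho e i (x - y) * g y))%:E =
    \int[mu]_x (eta x * dmoll e i g x)%:E)%E.
  apply: eq_integral => x _; have Ki := dmoll_integrable i x e0 gi.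
  under eq_integral do rewrite EFinM.
  by rewrite integralZl// -EFin_Rintegral// -EFinM.
have -> : (\int[mu]_y \int[mu]_x (eta x * (ndrho e i (x - y) * g y))%:E =
    \int[mu]_y (g y * - dmoll e i eta y)%:E)%E.
  apply: eq_integral => y _; have Ki := dmoll_integrable i y e0 ei.
  rewrite mulrN -mulNr EFinM (_ : (dmoll _ _ _ _)%:E = \int[mu]_x (ndrho e i (y - x) * eta x)%:E)%E; last first.
    by rewrite -EFin_Rintegral.
  rewrite -integralZl//; apply: eq_integral => x _; rewrite -EFinM; congr EFin.
  by rewrite -(opprB y x) /ndrho drhoN; ring.
by rewrite /Rintegral => ->.
Qed.

Lemma moll_indic_le e (B : set 'rV[R]_m) x : 0 < e -> measurable B ->
  ((moll e \1_B x)%:E <= ((2 / e) ^+ m)%:E * mu (B `&` ball x e))%E.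
Proof.
move=> e0 mB; have mb := measurable_rV_ball x e.
have mBb : measurable (B `&` ball x e) by exact: measurableI.
have ki : mu.-integrable setT (EFin \o (fun y => nrho e (x - y) * \1_B y)).
  apply: (eq_integrable _ (fun y => (\1_B y * nrho e (x - y))%:E)) => //.
    by move=> y _; rewrite /= mulrC.
  apply: (@integrable_kernel _ _ _ _ _ _ 1) => //; last exact: nrho_sub_integrable.
  by move=> y; rewrite indicE ger0_norm//; case: (_ \in _).
rewrite /moll EFin_Rintegral//.
apply: (@le_trans _ _ (\int[mu]_y (((2 / e) ^+ m)%:E * (\1_(B `&` ball x e) y)%:E))%E); last first.
  rewrite ge0_integralZl//; last first.
  - by rewrite lee_fin exprn_ge0// divr_ge0// ltW.
  - by apply/measurable_EFinP; exact: measurable_indic.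
  by rewrite integral_indic// setIT.
apply: ge0_le_integral => //.
- by move=> y _; rewrite lee_fin mulr_ge0// nrho_ge0.
- by case/integrableP : ki.
- by apply: emeasurable_funM => //; apply/measurable_EFinP; exact: measurable_indic.
move=> y _; rewrite -EFinM lee_fin !indicE in_setI.
have [ye|ye] := ltP `|x - y| e.
  have -> : y \in (ball x e : set 'rV[R]_m) by rewrite mem_set// -ball_normE.
  by rewrite andbT ler_wpM2r// nrho_le.
by rewrite /nrho rho_eq0// !mul0r mulr_ge0// exprn_ge0// divr_ge0// ltW.
Qed.

Lemma moll_indicC e (B : set 'rV[R]_m) x : 0 < e -> measurable B ->
  moll e \1_(~` B) x = 1 - moll e \1_B x.
Proof.
move=> e0 mB; have ki (A : set 'rV[R]_m) : measurable A ->
    mu.-integrable setT (EFin \o (fun y => nrho e (x - y) * \1_A y)).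
  move=> mA; apply: (eq_integrable _ (fun y => (\1_A y * nrho e (x - y))%:E)) => //.
    by move=> y _; rewrite /= mulrC.
  apply: (@integrable_kernel _ _ _ _ _ _ 1) => //; last exact: nrho_sub_integrable.
  by move=> y; rewrite indicE ger0_norm//; case: (_ \in _).
rewrite -(nrho_sub_integral x e0) /moll -RintegralB//; last 2 first.
- exact: nrho_sub_integrable.
- exact: ki.
apply: eq_Rintegral => y _; rewrite !indicE in_setC; case: (_ \in _) => /=; ring.
Qed.

Lemma zero_density_moll (B : set 'rV[R]_m) x : measurable B -> zero_density B x ->
  moll n.+1%:R^-1 \1_B x @[n --> \oo] --> 0.
Proof.
move=> mB xB; apply/cvgrPdist_le => eps eps0.
(* The factor [2 ^+ m] cancels the one in the bound [(2 / e) ^+ m] for the kernel. *)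
have e0 : 0 < eps / 2 ^+ m by rewrite divr_gt0// exprn_gt0.
have [d d0 Hd] := xB _ e0.
have [N _ HN] := near_infty_natSinv_lt (PosNum d0).
exists N => // n /= Nn; have nd := HN n Nn.
have en : 0 < n.+1%:R^-1 :> R by rewrite invr_gt0.
have B0 : forall y, 0 <= \1_B y :> R by [].
rewrite sub0r normrN ger0_norm; last exact: moll_ge0.
rewrite -lee_fin (le_trans (moll_indic_le _ en mB))//.
apply: (@le_trans _ _ (((2 / n.+1%:R^-1) ^+ m)%:E * (eps / 2 ^+ m * n.+1%:R^-1 ^+ m)%:E)%E).
  apply: lee_wpmul2l; first by rewrite lee_fin exprn_ge0// divr_ge0// ltW.
  by apply: Hd; rewrite en.
rewrite -EFinM lee_fin exprMn (exprVn n.+1%:R^-1) le_eqVlt; apply/orP; left; apply/eqP.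
by field; rewrite ?expf_neq0// ?invr_neq0// ?expf_neq0.
Qed.

(** The density theorem serves twice: for the complement at points of [A], for [A] at points of the
    complement. The total mass 1 of the kernel turns the first case into convergence to 1. *)
Lemma moll_indic_cvg (A : set 'rV[R]_m) : measurable A ->
  {ae mu, forall x, moll n.+1%:R^-1 \1_A x @[n --> \oo] --> (\1_A x : R)}.
Proof.
move=> mA; have := zero_density_setC mA; have := zero_density_setC (measurableC mA).
rewrite setCK; apply: filterS2 => x nAx Ax.
have [xA|xA] := pselect (A x); last first.
  by rewrite indicE memNset//; exact: (zero_density_moll mA (nAx xA)).
have -> : \1_A x = 1 :> R by rewrite indicE mem_set.
  have /= H := zero_density_moll (measurableC mA) (Ax xA).
  have : (1 - moll n.+1%:R^-1 \1_(~` A) x) @[n --> \oo] --> (1 - 0 : R).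
    by apply: cvgB => //; exact: cvg_cst.
  rewrite subr0; apply: cvg_trans; apply: near_eq_cvg; apply: nearW => n.
  by rewrite moll_indicC ?invr_gt0// subKr.
Qed.

End mollifier.

(** * C^1 functions with compact support *)

Section C1_functions.
Context {R : realType} {m : nat}.
Local Notation mu := (@lebesgue_rV R m).
Local Notation V := 'rV[R]_m.
Implicit Types (f g : V -> R) (df dg : 'I_m -> V -> R) (x y : V).

Definition unit_rV (i : 'I_m) : V := delta_mx ord0 i.

Lemma continuous_add f g : continuous f -> continuous g ->
  continuous (fun x => f x + g x).
Proof. by move=> cf cg x; exact: (@continuousD R R V f g x (cf x) (cg x)). Qed.

Lemma continuous_sub f g : continuous f -> continuous g ->
  continuous (fun x => f x - g x).
Proof. by move=> cf cg x; exact: (@continuousB R R V f g x (cf x) (cg x)). Qed.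

Lemma continuous_mul f g : continuous f -> continuous g ->
  continuous (fun x => f x * g x).
Proof. by move=> cf cg x; exact: (@continuousM R V f g x (cf x) (cg x)). Qed.

Lemma C1_pC1 p (phi : V -> 'rV[R]_p) (j : 'I_p) : C1 phi ->
  pC1 (fun x => phi x ord0 j) (fun i x => ('D_(unit_rV i) phi x) ord0 j).
Proof.
move=> cphi i; have [dphi cdphi] := cphi i; split.
  move=> x; apply: (@continuous_comp _ _ _ ('D_(unit_rV i) phi) (fun v : 'rV[R]_p => v ord0 j)).
    exact: cdphi.
  exact: coord_continuous.
move=> x; split; first exact: (derivable_mxP _ _ _).1.
by rewrite derive_mx// mxE.
Qed.

Lemma pC1_C1 p (phi : V -> 'rV[R]_p) (d : 'I_p -> 'I_m -> V -> R) :
  (forall j, pC1 (fun x => phi x ord0 j) (d j)) ->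
  C1 phi /\ forall i x, 'D_(unit_rV i) phi x = \row_j d j i x.
Proof.
move=> dphi; have der i x : derivable phi x (unit_rV i).
  apply/derivable_mxP => k j; rewrite (ord1 k).
  by have [_ /(_ x)[]] := dphi j i.
have E i x : 'D_(unit_rV i) phi x = \row_j d j i x.
  rewrite derive_mx//; apply/rowP => j; rewrite !mxE.
  by have [_ /(_ x)[_ ->]] := dphi j i.
split=> // i; split; first exact: der.
rewrite (_ : (fun x => _) = fun x => \row_j d j i x); last exact/funext/E.
move=> x; apply/(@cvgrPdist_lt R 'rV[R]_p _ (nbhs x) (nbhs_filter x)) => e e0.
have : \forall y \near x, forall j, `|d j i x - d j i y| < e.
  apply: (@filter_forall V 'I_p (fun j y => `|d j i x - d j i y| < e) (nbhs x) (nbhs_filter x)) => j; have [/(_ x) cd _] := dphi j i.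
  exact: (@cvgrPdist_lt R R _ (nbhs x) (nbhs_filter x) _ _).1 cd _ e0.
apply: filterS => y xy; apply/rV_norm_lt => // j; rewrite !mxE; exact: xy.
Qed.

Lemma pC1M f g df dg : continuous f -> continuous g -> pC1 f df -> pC1 g dg ->
  pC1 (fun x => f x * g x) (fun i x => f x * dg i x + g x * df i x).
Proof.
move=> cf cg Hf Hg i; have [cdf ddf] := Hf i; have [cdg ddg] := Hg i; split.
  by apply: continuous_add; exact: continuous_mul.
move=> x; have := ddf x; have := ddg x => ? ?.
exact: is_deriveM.
Qed.

Lemma pC1D f g df dg : pC1 f df -> pC1 g dg ->
  pC1 (fun x => f x + g x) (fun i x => df i x + dg i x).
Proof.
move=> Hf Hg i; have [cdf ddf] := Hf i; have [cdg ddg] := Hg i; split.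
  exact: continuous_add.
move=> x; have := ddf x; have := ddg x => ? ?.
exact: is_deriveD.
Qed.

Lemma pC1B f g df dg : pC1 f df -> pC1 g dg ->
  pC1 (fun x => f x - g x) (fun i x => df i x - dg i x).
Proof.
move=> Hf Hg i; have [cdf ddf] := Hf i; have [cdg ddg] := Hg i; split.
  exact: continuous_sub.
move=> x; have := ddf x; have := ddg x => ? ?.
exact: is_deriveB.
Qed.

Lemma pC1_line f df i x (t : R) : pC1 f df ->
  is_derive t (1 : R) (fun s => f (s *: unit_rV i + x)) (df i (t *: unit_rV i + x)).
Proof.
move=> Hf; have [_ /(_ (t *: unit_rV i + x))[df1 df2]] := Hf i.
have E : (fun h : R => h^-1 *: (((fun s => f (s *: unit_rV i + x)) \o shift t) (h *: (1 : R)) -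
      f (t *: unit_rV i + x))) =
    (fun h : R => h^-1 *: ((f \o shift (t *: unit_rV i + x)) (h *: unit_rV i) - f (t *: unit_rV i + x))).
  by apply/funext => h /=; rewrite /shift /= [h *: 1]mulr1 scalerDl addrA.
by split; rewrite /derivable /derive E.
Qed.

Lemma pC1_mvt f df i x (h C : R) : pC1 f df ->
  (forall t, `|t| <= `|h| -> `|df i (t *: unit_rV i + x)| <= C) ->
  `|f (h *: unit_rV i + x) - f x| <= C * `|h|.
Proof.
move=> Hf HC; pose g (s : R) := f (s *: unit_rV i + x).
have dg t : is_derive t (1 : R) g (df i (t *: unit_rV i + x)) by exact: pC1_line.
have cg a b : {within `[a, b], continuous g}.
  by apply: derivable_within_continuous => t _; have [] := dg t.
have -> : f (h *: unit_rV i + x) - f x = g h - g 0 by rewrite /g scale0r add0r.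
have [h0|h0] := leP 0 h.
  have [c] := MVT_segment h0 (fun t _ => dg t) (cg _ _).
  rewrite in_itv/= => /andP[c0 ch] ->; rewrite subr0 normrM ler_wpM2r//.
  by apply: HC; rewrite !ger0_norm.
have [c] := MVT_segment (ltW h0) (fun t _ => dg t) (cg _ _).
rewrite in_itv/= => /andP[hc c0] E; rewrite distrC E sub0r normrM normrN ler_wpM2r//.
by apply: HC; rewrite (ler0_norm c0) (ler0_norm (ltW h0)) lerN2.
Qed.

Lemma pC1_zero f df i x (r : R) : pC1 f df -> 0 < r ->
  (forall y, `|x - y| < r -> f y = 0) -> df i x = 0.
Proof.
move=> Hf r0 fx0; have [_ /(_ x)[_ <-]] := Hf i.
rewrite (@near_eq_derive _ _ _ f (cst 0)) ?derive_cst//.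
have : \forall y \near x, ball x r y by exact: nbhsx_ballx.
by apply: filterS => y; rewrite -ball_normE => /fx0.
Qed.

Lemma continuous_bounded_ball f (M : R) : continuous f ->
  exists2 C, 0 <= C & forall x, `|x| <= M -> `|f x| <= C.
Proof.
move=> cf; have cB : compact [set x : V | `|x| <= M].
  apply: bounded_closed_compact.
    by exists M; split; [exact: num_real|move=> r Mr x /= /le_trans; apply; exact: ltW].
  rewrite (_ : [set _ | _] = (fun x : V => `|x|) @^-1` [set r | r <= M])//.
  have /continuous_closedP : continuous (fun x : V => `|x| : R) by exact: norm_continuous.
  by apply; exact: closed_le.
have : compact (f @` [set x : V | `|x| <= M]).
  by apply: continuous_compact => //; exact: continuous_subspaceT.
move=> /compact_bounded[C [_ HC]]; exists (`|C| + 1); first by rewrite addr_ge0.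
move=> x xM; apply: (HC (`|C| + 1)); last by exists x.
by rewrite (le_lt_trans (ler_norm _))// ltrDl.
Qed.

(** A quantitative form of compactly supported C^1: one radius and one bound for the function and
    all its partial derivatives, from which integrability, the Lipschitz bound and dominations
    follow directly. *)
Record C1_compact f df (M C : R) : Prop := {
  C1c_pC1 : pC1 f df ;
  C1c_C0 : 0 <= C ;
  C1c_f0 : forall x, M <= `|x| -> f x = 0 ;
  C1c_df0 : forall i x, M <= `|x| -> df i x = 0 ;
  C1c_df : forall i x, `|df i x| <= C ;
  C1c_f : forall x, `|f x| <= C }.

Lemma C1_compact_lip f df M C x y : C1_compact f df M C ->
  `|f x - f y| <= (C * m%:R) * `|x - y|.
Proof.
move=> Hf; have step i z (h : R) : `|f (h *: unit_rV i + z) - f z| <= C * `|h|.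
  by apply: (pC1_mvt (C1c_pC1 Hf)) => t _; exact: (C1c_df Hf).
(* The path from [y] to [x] changes one coordinate at a time; each leg is parallel to an axis, where
   the mean value theorem applies. *)
have path (s : seq 'I_m) : `|f (\sum_(i <- s) (x - y) ord0 i *: unit_rV i + y) - f y| <=
    C * \sum_(i <- s) `|(x - y) ord0 i|.
  elim: s => [|i s IH]; first by rewrite !big_nil add0r subrr normr0 mulr0.
  rewrite !big_cons mulrDr -addrA.
  by rewrite (le_trans (ler_distD (f (\sum_(i <- s) (x - y) ord0 i *: unit_rV i + y)) _ _))// lerD.
have := path (index_enum 'I_m); rewrite -[X in X + y]row_sum_delta subrK => /le_trans; apply.
rewrite -mulrA ler_wpM2l//; first exact: (C1c_C0 Hf).
apply: (@le_trans _ _ (\sum_(i < m) `|x - y|)); first by apply: ler_sum => i _; exact: rV_norm_ge.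
by rewrite sumr_const card_ord mulr_natl.
Qed.

Lemma C1_compact_continuous f df M C : C1_compact f df M C -> continuous f.
Proof. by move=> Hf; apply: lip_continuous => x y; exact: C1_compact_lip Hf. Qed.

Lemma pC1_compact f df (M : R) : pC1 f df -> (forall x, M <= `|x| -> f x = 0) ->
  (exists2 C, 0 <= C & forall x, `|f x| <= C) -> exists C, C1_compact f df (M + 1) C.
Proof.
move=> Hf fM [Cf Cf0 HCf]; have f0 x : M + 1 <= `|x| -> f x = 0.
  by move=> Mx; apply: fM; rewrite (le_trans _ Mx)// lerDl.
(* The extra 1 gives a whole ball around [x] on which [f] vanishes; only then is the derivative
   known to be 0. *)
have df0 i x : M + 1 <= `|x| -> df i x = 0.
  move=> Mx; apply: (@pC1_zero _ _ i x 1 Hf) => // y xy; apply: fM.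
  by have := ler_normD y (x - y); rewrite addrC subrK; lra.
have /choice[c Hc] : forall i, exists c, 0 <= c /\ forall x, `|x| <= M + 1 -> `|df i x| <= c.
  by move=> i; have [c c0 H] := continuous_bounded_ball (M + 1) (Hf i).1; exists c.
have c0 i : 0 <= c i by have [] := Hc i.
have S0 : 0 <= \sum_i c i by apply: sumr_ge0 => i _.
exists (Cf + \sum_i c i); split => //; first exact: addr_ge0.
- move=> i x; have [xM|xM] := leP `|x| (M + 1); last first.
    by rewrite df0 ?normr0 ?addr_ge0// ltW.
  rewrite (le_trans ((Hc i).2 x xM))// (bigD1 i)//= addrCA lerDl addr_ge0//.
  exact: sumr_ge0.
- by move=> x; rewrite (le_trans (HCf x))// lerDl.
Qed.

Lemma bounded_support_integrable f (M C : R) : measurable_fun setT f ->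
  (forall x, `|f x| <= C) -> (forall x, M <= `|x| -> f x = 0) ->
  mu.-integrable setT (EFin \o f).
Proof.
move=> mf fC fM; have M0 : 0 < `|M| + 1 by rewrite ltr_wpDl.
have mB := measurable_rV_ball (0 : V) (`|M| + 1).
apply: (eq_integrable _ (EFin \o (fun x => f x * \1_(ball (0 : V) (`|M| + 1)) x))) => //.
  move=> x _; rewrite /= indicE; have [xM|xM] := ltP `|x| (`|M| + 1).
    by rewrite mem_set ?mulr1// -ball_normE /= sub0r normrN.
  by rewrite fM ?mul0r// (le_trans _ xM)// (le_trans (ler_norm M))// lerDl.
apply: integrable_kernel fC _ => //; apply: integrable_indic_lty => //.
by rewrite [X in (X < _)%E]lebesgue_rV_ball// ltry.
Qed.

Lemma C1_compact_integrable f df M C : C1_compact f df M C ->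
  mu.-integrable setT (EFin \o f).
Proof.
move=> Hf; apply: bounded_support_integrable (C1c_f Hf) (C1c_f0 Hf).
by apply: continuous_measurable_rV; exact: C1_compact_continuous Hf.
Qed.

Lemma C1_compact_dintegrable f df M C i : C1_compact f df M C ->
  mu.-integrable setT (EFin \o df i).
Proof.
move=> Hf; apply: bounded_support_integrable (C1c_df Hf i) (C1c_df0 Hf i).
by apply: continuous_measurable_rV; have [] := C1c_pC1 Hf i.
Qed.

(** Difference quotients have integral 0 by translation invariance, and they converge to the partial
    derivative under a common integrable bound. *)
Lemma integral_partial_eq0 f df M C i : C1_compact f df M C ->
  \int[mu]_x df i x = 0.
Proof.
move=> Hf; have cf := C1_compact_continuous Hf.
have mf := continuous_measurable_rV cf.
have fi := C1_compact_integrable Hf.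
pose h k : R := k.+1%:R^-1.
have h0 k : 0 < h k by rewrite invr_gt0.
have h1 k : h k <= 1 by rewrite invf_le1// ler1n.
pose q k x := (h k)^-1 * (f (x + h k *: unit_rV i) - f x).
have mfs k : measurable_fun setT (fun x => f (x + h k *: unit_rV i)).
  exact: (measurableT_comp mf (measurable_rV_shift _)).
have mq k : measurable_fun setT (q k).
  by apply: measurable_funM => //; exact: measurable_funB.
have n1 k : `|h k *: unit_rV i| <= 1.
  apply: rV_norm_le => // j; rewrite !mxE normrM (gtr0_norm (h0 k)).
  by case: (_ && _); rewrite ?normr1 ?normr0 ?mulr1 ?mulr0.
have qC k x : `|q k x| <= C.
  rewrite /q normrM (gtr0_norm (_ : 0 < (h k)^-1)) ?invr_gt0// ler_pdivrMl//.
  rewrite [x + _]addrC [h k * _]mulrC -{2}(gtr0_norm (h0 k)).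
  by apply: (pC1_mvt (C1c_pC1 Hf)) => t _; exact: (C1c_df Hf).
have qM k x : M + 1 <= `|x| -> q k x = 0.
  move=> Mx; rewrite /q.
  rewrite (C1c_f0 Hf (x := x)); last by rewrite (le_trans _ Mx)// lerDl.
  rewrite (C1c_f0 Hf (x := x + _)) ?subrr ?mulr0//.
  have := ler_normB (x + h k *: unit_rV i) (h k *: unit_rV i); rewrite addrK.
  by have := n1 k; lra.
have iq k : mu.-integrable setT (EFin \o q k).
  exact: bounded_support_integrable (qC k) (qM k).
have q0 k : (\int[mu]_x (q k x)%:E = 0)%E.
  have fsi : mu.-integrable setT (EFin \o (fun x => f (x + h k *: unit_rV i))).
    apply: (@bounded_support_integrable _ (M + 1) C) => // x; first exact: (C1c_f Hf).
    move=> Mx; apply: (C1c_f0 Hf).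
    have := ler_normB (x + h k *: unit_rV i) (h k *: unit_rV i); rewrite addrK.
    by have := n1 k; lra.
  under eq_integral do rewrite /q EFinM EFinB.
  rewrite integralZl//; last exact: (integrableB _ fsi fi).
  rewrite integralB//.
  rewrite (integral_rV_shift (h k *: unit_rV i) (f := fun x => (f x)%:E)); last exact/measurable_EFinP.
  by rewrite subee ?mule0//; exact: integrable_fin_num.
(* Shifts by at most 1 keep the quotients supported within radius [M + 1]; the absolute value makes
   the radius positive whatever the sign of [M]. *)
pose B := ball (0 : V) (`|M| + 1 + 1).
have M0 : 0 < `|M| + 1 + 1 by rewrite !ltr_wpDl// addr_ge0.
have [] := @dominated_convergence _ _ _ mu setT measurableT (fun k x => (q k x)%:E)
  (fun x => (df i x)%:E) (fun x => (C * \1_B x)%:E).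
- by move=> k; exact/measurable_EFinP.
- by apply/measurable_EFinP; apply: continuous_measurable_rV; have [] := C1c_pC1 Hf i.
- apply: aeW => x _; apply: cvg_EFin; first exact: nearW.
  have [_ /(_ x)[dx vx]] := C1c_pC1 Hf i.
  have : t^-1 *: ((f \o shift x) (t *: unit_rV i) - f x) @[t --> 0^'] --> df i x.
    by rewrite -vx; exact: dx.
  move=> /cvgrPdist_lt H; apply/cvgrPdist_lt => e /H.
  rewrite /dnbhs /= => /nbhs_ballP[r /= r0 Hr].
  have [N _ HN] := near_infty_natSinv_lt (PosNum r0).
  exists N => // k /= Nk; have := Hr (h k).
  rewrite /q [x + _]addrC /shift /=; apply; last by rewrite gt_eqF.
  by rewrite -ball_normE /= sub0r normrN gtr0_norm//; exact: (HN k Nk).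
- apply: (eq_integrable _ (fun x => C%:E * (\1_B x)%:E)%E) => //.
  apply: integrableZl => //; apply: integrable_indic_lty; first exact: measurable_rV_ball.
  by rewrite [X in (X < _)%E]lebesgue_rV_ball// ltry.
- apply: aeW => x k _; rewrite lee_fin indicE; have [xM|xM] := ltP `|x| (`|M| + 1 + 1).
    by rewrite mem_set ?mulr1// /B -ball_normE /= sub0r normrN.
  rewrite qM ?normr0 ?mulr_ge0 ?(C1c_C0 Hf)//.
  by rewrite (le_trans _ xM)// (le_trans (_ : _ <= `|M| + 1))// ?lerD2r ?ler_norm// lerDl.
move=> _ _; under eq_fun do rewrite q0.
move=> /(cvg_lim (@ereal_hausdorff _)); rewrite lim_cst; last exact: ereal_hausdorff.
by rewrite /Rintegral => <-.
Qed.

End C1_functions.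

Section more_mollifier.
Context {R : realType} {m : nat}.
Local Notation mu := (@lebesgue_rV R m).
Local Notation V := 'rV[R]_m.

(** Cauchy-Schwarz, by expanding the sum of the squares of [c i - t * b i] with [t] the Euclidean
    norm of [c]. *)
Lemma sum_mul_le_sqrt (b c : 'I_m -> R) : \sum_i b i ^+ 2 <= 1 ->
  \sum_i c i * b i <= Num.sqrt (\sum_i c i ^+ 2).
Proof.
move=> b1; set T := \sum_i c i ^+ 2; set t := Num.sqrt T.
have T0 : 0 <= T by apply: sumr_ge0 => i _; exact: sqr_ge0.
have tT : t ^+ 2 = T by rewrite sqr_sqrtr.
have [T00|T1] := eqVneq T 0.
  have c0 i : c i = 0.
    apply/eqP; rewrite -sqrf_eq0; apply/eqP.
    by have /psumr_eq0P : \sum_i c i ^+ 2 = 0 by []; apply => // j _; exact: sqr_ge0.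
  by rewrite big1 ?sqrtr_ge0// => i _; rewrite c0 mul0r.
have t0 : 0 < t by rewrite sqrtr_gt0 lt_neqAle eq_sym T1.
have : 0 <= \sum_i (c i - t * b i) ^+ 2 by apply: sumr_ge0 => i _; exact: sqr_ge0.
have -> : \sum_i (c i - t * b i) ^+ 2 =
    T - 2 * t * (\sum_i c i * b i) + t ^+ 2 * \sum_i b i ^+ 2.
  rewrite /T !mulr_sumr -sumrB -big_split/=; apply: eq_bigr => i _; ring.
move: (\sum_i c i * b i) (\sum_i b i ^+ 2) b1 => S B B1; rewrite -tT => H.
have : t * (2 * S) <= t * (2 * t) by have := sqr_ge0 t; nra.
by rewrite ler_pM2l// ler_pM2l.
Qed.

(** Mollification keeps the Euclidean bound of a field, not only the bounds of its components. If
    [c] is the mollified vector at [x], its squared norm is the average of the products of [c] with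
    [eta y], hence at most its norm. *)
Lemma moll_sum_sqr_le1 e (eta : 'I_m -> V -> R) x : 0 < e ->
  (forall i, mu.-integrable setT (EFin \o eta i)) ->
  (forall y, \sum_i eta i y ^+ 2 <= 1) -> \sum_i moll e (eta i) x ^+ 2 <= 1.
Proof.
move=> e0 ei e1; pose c i := moll e (eta i) x; rewrite -/(c _).
set T := \sum_i _; pose t := Num.sqrt T.
have T0 : 0 <= T by apply: sumr_ge0 => i _; exact: sqr_ge0.
have ici i : mu.-integrable setT (EFin \o (fun y : V => c i * (nrho e (x - y) * eta i y))).
  by apply: integrable_scale; exact: moll_integrable.
have : T <= t.
  rewrite /T; have -> : \sum_i c i ^+ 2 = \sum_i \int[mu]_y (c i * (nrho e (x - y) * eta i y)).
    apply: eq_bigr => i _; rewrite RintegralZl// ?expr2//; exact: moll_integrable.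
  rewrite -Rintegral_sum// -[t]mulr1 -(nrho_sub_integral x e0).
  rewrite -RintegralZl//; last exact: nrho_sub_integrable.
  apply: le_Rintegral => //.
  - exact: integrable_Rsum.
  - by apply: integrable_scale; exact: nrho_sub_integrable.
  move=> y _; under eq_bigr do rewrite mulrCA.
  by rewrite -mulr_sumr mulrC ler_wpM2r ?nrho_ge0// sum_mul_le_sqrt.
rewrite -{1}(sqr_sqrtr T0) -/t => tt; have t0 : 0 <= t by exact: sqrtr_ge0.
by rewrite -(sqr_sqrtr T0) -/t; nra.
Qed.

Lemma continuous_dmoll e i (g : V -> R) : 0 < e -> mu.-integrable setT (EFin \o g) ->
  continuous (dmoll e i g).
Proof. by move=> e0 gi; have [C] := dmoll_lip i e0 gi; exact: lip_continuous. Qed.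

Lemma dmoll_bounded e i (g : V -> R) : 0 < e -> mu.-integrable setT (EFin \o g) ->
  exists C, forall x, `|dmoll e i g x| <= C.
Proof.
move=> e0 gi; exists (4 / e / mass (m := m) e * \int[mu]_y `|g y|) => x.
apply: Rintegral_kernel_le => //; first exact: measurable_ndrho_sub.
by move=> y; exact: ndrho_bound.
Qed.

Lemma integrable_mul_dmoll e i (g eta : V -> R) : 0 < e ->
  mu.-integrable setT (EFin \o g) -> mu.-integrable setT (EFin \o eta) ->
  mu.-integrable setT (EFin \o (fun x => eta x * dmoll e i g x)).
Proof.
move=> e0 gi ei; have [C HC] := dmoll_bounded i e0 gi.
apply: (eq_integrable _ (EFin \o (fun x => dmoll e i g x * eta x))) => //.
  by move=> x _; rewrite /= mulrC.
apply: integrable_kernel HC ei; apply: continuous_measurable_rV.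
exact: continuous_dmoll.
Qed.

Lemma RintegralN (f : V -> R) : mu.-integrable setT (EFin \o f) ->
  \int[mu]_x (- f x) = - \int[mu]_x f x.
Proof.
by move=> fi; under eq_Rintegral do rewrite -mulN1r; rewrite RintegralZl// mulN1r.
Qed.

Lemma enorm_le1 (x : V) : (enorm x <= 1) = (\sum_i x ord0 i ^+ 2 <= 1).
Proof. by rewrite /enorm -[X in _ <= X = _]sqrtr1 ler_sqrt. Qed.

Lemma enorm_coor (x : V) i : `|x ord0 i| <= enorm x.
Proof.
rewrite -sqrtr_sqr /enorm ler_sqrt; last by apply: sumr_ge0 => j _; exact: sqr_ge0.
by rewrite (bigD1 i)//= lerDl; apply: sumr_ge0 => j _; exact: sqr_ge0.
Qed.

Lemma C1_compact_le (f : V -> R) df M C M' C' : M <= M' -> C <= C' ->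
  C1_compact f df M C -> C1_compact f df M' C'.
Proof.
move=> MM CC [a b c d e f0]; split => //.
- exact: le_trans CC.
- by move=> x /(le_trans MM); exact: c.
- by move=> i x /(le_trans MM); exact: d.
- by move=> i x; rewrite (le_trans (e _ _)).
- by move=> x; rewrite (le_trans (f0 _)).
Qed.

End more_mollifier.

(** * Submodularity of the perimeter *)

Section half_space.
Context {R : realType} {n : nat}.
Local Notation mu := (@lebesgue_rV R n.+1).
Local Notation V := 'rV[R]_n.+1.
Local Notation Om := (@Omega R n).

Definition part (phi : V -> V) (j i : 'I_n.+1) (x : V) : R :=
  ('D_(unit_rV i) phi x) ord0 j.

(** A compact support inside the open half-space stays at a positive height [delta], as the last
    coordinate attains its minimum. This margin is what mollification may consume. *)
Lemma test_field_Omega (phi : V -> V) : test_field Om phi ->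
  exists M delta, [/\ 0 < delta,
    forall x, phi x != 0 -> `|x| <= M /\ delta <= x ord0 ord_max &
    exists C, forall j, C1_compact (fun x => phi x ord0 j) (part phi j) M C].
Proof.
move=> [cphi cK KU e1]; set K := closure _ in cK KU.
have sK x : phi x != 0 -> K x by exact: (@subset_closure _ [set y | phi y != 0] x).
have [M0 [_ HM0]] := compact_bounded cK; pose M := `|M0| + 1.
have KM x : K x -> `|x| <= M.
  by move=> Kx; apply: (HM0 M) => //; rewrite (le_lt_trans (ler_norm _))// ltrDl.
have [delta d0 Kd] : exists2 delta, 0 < delta & forall x, K x -> delta <= x ord0 ord_max.
  have [[x0 Kx0]|K0] := pselect (K !=set0); last first.
    by exists 1 => // x Kx; exfalso; apply: K0; exists x.
  have [||c /set_mem Kc cmin] := @compact_EVT_min _ R (fun x : V => x ord0 ord_max) K _ cK.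
  - by exists x0.
  - by apply: continuous_subspaceT => x; exact: coord_continuous.
  exists (c ord0 ord_max) => [|x Kx]; first exact: (KU _ Kc).
  by apply: cmin; exact: mem_set.
exists (M + 1 + 1), delta; split => //.
  by move=> x /sK Kx; split; [rewrite (le_trans (KM _ Kx))// -addrA lerDl|exact: Kd].
have /choice[C HC] : forall j, exists C, C1_compact (fun x => phi x ord0 j) (part phi j) (M + 1 + 1) C.
  move=> j; apply: pC1_compact; first exact: C1_pC1.
    move=> x Mx; have [->|/sK /KM] := eqVneq (phi x) 0; first by rewrite mxE.
    by move=> xM; exfalso; lra.
  by exists 1 => // x; rewrite (le_trans (enorm_coor _ _)).
exists (\sum_j `|C j|) => j; apply: C1_compact_le (HC j) => //.
rewrite (bigD1 j)//= (le_trans (ler_norm _))// lerDl.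
by apply: sumr_ge0.
Qed.

Lemma test_fieldI (phi : V -> V) (M delta : R) : C1 phi -> 0 < delta ->
  (forall x, phi x != 0 -> `|x| <= M /\ delta <= x ord0 ord_max) ->
  (forall x, \sum_i phi x ord0 i ^+ 2 <= 1) -> test_field Om phi.
Proof.
move=> cphi d0 sphi p1; pose K : set V := [set x : V | `|x| <= M] `&` [set x : V | delta <= x ord0 ord_max].
have cK : closed K.
  apply: closedI.
    have /continuous_closedP : continuous (fun x : V => `|x| : R) by exact: norm_continuous.
    by move/(_ [set r | r <= M] (@closed_le _ M)).
  have /continuous_closedP : continuous (fun x : V => x ord0 ord_max) by exact: coord_continuous.
  by move/(_ [set r | delta <= r] (@closed_ge _ delta)).
have sK : closure [set x | phi x != 0] `<=` K.
  rewrite [X in _ `<=` X]((closure_id K).1 cK); apply: closure_subset => x /sphi[? ?].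
  by split.
split => //.
- apply: (subclosed_compact (B := K)) => //; first exact: closed_closure.
  apply: bounded_closed_compact => //; exists M; split; first exact: num_real.
  by move=> r Mr x [/= xM _]; rewrite (le_trans xM)// ltW.
- by move=> x /sK[_ /=]; exact: lt_le_trans.
- by move=> x; rewrite enorm_le1.
Qed.

Lemma integral_indic_Omega (E : set V) (h : V -> R) : E `<=` Om ->
  (\int[mu]_(x in Om) (\1_E x * h x)%:E = \int[mu]_x (\1_E x * h x)%:E)%E.
Proof.
move=> EO; rewrite integral_mkcond; apply: eq_integral => x _.
rewrite patchE; case: ifPn => // /negP xO; rewrite indicE memNset ?mul0r// => /EO Ox.
by apply: xO; exact: mem_set.
Qed.

(* By Fubini, testing the gradient of [moll e \1_E] with [eta] amounts to testing
   that of [\1_E] with the mollification of [eta]. *)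
Lemma moll_variation_le (E : set V) (e M delta : R) (eta : 'I_n.+1 -> V -> R) :
  measurable E -> E `<=` Om -> (mu E < +oo)%E -> 0 < e -> 0 < delta ->
  (forall i, measurable_fun setT (eta i)) ->
  (forall x, \sum_i eta i x ^+ 2 <= 1) ->
  (forall i x, eta i x != 0 -> `|x| <= M /\ delta + e <= x ord0 ord_max) ->
  ((- \int[mu]_x \sum_i eta i x * dmoll e i \1_E x)%:E <=
   Defs.total_variation Om \1_E)%E.
Proof.
move=> mE EO Eoo e0 d0 meta eta1 seta; have Ei := integrable_indic_lty mE Eoo; clear Eoo.
have etaC i x : `|eta i x| <= 1.
  rewrite -sqrtr_sqr -[X in _ <= X]sqrtr1 ler_sqrt// (le_trans _ (eta1 x))//.
  by rewrite (bigD1 i)//= lerDl; apply: sumr_ge0 => j _; exact: sqr_ge0.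
have etai i : mu.-integrable setT (EFin \o eta i).
  apply: (bounded_support_integrable (meta i) (etaC i) (M := M + 1)) => x Mx.
  by apply/eqP/negPn/negP => /seta[xM _]; lra.
pose Phi (z : V) : V := \row_i moll e (eta i) z.
have dPhi j : pC1 (fun x => Phi x ord0 j) (fun i => dmoll e i (eta j)).
  rewrite (_ : (fun x => _) = moll e (eta j)); first exact: moll_pC1.
  by apply/funext => x; rewrite mxE.
have [cPhi DPhi] := pC1_C1 dPhi.
(* Mollifying at scale [e] spreads supports by less than [e]: the radius [M] grows to [M + e] and
   the height [delta + e] drops to [delta]. *)
have tPhi : test_field Om Phi.
  apply: (test_fieldI (M := M + e) (delta := delta)) => //; last first.
    by move=> x; under eq_bigr do rewrite mxE; exact: moll_sum_sqr_le1.
  move=> x; apply: contraNP => H; apply/eqP/rowP => i; rewrite !mxE.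
  apply/eqP/negPn/negP => /(moll_neq0 e0)[y /seta[yM yd] xy]; apply: H; split.
    by have := ler_normD y (x - y); rewrite addrC subrK; lra.
  have := rV_norm_ge (x - y) ord_max; rewrite !mxE ler_norml => /andP[]; lra.
apply: le_trans (ereal_sup_ubound _); last by exists Phi.
rewrite integral_indic_Omega//.
have iD i : mu.-integrable setT (EFin \o (fun y => \1_E y * dmoll e i (eta i) y)).
  exact: integrable_mul_dmoll.
have iE i : mu.-integrable setT (EFin \o (fun y => eta i y * dmoll e i \1_E y)).
  exact: integrable_mul_dmoll.
rewrite Rintegral_sum// -sumrN.
rewrite (eq_bigr (fun i => \int[mu]_y (\1_E y * dmoll e i (eta i) y))); last first.
  move=> i _; rewrite dmoll_fubini//; under eq_Rintegral do rewrite mulrN.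
  by rewrite RintegralN// opprK.
rewrite -Rintegral_sum// EFin_Rintegral//; last exact: integrable_Rsum.
rewrite le_eqVlt; apply/orP; left; apply/eqP; apply: eq_integral => x _.
rewrite -mulr_sumr /divergence; congr (_ * _)%:E; apply: eq_bigr => i _.
by rewrite -/(unit_rV i) DPhi mxE.
Qed.

End half_space.

(** * The perimeter inequality for intersection and union *)

Section submodularity.
Context {R : realType} {n : nat}.
Local Notation mu := (@lebesgue_rV R n.+1).
Local Notation V := 'rV[R]_n.+1.
Local Notation Om := (@Omega R n).
Local Notation TV E := (Defs.total_variation Om (\1_E : V -> R)).

Lemma indic_bound (A : set V) x : `|\1_A x : R| <= 1.
Proof. by rewrite indicE; case: (_ \in _); rewrite ?normr1 ?normr0. Qed.

Lemma integrable_indic_mul (A : set V) (f : V -> R) : measurable A ->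
  mu.-integrable setT (EFin \o f) ->
  mu.-integrable setT (EFin \o (fun x => \1_A x * f x)).
Proof. by move=> mA; apply: integrable_kernel => //; exact: indic_bound. Qed.

Lemma moll_indic_bound e (F : set V) x : 0 < e -> measurable F ->
  (mu F < +oo)%E -> 0 <= moll e \1_F x <= 1.
Proof.
move=> e0 mF Foo; rewrite moll_ge0//=; apply: moll_le1 => //.
exact: integrable_indic_lty.
Qed.

Lemma integrable_moll_mul e (F : set V) (W : V -> R) : 0 < e -> measurable F ->
  (mu F < +oo)%E -> mu.-integrable setT (EFin \o W) ->
  mu.-integrable setT (EFin \o (fun x => moll e \1_F x * W x)).
Proof.
move=> e0 mF Foo; apply: (@integrable_kernel _ _ _ _ _ _ 1).
  apply: continuous_measurable_rV; apply: continuous_moll => //.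
  exact: integrable_indic_lty.
by move=> x; have /andP[f0 f1] := moll_indic_bound x e0 mF Foo; rewrite ger0_norm.
Qed.

Lemma moll_weak_cvg (F : set V) (W : V -> R) : measurable F -> (mu F < +oo)%E ->
  mu.-integrable setT (EFin \o W) ->
  \int[mu]_x (moll k.+1%:R^-1 \1_F x * W x) @[k --> \oo] -->
  \int[mu]_x (\1_F x * W x).
Proof.
move=> mF Foo Wi; have e0 k : 0 < k.+1%:R^-1 :> R by rewrite invr_gt0.
have iW k := integrable_moll_mul (e0 k) mF Foo Wi.
have iFW := integrable_indic_mul mF Wi.
have [|||||_ _] := @dominated_convergence _ _ _ mu setT measurableT
  (fun k x => (moll k.+1%:R^-1 \1_F x * W x)%:E) (fun x => (\1_F x * W x)%:E)
  (fun x => `|W x|%:E).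
- by move=> k; exact: (measurable_int _ (iW k)).
- exact: (measurable_int _ iFW).
- apply: filterS (moll_indic_cvg mF) => x Hx _; apply: cvg_EFin; first exact: nearW.
  by apply: cvgM => //; exact: cvg_cst.
- exact: integrable_norm.
- apply: aeW => x k _; rewrite lee_fin normrM.
  have /andP[f0 f1] := moll_indic_bound x (e0 k) mF Foo.
  by rewrite (ger0_norm f0) ler_piMl.
by rewrite -EFin_Rintegral// => /fine_cvg.
Qed.

Lemma test_field0 : test_field Om (fun=> 0 : V).
Proof.
have dz (j : 'I_n.+1) : pC1 (fun x : V => (0 : V) ord0 j) (fun _ _ => 0 : R).
  move=> i; split; first by move=> x; exact: cst_continuous.
  move=> x; rewrite (_ : (fun _ => _) = cst (0 : R)); last by apply/funext => y; rewrite mxE.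
  exact: is_derive_cst.
have [c0 _] := pC1_C1 dz.
apply: (@test_fieldI _ _ (fun=> 0) 0 1) => // x; first by rewrite eqxx.
by rewrite big1// => i _; rewrite mxE expr0n.
Qed.

Lemma tv_ge0 (E : set V) : (0 <= TV E)%E.
Proof.
apply: ereal_sup_ubound; exists (fun=> 0); first exact: test_field0.
apply: integral0_eq => x _; rewrite /divergence big1 ?mulr0// => i _.
by rewrite derive_cst mxE.
Qed.

(* With [f] a mollification of [\1_F] and [a := \1_E], the fields
   [psi + f (phi - psi)] and [a phi + (1 - a) psi] are admissible for [E] and
   for [F] respectively, and the terms containing the gradient of [f] add up to
   [div (f psi)], which has integral 0. *)
Lemma submod_moll (E F : set V) (phi psi : V -> V) :
  measurable E -> E `<=` Om -> (mu E < +oo)%E ->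
  measurable F -> F `<=` Om -> (mu F < +oo)%E ->
  test_field Om phi -> test_field Om psi ->
  \forall k \near \oo,
  ((\int[mu]_x (\1_E x * divergence psi x) +
    \int[mu]_x (moll k.+1%:R^-1 \1_F x *
      (\1_E x * (divergence phi x - divergence psi x) + divergence psi x)))%:E
  <= TV E + TV F)%E.
Proof.
move=> mE EO Eoo mF FO Foo tphi tpsi.
have [M1 [d1 [d10 s1 [C1 H1]]]] := test_field_Omega tphi.
have [M2 [d2 [d20 s2 [C2 H2]]]] := test_field_Omega tpsi.
have n1 x : \sum_i phi x ord0 i ^+ 2 <= 1.
  by rewrite -enorm_le1; have [_ _ _] := tphi; exact.
have n2 x : \sum_i psi x ord0 i ^+ 2 <= 1.
  by rewrite -enorm_le1; have [_ _ _] := tpsi; exact.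
have Fi := integrable_indic_lty mF Foo.
pose d := Num.min d1 d2; pose M := Num.max M1 M2.
have d0 : 0 < d by rewrite lt_min d10.
have s1' x : phi x != 0 -> `|x| <= M /\ d <= x ord0 ord_max.
  by move=> /s1[xM xd]; rewrite le_max xM ge_min xd.
have s2' x : psi x != 0 -> `|x| <= M /\ d <= x ord0 ord_max.
  by move=> /s2[xM xd]; rewrite le_max xM ge_min xd !orbT.
have [N _ HN] := near_infty_natSinv_lt (PosNum (divr_gt0 d0 (ltr0Sn R 1))).
exists N => // k /= Nk; have {HN} ed := HN k Nk; rewrite /= in ed.
set e := k.+1%:R^-1 in ed *; have e0 : 0 < e by rewrite invr_gt0.
set f := moll e \1_F; pose Df i := dmoll e i \1_F.
have Hf : pC1 f Df by exact: moll_pC1.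
have cf : continuous f by exact: continuous_moll.
have f01 x : 0 <= f x <= 1 by exact: moll_indic_bound.
have cphi j := C1_compact_continuous (H1 j).
have cpsi j := C1_compact_continuous (H2 j).
pose zeta (x : V) : V := psi x + f x *: (phi x - psi x).
have Hz j : pC1 (fun x => zeta x ord0 j) (fun i x => part psi j i x +
    (f x * (part phi j i x - part psi j i x) + (phi x ord0 j - psi x ord0 j) * Df i x)).
  rewrite (_ : (fun x => _) = fun x => psi x ord0 j + f x * (phi x ord0 j - psi x ord0 j)).
    apply: pC1D; first exact: (C1c_pC1 (H2 j)).
    apply: pC1M => //; first exact: continuous_sub.
    by apply: pC1B; [exact: (C1c_pC1 (H1 j))|exact: (C1c_pC1 (H2 j))].
  by apply/funext => x; rewrite !mxE.
have [cz Dz] := pC1_C1 Hz.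
have sz x : zeta x != 0 -> `|x| <= M /\ d <= x ord0 ord_max.
  have [p0|/s1' //] := eqVneq (phi x) 0.
  have [q0|/s2' //] := eqVneq (psi x) 0.
  by rewrite /zeta p0 q0 subrr scaler0 addr0 eqxx.
(* [zeta] is the convex combination of [phi] and [psi] with weights [f] and [1 - f], and squaring is
   convex. *)
have nz x : \sum_i zeta x ord0 i ^+ 2 <= 1.
  have /andP[f0 f1] := f01 x.
  apply: (@le_trans _ _ (\sum_i (f x * phi x ord0 i ^+ 2 + (1 - f x) * psi x ord0 i ^+ 2))).
    apply: ler_sum => i _; rewrite !mxE.
    have : 0 <= f x * (1 - f x) * (phi x ord0 i - psi x ord0 i) ^+ 2.
      by apply: mulr_ge0; [apply: mulr_ge0 => //; lra|exact: sqr_ge0].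
    by rewrite !expr2; lra.
  rewrite big_split/= -!mulr_sumr.
  by have := n1 x; have := n2 x; move: (\sum_i _) (\sum_i _) => S1 S2; nra.
have tz : test_field Om zeta by exact: (test_fieldI cz d0 sz nz).
pose eta i (x : V) := \1_E x * phi x ord0 i + (1 - \1_E x) * psi x ord0 i.
have mI : measurable_fun setT (\1_E : V -> R) by exact: measurable_indic.
have meta i : measurable_fun setT (eta i).
  apply: measurable_funD; apply: measurable_funM => //.
  - exact: continuous_measurable_rV.
  - exact: measurable_funB.
  - exact: continuous_measurable_rV.
have etaE x : (forall i, eta i x = phi x ord0 i) \/ (forall i, eta i x = psi x ord0 i).
  rewrite /eta indicE; case: (x \in E); [left|right] => i.
    by rewrite mul1r subrr mul0r addr0.
  by rewrite mul0r subr0 mul1r add0r.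
have neta x : \sum_i eta i x ^+ 2 <= 1.
  by have [H|H] := etaE x; under eq_bigr do rewrite H.
have seta i x : eta i x != 0 -> `|x| <= M /\ d / 2 + e <= x ord0 ord_max.
  have [H|H] := etaE x; rewrite H => nz0.
    have [|xM xd] := s1' x; last by split => //; lra.
    by apply: contraNneq nz0 => ->; rewrite mxE.
  have [|xM xd] := s2' x; last by split => //; lra.
  by apply: contraNneq nz0 => ->; rewrite mxE.
(* [eta] jumps across the boundary of [E], which is harmless here as only measurability is asked.
   The choice [e < d / 2] leaves the height [d / 2 + e] below [d]. *)
have HF := moll_variation_le mF FO Foo e0 (divr_gt0 d0 (ltr0Sn R 1)) meta neta seta.
pose B i (x : V) := \1_E x * (part psi i i x + (f x * (part phi i i x - part psi i i x) +
  (phi x ord0 i - psi x ord0 i) * Df i x)).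
have Hzc i : exists C, C1_compact (fun x => zeta x ord0 i) (fun j x => part psi i j x +
    (f x * (part phi i j x - part psi i j x) + (phi x ord0 i - psi x ord0 i) * Df j x)) (M + 1 + 1) C.
  apply: pC1_compact => //.
    move=> x Mx; have [->|/sz[xM _]] := eqVneq (zeta x) 0; first by rewrite mxE.
    by move: xM Mx; clear; lra.
  by exists 1 => // x; rewrite (le_trans (enorm_coor _ _))// enorm_le1.
have iB i : mu.-integrable setT (EFin \o B i).
  by apply: integrable_indic_mul => //; have [C HC] := Hzc i; exact: (C1_compact_dintegrable i HC).
have HE : ((\int[mu]_x \sum_i B i x)%:E <= TV E)%E.
  apply: le_trans (ereal_sup_ubound _); last by exists zeta.
  rewrite integral_indic_Omega// EFin_Rintegral//; last exact: integrable_Rsum.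
  rewrite le_eqVlt; apply/orP; left; apply/eqP; apply: eq_integral => x _.
  rewrite /B -mulr_sumr /divergence; congr (_ * _)%:E; apply: eq_bigr => i _.
  by rewrite -/(unit_rV i) Dz mxE.
pose G i (x : V) := eta i x * Df i x.
pose H i (x : V) := f x * part psi i i x + psi x ord0 i * Df i x.
have Hc i : exists C, C1_compact (fun x => f x * psi x ord0 i)
    (fun j x => f x * part psi i j x + psi x ord0 i * Df j x) (M2 + 1) C.
  apply: pC1_compact.
  - by apply: pC1M => //; exact: (C1c_pC1 (H2 i)).
  - by move=> x Mx; rewrite (C1c_f0 (H2 i)) ?mulr0.
  - exists C2; first exact: (C1c_C0 (H2 i)).
    move=> x; have /andP[f0 f1] := f01 x; rewrite normrM (ger0_norm f0).
    by rewrite (le_trans _ (C1c_f (H2 i) x))// ler_piMl.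
have iH i : mu.-integrable setT (EFin \o H i).
  by have [C HC] := Hc i; exact: (C1_compact_dintegrable i HC).
have H0 i : \int[mu]_x H i x = 0.
  by have [C HC] := Hc i; exact: (integral_partial_eq0 i HC).
have ipsi i : mu.-integrable setT (EFin \o part psi i i) by exact: (C1_compact_dintegrable i (H2 i)).
have iphi i : mu.-integrable setT (EFin \o part phi i i) by exact: (C1_compact_dintegrable i (H1 i)).
have ieta i : mu.-integrable setT (EFin \o eta i).
  have eta1 x : `|eta i x| <= 1.
    rewrite -sqrtr_sqr -[X in _ <= X]sqrtr1 ler_sqrt// (le_trans _ (neta x))//.
    by rewrite (bigD1 i)//= lerDl; apply: sumr_ge0 => j _; exact: sqr_ge0.
  apply: (bounded_support_integrable (meta i) eta1 (M := M + 1)) => x Mx.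
  by apply/eqP/negPn/negP => /seta[xM _]; move: xM Mx; clear; lra.
have iG i : mu.-integrable setT (EFin \o G i) by exact: integrable_mul_dmoll.
pose A i (x : V) := \1_E x * part psi i i x +
  f x * (\1_E x * (part phi i i x - part psi i i x) + part psi i i x).
have iU : mu.-integrable setT (EFin \o (fun x => \1_E x * divergence psi x)).
  by apply: integrable_indic_mul => //; exact: integrable_Rsum.
have iW : mu.-integrable setT (EFin \o (fun x => f x *
    (\1_E x * (divergence phi x - divergence psi x) + divergence psi x))).
  apply: integrable_moll_mul => //; apply: integrable_add; last exact: integrable_Rsum.
  by apply: integrable_indic_mul => //; apply: integrable_sub; exact: integrable_Rsum.
rewrite -RintegralD//.
have -> : \int[mu]_x (\1_E x * divergence psi x + f x *
    (\1_E x * (divergence phi x - divergence psi x) + divergence psi x)) =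
  \int[mu]_x \sum_i B i x - \int[mu]_x \sum_i G i x + \int[mu]_x \sum_i H i x.
  rewrite -RintegralB//; [|exact: integrable_Rsum|exact: integrable_Rsum].
  rewrite -RintegralD//; [|by apply: integrable_sub; exact: integrable_Rsum|exact: integrable_Rsum].
  apply: eq_Rintegral => x _; transitivity (\sum_i A i x).
    by rewrite /A big_split/= -!mulr_sumr big_split/= -mulr_sumr sumrB.
  (* The products of [\1_E (phi - psi)] with [Df] cancel between [B] and [G], those of [psi] with
     [Df] between [G] and [H]. *)
  rewrite -sumrB -big_split/=; apply: eq_bigr => i _.
  by rewrite /A /B /G /H /eta; ring.
rewrite [X in _ + X]Rintegral_sum// [X in _ + X]big1 ?addr0//.
by rewrite EFinD; exact: leeD.
Qed.

Lemma indic_setU_setI (E F : set V) x :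
  (\1_E x + \1_F x - \1_E x * \1_F x = \1_(E `|` F) x :> R) /\
  (\1_E x * \1_F x = \1_(E `&` F) x :> R).
Proof.
rewrite !indicE in_setU in_setI.
by split; case: (x \in E); case: (x \in F) => /=; ring.
Qed.

(** Writes the two tested integrals as an expression affine in [\1_F], so that replacing [\1_F]
    alone by its mollification is enough, and weak convergence recovers the original. *)
Lemma integral_indic_setU_setI (E F : set V) (p q : V -> R) :
  measurable E -> measurable F ->
  mu.-integrable setT (EFin \o p) -> mu.-integrable setT (EFin \o q) ->
  \int[mu]_x (\1_(E `&` F) x * p x) + \int[mu]_x (\1_(E `|` F) x * q x) =
  \int[mu]_x (\1_E x * q x) + \int[mu]_x (\1_F x * (\1_E x * (p x - q x) + q x)).
Proof.
move=> mE mF ip iq.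
have mI := measurableI _ _ mE mF; have mU := measurableU _ _ mE mF.
have iW : mu.-integrable setT (EFin \o (fun x => \1_E x * (p x - q x) + q x)).
  by apply: integrable_add => //; apply: integrable_indic_mul => //; exact: integrable_sub.
have i1 := integrable_indic_mul mI ip; have i2 := integrable_indic_mul mU iq.
have i3 := integrable_indic_mul mE iq; have i4 := integrable_indic_mul mF iW.
apply: etrans (esym (RintegralD measurableT i1 i2)) _.
apply: etrans _ (RintegralD measurableT i3 i4).
apply: eq_Rintegral => x _; have [<- <-] := indic_setU_setI E F x; ring.
Qed.

Lemma cvg_add_le (u : nat -> R) (a l c : R) : u @ \oo --> l ->
  (\forall k \near \oo, a + u k <= c) -> a + l <= c.
Proof.
move=> ul H; have cU : a + u k @[k --> \oo] --> a + l.
  by apply: cvgD => //; exact: cvg_cst.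
rewrite -(cvg_lim (@Rhausdorff _) cU); apply: limr_le => //.
by apply/cvg_ex; eexists; exact: cU.
Qed.

Lemma integrable_divergence (phi : V -> V) : test_field Om phi ->
  mu.-integrable setT (EFin \o divergence phi).
Proof.
move=> /test_field_Omega[M [d [_ _ [C HC]]]].
by apply: integrable_Rsum => i; exact: (C1_compact_dintegrable i (HC i)).
Qed.

(** For each pair of fields the inequality is the limit of the mollified one; the suprema over [phi]
    and then over [psi] are taken separately. An infinite right side is set apart first. *)
Lemma total_variation_submod (E F : set V) :
  measurable E -> E `<=` Om -> (mu E < +oo)%E ->
  measurable F -> F `<=` Om -> (mu F < +oo)%E ->
  (TV (E `&` F) + TV (E `|` F) <= TV E + TV F)%E.
Proof.
move=> mE EO Eoo mF FO Foo.
have [Efin|] := boolP (TV E \is a fin_num); last first.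
  by rewrite ge0_fin_numE ?tv_ge0// -leNgt leye_eq => /eqP ->; rewrite addye ?leey// gt_eqF// (lt_le_trans _ (tv_ge0 _)).
have [Ffin|] := boolP (TV F \is a fin_num); last first.
  by rewrite ge0_fin_numE ?tv_ge0// -leNgt leye_eq => /eqP ->; rewrite addey ?leey// gt_eqF// (lt_le_trans _ (tv_ge0 _)).
have mI := measurableI _ _ mE mF; have mU := measurableU _ _ mE mF.
have divi := integrable_divergence.
have key (phi psi : V -> V) : test_field Om phi -> test_field Om psi ->
  ((\int[mu]_x (\1_(E `&` F) x * divergence phi x) +
    \int[mu]_x (\1_(E `|` F) x * divergence psi x))%:E <= TV E + TV F)%E.
  move=> tphi tpsi; have iphi := divi _ tphi; have ipsi := divi _ tpsi.
  pose W x := \1_E x * (divergence phi x - divergence psi x) + divergence psi x.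
  have iW : mu.-integrable setT (EFin \o W).
    by apply: integrable_add => //; apply: integrable_indic_mul => //; exact: integrable_sub.
  have -> : \int[mu]_x (\1_(E `&` F) x * divergence phi x) +
      \int[mu]_x (\1_(E `|` F) x * divergence psi x) =
      \int[mu]_x (\1_E x * divergence psi x) + \int[mu]_x (\1_F x * W x).
    exact: integral_indic_setU_setI.
  rewrite -(fineK Efin) -(fineK Ffin) -EFinD lee_fin.
  have cW := moll_weak_cvg mF Foo iW.
  apply: cvg_add_le cW _.
  apply: filterS (submod_moll mE EO Eoo mF FO Foo tphi tpsi) => k.
  by rewrite -{1}(fineK Efin) -{1}(fineK Ffin) -EFinD lee_fin.
have IO : E `&` F `<=` Om by move=> x [/EO].
have UO : E `|` F `<=` Om by move=> x [/EO|/FO].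
have step (psi : V -> V) : test_field Om psi ->
    (TV (E `&` F) + (\int[mu]_x (\1_(E `|` F) x * divergence psi x))%:E <= TV E + TV F)%E.
  move=> tpsi; rewrite -leeBrDr//; apply: ge_ereal_sup => _ [phi tphi <-].
  rewrite integral_indic_Omega// -EFin_Rintegral//; last by apply: integrable_indic_mul => //; exact: divi.
  by rewrite leeBrDr// -EFinD; exact: key.
(* Finiteness is required to move this term across the inequality; testing the union with the zero
   field gives it. *)
have Ifin : TV (E `&` F) \is a fin_num.
  rewrite ge0_fin_numE ?tv_ge0// ltey; apply/negP => /eqP Ioo.
  have t0 : test_field Om (fun=> 0 : V) by exact: test_field0.
  have := step _ t0; rewrite Ioo addye// leye_eq => /eqP H.
  by have := fin_numD (TV E) (TV F); rewrite H Efin Ffin.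
rewrite addeC -leeBrDr//; apply: ge_ereal_sup => _ [psi tpsi <-].
rewrite integral_indic_Omega// -EFin_Rintegral//; last by apply: integrable_indic_mul => //; exact: divi.
by rewrite leeBrDr// addeC; exact: step.
Qed.

End submodularity.

(** * Traces *)

Section slices.
Context {R : realType} {n : nat}.
Local Notation mu := (@lebesgue_rV R n.+1).
Local Notation nu := (@lebesgue_rV R n).
Local Notation leb := (@lebesgue_measure R).
Local Notation V := 'rV[R]_n.+1.
Local Notation Om := (@Omega R n).

Definition slice (A : set V) (y : 'rV[R]_n) : set R := [set s | A (rV_snoc (y, s))].

Lemma measurable_snoc_preimage (A : set V) : measurable A ->
  measurable (@rV_snoc R n @^-1` A).
Proof. by move=> mA; rewrite -[X in measurable X]setTI; exact: measurable_rV_snoc. Qed.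

Lemma sliceE (A : set V) y : slice A y = xsection (@rV_snoc R n @^-1` A) y.
Proof. by apply/seteqP; split => s; rewrite /xsection /slice /= inE. Qed.

Lemma measurable_slice (A : set V) y : measurable A -> measurable (slice A y).
Proof.
by move=> mA; rewrite sliceE; apply: measurable_xsection; exact: measurable_snoc_preimage.
Qed.

Lemma measurable_fun_slice (A : set V) : measurable A ->
  measurable_fun setT (fun y => leb (slice A y)).
Proof.
move=> mA; have := measurable_fun_xsection leb (measurable_snoc_preimage mA).
by apply: eq_measurable_fun => y _; rewrite /= sliceE.
Qed.

Lemma ae_slice (P : V -> Prop) : {ae mu, forall x, P x} ->
  {ae nu, forall y, {ae leb, forall s, P (rV_snoc (y, s))}}.
Proof.
move=> [N [mN N0 PN]]; have := lebesgue_rVS mN; rewrite N0 => /esym N0'.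
have mf := measurable_fun_slice mN.
have : (\int[nu]_y `|leb (slice N y)| = 0)%E.
  by rewrite -N0'; apply: eq_integral => y _; rewrite gee0_abs.
move=> /(ae_eq_integral_abs nu measurableT mf); apply: filterS => y /(_ I) /= Ny.
exists (slice N y); split => //; first exact: measurable_slice.
by move=> s /= nP; exact: PN.
Qed.

Definition strip (d : R) : set V := [set x | 0 < x ord0 ord_max < d].

Lemma measurable_strip d : measurable (strip d).
Proof.
rewrite (_ : strip d = (fun x : V => x ord0 ord_max) @^-1` `]0, d[).
  by rewrite -[X in measurable X]setTI; exact: measurable_coor.
by apply/seteqP; split => x; rewrite /= in_itv.
Qed.

Lemma slice_strip (A : set V) d y : slice (A `&` strip d) y = slice A y `&` `]0, d[.
Proof.
by apply/seteqP; split => s; rewrite /slice /strip /= in_itv/= mxE unlift_none.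
Qed.

(** A one-dimensional substitute for a vanishing trace, measurable in [y] by Fubini. Applied to the
    complement, it says that the line starts inside [A]. *)
Definition low_null (A : set V) (d : R) : set 'rV[R]_n :=
  [set y | leb (slice A y `&` `]0, d[) = 0%E].

Lemma measurable_low_null (A : set V) d : measurable A -> measurable (low_null A d).
Proof.
move=> mA; have mB : measurable (A `&` strip d).
  by apply: measurableI => //; exact: measurable_strip.
have := measurable_fun_slice mB measurableT (emeasurable_set1 0%E).
rewrite setTI; congr measurable; apply/seteqP; split => y /=; by rewrite slice_strip.
Qed.

Lemma low_null_le (A : set V) d d' : measurable A -> d' <= d -> low_null A d `<=` low_null A d'.
Proof.
move=> mA dd y Ay; apply/eqP; rewrite -measure_le0 -Ay le_measure ?inE//.
- by apply: measurableI => //; exact: measurable_slice.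
- by apply: measurableI => //; exact: measurable_slice.
- by apply: setIS => s /=; rewrite !in_itv/= => /andP[-> sd]; rewrite (lt_le_trans sd).
Qed.

Lemma enorm_le_sum m (x : 'rV[R]_m) : enorm x <= \sum_i `|x ord0 i|.
Proof.
have S0 : 0 <= \sum_i `|x ord0 i| by apply: sumr_ge0.
rewrite -(ger0_norm S0) -sqrtr_sqr /enorm ler_sqrt ?sqr_ge0//.
rewrite expr2 mulr_suml; apply: ler_sum => i _.
rewrite -(real_normK (num_real (x ord0 i))) expr2 ler_wpM2l// (bigD1 i)//= lerDl.
exact: sumr_ge0.
Qed.

Definition half_ball y r : set V := Om `&` eball (bd y) r.

Lemma bd_coor (y : 'rV[R]_n) : (forall j, bd y ord0 (lift ord_max j) = y ord0 j) /\
  bd y ord0 ord_max = 0.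
Proof. by split => [j|]; rewrite /bd /rV_snoc mxE ?liftK ?unlift_none. Qed.

Lemma measurable_eball m (x : 'rV[R]_m) r : measurable (eball x r).
Proof.
have mf : measurable_fun setT (fun y : 'rV[R]_m => enorm (y - x)).
  apply: (measurableT_comp (continuous_measurable_fun (@sqrt_continuous R))).
  apply: measurable_sum => i; apply: measurable_funX.
  apply: (eq_measurable_fun (fun y : 'rV[R]_m => y ord0 i - x ord0 i)).
    by move=> y _; rewrite !mxE.
  by apply: measurable_funB => //; exact: measurable_coor.
rewrite (_ : eball x r = (fun y => enorm (y - x)) @^-1` `]-oo, r[).
  by rewrite -[X in measurable X]setTI; exact: mf.
by apply/seteqP; split => y; rewrite /eball /= in_itv.
Qed.

Lemma measurable_Omega : measurable Om.
Proof.
rewrite (_ : Om = (fun x : V => x ord0 ord_max) @^-1` `]0, +oo[).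
  by rewrite -[X in measurable X]setTI; exact: measurable_coor.
by apply/seteqP; split => x; rewrite /= in_itv/= andbT.
Qed.

Lemma measurable_half_ball y r : measurable (half_ball y r).
Proof. by apply: measurableI; [exact: measurable_Omega|exact: measurable_eball]. Qed.

Lemma half_ball_sub y r : 0 < r ->
  half_ball y r `<=` [set x | ball y r (rV_unsnoc x).1] `&` strip r.
Proof.
move=> r0 x [Ox xr]; have [b1 b2] := bd_coor y.
have c i : `|x ord0 i - bd y ord0 i| < r.
  have := enorm_coor (x - bd y) i; rewrite !mxE => /le_lt_trans; apply.
  exact: xr.
split.
  apply/rV_ballP => // j; rewrite /rV_unsnoc /= mxE distrC -(b1 j); exact: c.
by have := c ord_max; rewrite b2 subr0 /strip /= Ox => /ltr_normlW.
Qed.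

Definition half_zero_density (A : set V) y := forall e : R, 0 < e ->
  exists2 d, 0 < d & forall r, 0 < r < d ->
  (mu (A `&` half_ball y r) <= (e * r ^+ n.+1)%:E)%E.

(** At a density point of [low_null A d] in R^n, take a half ball of radius [r < d]: lines over
    [low_null A d] contribute nothing, the others at most [r] each, and their base has measure
    [o(r ^ n)]. The total is [o(r ^ n.+1)]. *)
Lemma low_null_density (A : set V) d : measurable A -> 0 < d ->
  {ae nu, forall y, low_null A d y -> half_zero_density A y}.
Proof.
move=> mA d0; have mZ := measurable_low_null d mA.
apply: filterS (zero_density_setC mZ) => y H Zy e e0.
have [d1 d10 Hd1] := H Zy e e0.
exists (Num.min d d1) => [|r]; first by rewrite lt_min d0.
rewrite lt_min => /and3P[r0 rd rd1].
have mB := measurable_rV_ball y r.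
have mD : measurable (A `&` half_ball y r).
  by apply: measurableI => //; exact: measurable_half_ball.
rewrite lebesgue_rVS//.
have mn : measurable (~` low_null A d `&` ball y r) by apply: measurableI => //; exact: measurableC.
apply: (@le_trans _ _ (\int[nu]_z (r%:E * (\1_(~` low_null A d `&` ball y r) z)%:E))%E).
  apply: ge0_le_integral => //.
  - exact: (measurable_fun_slice mD).
  - by apply: emeasurable_funM => //; apply/measurable_EFinP; exact: measurable_indic.
  move=> z _; rewrite -EFinM indicE.
  have sub : slice (A `&` half_ball y r) z `<=` `]0, r[%classic.
    move=> s [_ /(half_ball_sub r0)[_]]; rewrite /strip /= mxE unlift_none.
    by rewrite in_itv.
  have ms := measurable_slice z mD.
  have [zB|zB] := pselect (ball y r z); last first.
    rewrite memNset ?mulr0; last by case.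
    rewrite (_ : [set _ | _] = set0) ?measure0//.
    apply/seteqP; split => // s [_ /(half_ball_sub r0)[+ _]].
    by rewrite /mkset rV_snocK.
  have [zZ|zZ] := pselect (low_null A d z).
    rewrite memNset ?mulr0; last by case.
    have H0 : leb (slice A z `&` `]0, r[) = 0%E := low_null_le mA (ltW rd) zZ.
    rewrite -[leRHS]H0 le_measure ?inE//; first by apply: measurableI => //; exact: measurable_slice.
    by move=> s As; split; [case: As|exact: sub].
  rewrite mem_set// mulr1.
  apply: (@le_trans _ _ (leb `]0, r[%classic)); first by rewrite le_measure ?inE.
  by rewrite lebesgue_measure_itv/= lte_fin r0 sube0.
rewrite ge0_integralZl//; last 2 first.
- by apply/measurable_EFinP; exact: measurable_indic.
- by rewrite lee_fin ltW.
rewrite integral_indic// setIT.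
apply: (@le_trans _ _ (r%:E * (e * r ^+ n)%:E)%E).
  by apply: lee_wpmul2l; [rewrite lee_fin ltW|apply: Hd1; rewrite r0].
by rewrite -EFinM lee_fin exprS mulrCA.
Qed.

(** With [p = r / n.+3], the [n.+1] coordinates are off by at most [p] each, plus [p] for the shift;
    the sum [n.+2 * p] is below [r] and dominates the Euclidean norm. An upward shift places a cube
    inside [Om], a downward one outside. *)
Lemma shifted_ball_sub (z : V) (i : 'I_n.+1) (s r : R) : 0 < r -> `|s| <= 1 ->
  ball (z + (s * (r / n.+3%:R)) *: delta_mx ord0 i : V) (r / n.+3%:R) `<=` eball z r.
Proof.
move=> r0 s1; set p := r / n.+3%:R; have p0 : 0 < p by rewrite divr_gt0.
move=> x /(rV_ballP _ _ p0) xp; rewrite /eball /=; apply: (le_lt_trans (enorm_le_sum _)).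
apply: (@le_lt_trans _ _ (\sum_(j < n.+1) (p + p * (j == i)%:R))).
  apply: ler_sum => j _; have := xp j; rewrite !mxE eqxx/= => H.
  have := ler_distD (z ord0 j + s * p * (j == i)%:R) (x ord0 j) (z ord0 j).
  rewrite [X in _ <= _ + X]distrC => /le_trans; apply.
  rewrite [X in X + _]distrC; apply: lerD; first exact: ltW.
  rewrite distrC addrAC subrr add0r normrM normrM (ger0_norm (ltW p0)) normr_nat.
  by rewrite ler_wpM2r// ler_piMl// ltW.
rewrite big_split/= sumr_const card_ord -mulr_sumr (bigD1 i)//= big1 ?addr0; last first.
  by move=> j /negbTE ->.
rewrite eqxx mulr1 -mulr_natr -[X in _ + X]mulr1 -mulrDr /p -natr1 -!natr1.
have n0 : 0 <= n%:R :> R by [].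
by rewrite mulrAC ltr_pdivrMr ?ltr_pM2l//; lra.
Qed.

Lemma half_ball_ge y r : 0 < r ->
  (((2 * (r / n.+3%:R)) ^+ n.+1)%:E <= mu (half_ball y r))%E.
Proof.
move=> r0; pose p := r / n.+3%:R; have p0 : 0 < p by rewrite divr_gt0.
have [_ b2] := bd_coor y; have mh := measurable_half_ball y r.
move: mh b2; rewrite /half_ball; move: (bd y) => z mh b2.
rewrite -(lebesgue_rV_ball (z + (1 * p) *: delta_mx ord0 ord_max : V) p0).
rewrite le_measure ?inE//; [exact: measurable_rV_ball|].
move=> x xp; split; last by apply: (shifted_ball_sub (s := 1)) xp; rewrite ?normr1.
have /(rV_ballP _ _ p0)/(_ ord_max) := xp.
by rewrite /Omega /= !mxE b2 !eqxx mulr1 mul1r add0r ltr_norml => /andP[]; lra.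
Qed.

End slices.

(** * Trace values from one-sided densities *)

Section trace_values.
Context {R : realType} {n : nat}.
Local Notation mu := (@lebesgue_rV R n.+1).
Local Notation nu := (@lebesgue_rV R n).
Local Notation V := 'rV[R]_n.+1.

Lemma near_right0P (P : R -> Prop) :
  (exists2 d, 0 < d & forall r, 0 < r < d -> P r) <-> (\forall r \near 0^'+, P r).
Proof.
split=> [[d d0 H]|[d /= d0 H]].
  exists d => //= r /=; rewrite sub0r normrN => rd r0; apply: H.
  by rewrite r0 -(gtr0_norm r0).
exists d => // r /andP[r0 rd]; apply: H => //=.
by rewrite sub0r normrN gtr0_norm.
Qed.

Lemma ge0_cvg_right0P (f : R -> \bar R) : (forall r, (0 <= f r)%E) ->
  f r @[r --> 0^'+] --> 0%E <->
  forall e : R, 0 < e -> exists2 d, 0 < d & forall r, 0 < r < d -> (f r <= e%:E)%E.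
Proof.
move=> f0; split=> [/fine_cvgP[fin cf] e e0|H].
  apply/near_right0P; move/cvgrPdist_le : cf => /(_ _ e0).
  apply: filterS2 fin => r fr; rewrite /= sub0r normrN => /(le_trans (ler_norm _)).
  by rewrite -lee_fin fineK.
apply/fine_cvgP; split.
  have /near_right0P := H 1 ltr01; apply: filterS => r fr.
  by rewrite ge0_fin_numE// (le_lt_trans fr)// ltry.
apply/cvgrPdist_le => e e0; have /near_right0P := H e e0.
apply: filterS => r fr; rewrite /= sub0r normrN ger0_norm ?fine_ge0//.
by rewrite -lee_fin fineK// ge0_fin_numE// (le_lt_trans fr)// ltry.
Qed.

(** [trace] is chosen by [xget], so uniqueness has to be shown: two candidates differ, on average
    over the half ball, by at most the two mean deviations of [u], and half balls have measure at
    least a constant times [r ^+ n.+1]. *)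
Lemma trace_eq (u : V -> R) y (a : R) : measurable_fun setT u ->
  (forall e : R, 0 < e -> exists2 d, 0 < d & forall r, 0 < r < d ->
    (\int[mu]_(x in half_ball y r) `|u x - a|%:E <= (e * r ^+ n.+1)%:E)%E) ->
  trace u y = a.
Proof.
move=> mu0 Ha.
(* The absolute value of [r] makes this nonnegative for every real [r], and changes nothing to the
   right of 0. *)
pose I (b : R) (r : R) := ((`|r| ^- n.+1)%:E * \int[mu]_(x in half_ball y r) `|u x - b|%:E)%E.
have I0 b r : (0 <= I b r)%E.
  by rewrite mule_ge0 ?lee_fin ?invr_ge0 ?exprn_ge0//; apply: integral_ge0.
have IP b : ((r ^- n.+1)%:E * \int[mu]_(x in Omega (n := n) `&` eball (bd y) r) `|u x - b|%:E)%E
    @[r --> 0^'+] --> 0%E <->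
  forall e : R, 0 < e -> exists2 d, 0 < d & forall r, 0 < r < d ->
    (\int[mu]_(x in half_ball y r) `|u x - b|%:E <= (e * r ^+ n.+1)%:E)%E.
  have E : \forall r \near 0^'+, ((r ^- n.+1)%:E *
      \int[mu]_(x in Omega (n := n) `&` eball (bd y) r) `|u x - b|%:E)%E = I b r.
    apply/near_right0P; exists 1 => // r /andP[r0 _].
    by rewrite /I (gtr0_norm r0).
  have S r (e : R) : 0 < r -> (I b r <= e%:E)%E =
      (\int[mu]_(x in half_ball y r) `|u x - b|%:E <= (e * r ^+ n.+1)%:E)%E.
    move=> r0; rewrite /I (gtr0_norm r0) muleC -lee_pdivlMr ?invr_gt0 ?exprn_gt0//.
    by rewrite invrK -EFinM.
  split=> [H|H].
    have {}H : I b r @[r --> 0^'+] --> 0%E by apply: cvg_trans H; exact: near_eq_cvg.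
    move=> e e0; have [d d0 Hd] := (ge0_cvg_right0P (I0 b)).1 H e e0.
    by exists d => // r rd; rewrite -S ?Hd//; case/andP : rd.
  have {}H : I b r @[r --> 0^'+] --> 0%E.
    apply/(ge0_cvg_right0P (I0 b)) => e e0; have [d d0 Hd] := H e e0.
    by exists d => // r rd; rewrite S ?Hd//; case/andP : rd.
  by apply: cvg_trans H; apply: near_eq_cvg; apply: filterS E => r ->.
apply: xget_unique; first exact/IP.
move=> b /IP Hb; apply/eqP; rewrite -subr_eq0 -normr_eq0 eq_le normr_ge0 andbT.
pose c := (2 / n.+3%:R : R) ^+ n.+1.
have c0 : 0 < c by rewrite exprn_gt0// divr_gt0.
apply/ler_addgt0Pl => e e0; rewrite addr0.
have e1 : 0 < e * c / 2 by rewrite divr_gt0// mulr_gt0.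
have [d1 d10 H1] := Ha _ e1; have [d2 d20 H2] := Hb _ e1.
pose r := Num.min d1 d2 / 2.
have m0 : 0 < Num.min d1 d2 by rewrite lt_min d10.
have r0 : 0 < r by rewrite divr_gt0.
have rm : r < Num.min d1 d2 by rewrite /r; lra.
have {}H1 := H1 r ltac:(by rewrite r0 (lt_le_trans rm)// ge_min lexx).
have {}H2 := H2 r ltac:(by rewrite r0 (lt_le_trans rm)// ge_min lexx orbT).
have mh := measurable_half_ball y r.
have mn (v : R) : measurable_fun (half_ball y r) (fun x => `|u x - v|%:E).
  apply/measurable_EFinP; apply: measurableT_comp => //; apply: measurable_funTS.
  exact: measurable_funB.
have : (`|b - a|%:E * mu (half_ball y r) <= (e * c / 2 * r ^+ n.+1)%:E + (e * c / 2 * r ^+ n.+1)%:E)%E.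
  rewrite -integral_cst//.
  apply: (@le_trans _ _ (\int[mu]_(x in half_ball y r) (`|u x - a|%:E + `|u x - b|%:E))%E).
    have md := emeasurable_funD (mn a) (mn b).
    apply: ge0_le_integral => // x _; first by rewrite /cst lee_fin.
    rewrite /cst -EFinD lee_fin.
    by have := ler_distD (u x) b a; rewrite [X in _ <= X]addrC (distrC b (u x)).
  by rewrite ge0_integralD//; exact: leeD.
move=> Hab.
have : (`|b - a|%:E * ((2 * (r / n.+3%:R)) ^+ n.+1)%:E <= (e * c * r ^+ n.+1)%:E)%E.
  apply: le_trans (lee_wpmul2l _ (half_ball_ge y r0)) _ => //.
  by rewrite (le_trans Hab)// -EFinD lee_fin le_eqVlt; apply/orP; left; apply/eqP; field.
rewrite -EFinM lee_fin (_ : (2 * (r / n.+3%:R)) ^+ n.+1 = c * r ^+ n.+1); last first.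
  have E3 : 2 * (r / n.+3%:R) = 2 / n.+3%:R * r by rewrite mulrA mulrAC.
  by rewrite E3 exprMn.
by rewrite mulrA ler_pM2r ?exprn_gt0// ler_pM2r.
Qed.

Lemma trace_indic0 (E : set V) y : measurable E -> half_zero_density E y ->
  trace \1_E y = 0.
Proof.
move=> mE Ey; apply: trace_eq; first exact: measurable_indic.
move=> e e0; have [d d0 Hd] := Ey e e0; exists d => // r rd.
have mh := measurable_half_ball y r.
apply: le_trans (Hd r rd); rewrite -integral_indic//.
by rewrite le_eqVlt; apply/orP; left; apply/eqP; apply: eq_integral => x _; rewrite subr0 ger0_norm.
Qed.

Lemma trace_indic1 (E : set V) y : measurable E -> half_zero_density (~` E) y ->
  trace \1_E y = 1.
Proof.
move=> mE Ey; apply: trace_eq; first exact: measurable_indic.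
move=> e e0; have [d d0 Hd] := Ey e e0; exists d => // r rd.
have mh := measurable_half_ball y r.
apply: le_trans (Hd r rd); rewrite -integral_indic//; last exact: measurableC.
rewrite le_eqVlt; apply/orP; left; apply/eqP; apply: eq_integral => x _; congr EFin.
by rewrite !indicE in_setC; case: (x \in E) => /=; rewrite ?subrr ?normr0// sub0r normrN normr1.
Qed.

End trace_values.

Section liminf_aux.
Context {R : realType}.
Local Open Scope ereal_scope.

Lemma limn_einf_le (u : nat -> \bar R) c : (forall k, u k <= c) -> limn_einf u <= c.
Proof.
move=> H; rewrite limn_einf_lim; apply: lime_le; first exact: is_cvg_einfs.
by apply: nearW => k; apply: ge_ereal_inf; exists (u k) => //; exists k => /=.
Qed.

Lemma limn_einf_ge (u : nat -> \bar R) c K : (forall k, (K <= k)%N -> c <= u k) ->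
  c <= limn_einf u.
Proof.
move=> H; rewrite limn_einf_lim; apply: lime_ge; first exact: is_cvg_einfs.
exists K => // k /= Kk; apply: le_ereal_inf_tmp => _ [j /= kj <-].
by apply: H; exact: leq_trans kj.
Qed.

(** Each new interval is chosen below the left end of the previous ones, so that [N] of them are
    disjoint and contribute 1/2 each. Every interval counts only from some [k] on, but finitely many
    admit a common threshold. *)
Lemma oscillation_einf (G : nat -> R -> \bar R) :
  (forall k, measurable_fun setT (G k)) -> (forall k s, 0 <= G k s) ->
  (forall d : R, (0 < d)%R -> exists a b : R, (0 < a < b)%R /\ (b < d)%R /\
    exists K, forall k, (K <= k)%N ->
    (1 / 2)%:E <= \int[lebesgue_measure]_(s in `[a, b]) G k s) ->
  forall N, (N%:R / 2)%:E <= limn_einf (fun k => \int[lebesgue_measure]_s G k s).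
Proof.
move=> mG G0 osc.
have chain N : forall d : R, (0 < d)%R -> exists c, (0 < c < d)%R /\
    exists K, forall k, (K <= k)%N ->
    (N%:R / 2)%:E <= \int[lebesgue_measure]_(s in `[c, d[) G k s.
  elim: N => [|N IH] d d0.
    exists (d / 2)%R; split; first by apply/andP; split; lra.
    by exists 0%N => k _; rewrite mul0r; apply: integral_ge0.
  have [c [/andP[c0 cd] [K1 H1]]] := IH d d0.
  have [a [b [/andP[a0 ab] [bc [K2 H2]]]]] := osc c c0.
  exists a; split; first by apply/andP; split; lra.
  exists (maxn K1 K2) => k; rewrite geq_max => /andP[k1 k2].
  have dis : [disjoint `[a, b]%classic & `[c, d[%classic].
    rewrite disj_set2E; apply/eqP/seteqP; split => // s [] /=.
    by rewrite !in_itv/= => /andP[_ sb] /andP[cs _]; lra.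
  apply: (@le_trans _ _ (\int[lebesgue_measure]_(s in `[a, b] `|` `[c, d[) G k s)).
    rewrite ge0_integral_setU//; last first.
      by apply: measurable_funTS; exact: mG.
    rewrite -natr1 mulrDl EFinD addeC; apply: leeD; [exact: H2|exact: H1].
  apply: ge0_subset_integral => //; first by apply: measurableU.
    by apply: measurable_funTS; exact: mG.
  move=> s [] /=; rewrite !in_itv/= => /andP[s1 s2]; apply/andP; split; lra.
move=> N; have [c [_ [K HK]]] := chain N 1%R ltr01.
apply: (@limn_einf_ge _ _ K) => k Kk; apply: (le_trans (HK k Kk)).
by apply: ge0_subset_integral => //; exact: mG.
Qed.

End liminf_aux.

Lemma ae_mem d (T : measurableType d) (R : realType)
    (mu : {measure set T -> \bar R}) (A : set T) (P : T -> Prop) :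
  measurable A -> mu A != 0%E -> {ae mu, forall x, P x} -> exists2 x, A x & P x.
Proof.
move=> mA A0 [N [mN N0 PN]]; apply: contrapT => H; move/negP : A0; apply.
rewrite -measure_le0 -N0 le_measure ?inE// => x Ax; apply: PN => /= Px.
by apply: H; exists x.
Qed.

Lemma ae_le_measure d (T : measurableType d) (R : realType)
    (mu : {measure set T -> \bar R}) (A B : set T) :
  measurable A -> measurable B -> {ae mu, forall x, A x -> B x} -> (mu A <= mu B)%E.
Proof.
move=> mA mB [N [mN N0 HN]]; apply: (@le_trans _ _ (mu (B `|` N))).
  rewrite le_measure ?inE//; first exact: measurableU.
  move=> x Ax; have [Nx|Nx] := pselect (N x); [by right|left].
  by apply: contrapT => nB; apply: Nx; apply: HN => /= /(_ Ax).
by apply: (le_trans (measureU2 _ mB mN)); rewrite [X in (_ + X)%E]N0 adde0.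
Qed.

(** * Variation along vertical lines *)

Section vertical_variation.
Context {R : realType} {n : nat}.
Local Notation mu := (@lebesgue_rV R n.+1).
Local Notation nu := (@lebesgue_rV R n).
Local Notation leb := (@lebesgue_measure R).
Local Notation V := 'rV[R]_n.+1.
Local Notation Om := (@Omega R n).
Local Notation h k := (k.+1%:R^-1 : R).

(** Height [2 * h k]: one [h k] is used up by the mollification, the other remains as the margin of
    the test field. The boxes exhaust [Om]. *)
Definition box (k : nat) : set V :=
  [set x : V | `|x| <= k.+1%:R /\ 2 * h k <= x ord0 ord_max].

Lemma measurable_box k : measurable (box k).
Proof.
rewrite (_ : box k = (fun x : V => `|x|) @^-1` `]-oo, k.+1%:R] `&`
    (fun x : V => x ord0 ord_max) @^-1` `[2 * h k, +oo[).
  apply: measurableI; rewrite -[X in measurable X]setTI.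
    by apply: continuous_measurable_rV => //; exact: norm_continuous.
  exact: measurable_coor.
by apply/seteqP; split => x; rewrite /box /= !in_itv/= andbT.
Qed.

Definition vertical_density (E : set V) k (x : V) : R :=
  \1_(box k) x * `|dmoll (h k) ord_max \1_E x|.

(** Stands for the variation of [\1_E] on the open half-line over [y]. The lower limit is the form
    to which Fatou's lemma applies, giving an integral in [y] bounded by the perimeter. *)
Definition vertical_variation (E : set V) (y : 'rV[R]_n) : \bar R :=
  limn_einf (fun k => \int[leb]_s (vertical_density E k (rV_snoc (y, s)))%:E)%E.

Variable E : set V.
Hypotheses (mE : measurable E) (EO : E `<=` Om) (Eoo : (mu E < +oo)%E).

Let h0 k : 0 < h k. Proof. by rewrite invr_gt0. Qed.

Let Ei := integrable_indic_lty mE Eoo.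

Let mD k : measurable_fun setT (dmoll (h k) ord_max (\1_E : V -> R)).
Proof. by apply: continuous_measurable_rV; exact: continuous_dmoll. Qed.

Lemma measurable_vertical_density k : measurable_fun setT (vertical_density E k).
Proof.
apply: measurable_funM; first exact: measurable_indic (measurable_box k).
exact: measurableT_comp (mD k).
Qed.

Lemma measurable_vertical_density_line k y :
  measurable_fun setT (fun s => (vertical_density E k (rV_snoc (y, s)))%:E).
Proof.
apply/measurable_EFinP; apply: (measurableT_comp (measurable_vertical_density k)).
apply: (measurableT_comp (@measurable_rV_snoc _ _)); exact: measurable_pair1.
Qed.

Lemma vertical_density_ge0 k x : 0 <= vertical_density E k x.
Proof. by rewrite mulr_ge0. Qed.

Lemma measurable_vertical_integral k :
  measurable_fun setT (fun y => \int[leb]_s (vertical_density E k (rV_snoc (y, s)))%:E)%E.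
Proof.
have mf : measurable_fun setT (fun p : 'rV[R]_n * R => (vertical_density E k (rV_snoc p))%:E).
  apply/measurable_EFinP.
  exact: measurableT_comp (measurable_vertical_density k) (@measurable_rV_snoc _ _).
apply: (measurable_fun_fubini_tonelli_F (m2 := leb) _ mf) => p.
by rewrite lee_fin vertical_density_ge0.
Qed.

(** The supremum is tested with a vertical field on the box that carries the sign of the derivative;
    it is discontinuous, but measurable fields are allowed against a mollified indicator. *)
Lemma vertical_density_le k :
  (\int[mu]_x (vertical_density E k x)%:E <= Defs.total_variation Om (\1_E : V -> R))%E.
Proof.
pose D := dmoll (h k) ord_max (\1_E : V -> R).
pose A : set V := D @^-1` `]-oo, 0[.
have mA : measurable A by rewrite /A -[X in measurable X]setTI; exact: mD.
(* The sign opposite to that of [D], to match the minus sign in [moll_variation_le]. *)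
pose s x : R := \1_A x - \1_(~` A) x.
have sE x : s x = (-1) ^+ (~~ (D x < 0)).
  rewrite /s !indicE in_setC (_ : (x \in A) = (D x < 0)); last first.
    by apply/idP/idP; rewrite inE /A /= in_itv.
  by case: (D x < 0); rewrite ?subr0// sub0r expr1.
have sD x : s x * D x = - `|D x|.
  rewrite sE; case: ltP => Dx; first by rewrite mul1r ltr0_norm// opprK.
  by rewrite expr1 mulN1r ger0_norm.
pose eta (i : 'I_n.+1) x : R := (i == ord_max)%:R * (\1_(box k) x * s x).
have ms : measurable_fun setT s.
  apply: measurable_funB; apply: measurable_indic => //; exact: measurableC.
have meta i : measurable_fun setT (eta i).
  apply: measurable_funM => //; apply: measurable_funM => //.
  exact: measurable_indic (measurable_box k).
have etaD x : \sum_i eta i x * dmoll (h k) i \1_E x = - vertical_density E k x.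
  rewrite (bigD1 ord_max)//= big1 ?addr0; last first.
    by move=> i /negbTE ni; rewrite /eta ni !mul0r.
  by rewrite /eta eqxx mul1r -mulrA -/(D x) sD mulrN.
have eta1 x : \sum_i eta i x ^+ 2 <= 1.
  rewrite (bigD1 ord_max)//= big1 ?addr0; last first.
    by move=> i /negbTE ni; rewrite /eta ni !mul0r expr0n.
  rewrite /eta eqxx mul1r exprMn sE sqrr_sign mulr1 indicE.
  by case: (_ \in _); rewrite ?expr1n ?expr0n/= ?ler01.
have seta i x : eta i x != 0 -> `|x| <= k.+1%:R /\ h k + h k <= x ord0 ord_max.
  rewrite /eta indicE; case: (i == ord_max); last by rewrite mul0r eqxx.
  have [|] := boolP (x \in box k); last by rewrite mul0r mulr0 eqxx.
  by rewrite inE => -[x1 x2] _; split => //; move: x2; rewrite mulr_natl mulr2n.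
have := moll_variation_le mE EO Eoo (h0 k) (h0 k) meta eta1 seta.
under eq_Rintegral do rewrite etaD.
apply: le_trans; rewrite le_eqVlt; apply/orP; left; apply/eqP.
have si : mu.-integrable setT (EFin \o (fun x => eta ord_max x * D x)).
  apply: integrable_mul_dmoll => //.
  apply: (@bounded_support_integrable _ _ (eta ord_max) (k.+1%:R + 1) 1) => // x.
    rewrite -sqrtr_sqr -[X in _ <= X]sqrtr1 ler_sqrt// (le_trans _ (eta1 x))//.
    by rewrite (bigD1 ord_max)//= lerDl; apply: sumr_ge0 => j _; exact: sqr_ge0.
  move=> kx; apply/eqP; apply: contraTT kx => /seta[xk _].
  by rewrite -ltNge (le_lt_trans xk)// ltrDl.
have gE x : vertical_density E k x = - (eta ord_max x * D x).
  by rewrite /eta eqxx mul1r -mulrA sD mulrN opprK.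
have gi : mu.-integrable setT (EFin \o vertical_density E k).
  apply: (eq_integrable _ (EFin \o (fun x => -1 * (eta ord_max x * D x)))) => //.
    by move=> x _; rewrite /= gE mulN1r.
  exact: integrable_scale.
by rewrite RintegralN// opprK EFin_Rintegral.
Qed.

Lemma measurable_vertical_variation : measurable_fun setT (vertical_variation E).
Proof.
rewrite (_ : vertical_variation E = (fun y => - limn_esup (fun k =>
   (- \int[leb]_s (vertical_density E k (rV_snoc (y, s)))%:E)))%E).
  apply: measurableT_comp => //.
  apply: (@measurable_fun_limn_esup _ _ _ _ (fun k y =>
    (- \int[leb]_s (vertical_density E k (rV_snoc (y, s)))%:E)%E)) => k.
  by apply: measurableT_comp => //; exact: measurable_vertical_integral.
by apply/funext => y.
Qed.

Lemma vertical_variation_ge0 y : (0 <= vertical_variation E y)%E.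
Proof.
apply: (@limn_einf_ge _ _ _ 0) => k _; apply: integral_ge0 => s _.
by rewrite lee_fin vertical_density_ge0.
Qed.

Lemma integral_vertical_variation :
  (\int[nu]_y vertical_variation E y <= Defs.total_variation Om (\1_E : V -> R))%E.
Proof.
apply: le_trans.
  apply: (@fatou _ _ _ nu _ measurableT (fun k y =>
    \int[leb]_s (vertical_density E k (rV_snoc (y, s)))%:E)%E).
    exact: measurable_vertical_integral.
  by move=> k y _; apply: integral_ge0 => s _; rewrite lee_fin vertical_density_ge0.
apply: limn_einf_le => k.
rewrite -(ge0_integral_rVS (f := fun x => (vertical_density E k x)%:E)).
- exact: vertical_density_le.
- by apply/measurable_EFinP; exact: measurable_vertical_density.
- by move=> x; rewrite lee_fin vertical_density_ge0.
Qed.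

Lemma snocE (y : 'rV[R]_n) s : rV_snoc (y, s) = s *: unit_rV ord_max + rV_snoc (y, 0) :> V.
Proof.
apply/rowP => i; rewrite !mxE eqxx /=; case: unliftP => [j ->|->] /=.
  by rewrite eq_sym (negbTE (neq_lift _ _)) mulr0 add0r.
by rewrite eqxx mulr1 addr0.
Qed.

Definition regular_at (y : 'rV[R]_n) (s : R) :=
  moll k.+1%:R^-1 \1_E (rV_snoc (y, s)) @[k --> \oo] --> (\1_E (rV_snoc (y, s)) : R).

Lemma ae_regular_at : {ae nu, forall y, {ae leb, forall s, regular_at y s}}.
Proof. exact: (ae_slice (moll_indic_cvg mE)). Qed.

(** At regular points the mollifications tend to the indicator, which takes both values 0 and 1 at
    the two ends; eventually their difference exceeds 1/2, and the fundamental theorem of calculus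
    bounds it by the integral of the derivative. *)
Lemma vertical_density_jump y (a b : R) : 0 < a -> a < b ->
  regular_at y a -> regular_at y b -> slice E y a <> slice E y b ->
  exists K, forall k, (K <= k)%N -> ((1 / 2)%:E <=
    \int[leb]_(s in `[a, b]) (vertical_density E k (rV_snoc (y, s)))%:E)%E.
Proof.
move=> a0 ab ra rb Eab; pose u : R := \1_E (rV_snoc (y, a)); pose v : R := \1_E (rV_snoc (y, b)).
have uv : `|v - u| = 1 :> R.
  have : (rV_snoc (y, a) \in E) != (rV_snoc (y, b) \in E).
    apply/eqP => H; apply: Eab; apply/propext; rewrite /slice /=; split => /mem_set.
      by rewrite H => /set_mem.
    by rewrite -H => /set_mem.
  rewrite /u /v !indicE; case: (_ \in E); case: (_ \in E) => // _.
    by rewrite sub0r normrN normr1.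
  by rewrite subr0 normr1.
pose F k s := moll (h k) (\1_E : V -> R) (rV_snoc (y, s)).
pose G k s := dmoll (h k) ord_max (\1_E : V -> R) (rV_snoc (y, s)).
have cF : F k b - F k a @[k --> \oo] --> v - u by apply: cvgB.
have /cvgrPdist_lt/(_ (1 / 2)) := cF.
rewrite divr_gt0// => /(_ isT) [K1 _ HK1].
have dF k s : is_derive s (1 : R) (F k) (G k s).
  have := pC1_line ord_max (rV_snoc (y, 0)) s (moll_pC1 (h0 k) Ei).
  by rewrite /G snocE; congr is_derive; apply/funext => t; rewrite /F snocE.
have cG k : continuous (G k).
  have -> : G k = dmoll (h k) ord_max (\1_E : V -> R) \o
      (fun s => s *: unit_rV ord_max + rV_snoc (y, 0)).
    by apply/funext => s; rewrite /= -snocE.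
  move=> s; apply: continuous_comp; last by apply: continuous_dmoll.
  by apply: cvgD; [apply: cvgZr_tmp; exact: cvg_id|exact: cvg_cst].
have FTC k : (\int[leb]_(s in `[a, b]) (G k s)%:E = (F k b)%:E - (F k a)%:E)%E.
  apply: continuous_FTC2 => //.
  - by apply: continuous_subspaceT; exact: cG.
  - have cFk : continuous (F k).
      by move=> s; apply: differentiable_continuous; apply/derivable1_diffP; have [] := dF k s.
    split; [by move=> s _; have [] := dF k s|exact: cvg_at_right_filter (cFk a)|].
    exact: cvg_at_left_filter (cFk b).
  - by move=> s _; rewrite derive1E; exact: derive_val.
(* From here on the whole segment over [[a, b]] lies in [box k], so the truncation is invisible. *)
have [K2 HK2] : exists K, forall k, (K <= k)%N -> 2 * h k <= a /\
    `|rV_snoc (y, 0) : V| + b <= k.+1%:R.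
  pose M := Num.max (2 / a) (`|rV_snoc (y, 0) : V| + b).
  exists (Num.truncn M) => k Kk; have Mk : M <= k.+1%:R.
    by apply: (le_trans (ltW (truncnS_gt M))); rewrite ler_nat.
  move: Mk; rewrite ge_max => /andP[k1 ->]; split => //.
  by rewrite ler_pdivrMr//; move: k1; rewrite ler_pdivrMr// mulrC.
exists (maxn K1 K2) => k; rewrite geq_max => /andP[k1 k2].
have [ka kb] := HK2 k k2.
have : (`|\int[leb]_(s in `[a, b]) (G k s)%:E| <= \int[leb]_(s in `[a, b]) `|(G k s)%:E|)%E.
  apply: le_abse_integral => //; apply/measurable_EFinP; apply: measurable_funTS.
  exact: continuous_measurable_fun.
have -> : (\int[leb]_(s in `[a, b]) `|(G k s)%:E| =
    \int[leb]_(s in `[a, b]) (vertical_density E k (rV_snoc (y, s)))%:E)%E.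
  apply: eq_integral => s; rewrite inE /= in_itv/= => /andP[as_ sb].
  rewrite /vertical_density indicE mem_set ?mul1r//; split.
    rewrite snocE (le_trans (ler_normD _ _))// addrC (le_trans _ kb)// lerD2l.
    apply: rV_norm_le; first by lra.
    move=> i; rewrite !mxE eqxx/= normrM ger0_norm ?(le_trans (ltW a0))//.
    by case: (_ == _); rewrite ?normr1 ?normr0 ?mulr1 ?mulr0//; lra.
  by rewrite mxE unlift_none/= (le_trans ka).
apply: le_trans; rewrite FTC -EFinB abse_EFin lee_fin.
have := HK1 k k1; rewrite /= => Hk.
have := ler_normD (v - u - (F k b - F k a)) (F k b - F k a).
by rewrite subrK uv; lra.
Qed.

End vertical_variation.

Lemma measure_setU_null d (T : measurableType d) (R : realType)
    (mu : {measure set T -> \bar R}) (A B : set T) :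
  measurable A -> measurable B -> mu A = 0%E -> mu B = 0%E -> mu (A `|` B) = 0%E.
Proof.
move=> mA mB A0 B0; apply/eqP; rewrite -measure_le0.
by apply: (le_trans (measureU2 _ mA mB)); rewrite [X in (X + _)%E]A0 add0e [leLHS]B0.
Qed.

(** * The trace as the indicator of a measurable set *)

Section trace_set.
Context {R : realType} {n : nat}.
Local Notation mu := (@lebesgue_rV R n.+1).
Local Notation nu := (@lebesgue_rV R n).
Local Notation leb := (@lebesgue_measure R).
Local Notation V := 'rV[R]_n.+1.
Local Notation Om := (@Omega R n).
Local Notation h k := (k.+1%:R^-1 : R).
Local Notation TV E := (Defs.total_variation Om (\1_E : V -> R)).
Implicit Types E F : set V.

Let h0 k : 0 < h k. Proof. by rewrite invr_gt0. Qed.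

Let h_lt (d : R) : 0 < d -> exists k, h k < d.
Proof.
move=> d0; exists (Num.truncn d^-1); rewrite invf_plt ?posrE//.
exact: truncnS_gt.
Qed.

(* A measurable set whose indicator is a.e. the trace of [\1_E]. *)
Definition trace_set E : set 'rV[R]_n := \bigcup_k low_null (~` E) (h k).

Lemma measurable_trace_set E : measurable E -> measurable (trace_set E).
Proof.
move=> mE; apply: bigcup_measurable => k _; apply: measurable_low_null.
exact: measurableC.
Qed.

Lemma low_nullU E F d y : measurable E -> measurable F ->
  low_null (E `|` F) d y <-> low_null E d y /\ low_null F d y.
Proof.
move=> mE mF; have mEd := measurableI _ _ (measurable_slice y mE) (measurable_itv `]0, d[).
have mFd := measurableI _ _ (measurable_slice y mF) (measurable_itv `]0, d[).
have -> : low_null (E `|` F) d y =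
    (leb ((slice E y `&` `]0, d[) `|` (slice F y `&` `]0, d[)) = 0%E).
  by rewrite -setIUl.
split=> [H|[HE HF]].
  split; apply/eqP; rewrite -measure_le0 -H le_measure ?inE//.
  - exact: measurableU.
  - exact: measurableU.
exact: measure_setU_null.
Qed.

Lemma low_null_setC E d y : measurable E -> 0 < d -> low_null E d y ->
  low_null (~` E) d y -> False.
Proof.
move=> mE d0 Ey nEy; have : low_null (E `|` ~` E) d y.
  by apply/low_nullU => //; exact: measurableC.
rewrite /low_null /= setUv (_ : slice setT y = setT); last by apply/seteqP; split.
by rewrite setTI lebesgue_measure_itv/= lte_fin d0 sube0 => -[d00]; move: d0; rewrite d00 ltxx.
Qed.

(** Two lines of proof meet at the smaller of the two heights, so the equality holds at every point.
    For unions, in [trace_setU], only almost every point is reached. *)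
Lemma trace_setI E F : measurable E -> measurable F ->
  trace_set (E `&` F) = trace_set E `&` trace_set F.
Proof.
move=> mE mF; have mCE := measurableC mE; have mCF := measurableC mF.
apply/seteqP; split => y.
  move=> [k _]; rewrite setCI => /(low_nullU _ _ mCE mCF)[Ek Fk].
  by split; exists k.
move=> [[j _ Ej] [k _ Fk]]; exists (maxn j k) => //.
rewrite setCI; apply/low_nullU => //.
have hle i m : (i <= m)%N -> h m <= h i by move=> im; rewrite lef_pV2 ?posrE// ler_nat.
by split; [apply: low_null_le Ej|apply: low_null_le Fk] => //;
  apply: hle; rewrite ?leq_maxl ?leq_maxr.
Qed.

Lemma trace_set_mono E F : measurable E -> measurable F ->
  {ae mu, forall x, E x -> F x} ->
  {ae nu, forall y, trace_set E y -> trace_set F y}.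
Proof.
move=> mE mF /ae_slice; apply: filterS => y EF [k _ Ek]; exists k => //.
have mCE := measurable_slice y (measurableC mE); have mCF := measurable_slice y (measurableC mF).
apply/eqP; rewrite -measure_le0 -Ek; apply: ae_le_measure; [exact: measurableI..|].
have [N [mN N0 HN]] := EF; exists N; split => // s /= nH.
by apply: HN => /= EFs; apply: nH => -[nF s0]; split => // /EFs.
Qed.

Section finite_perimeter.
Variable E : set V.
Hypotheses (mE : measurable E) (EO : E `<=` Om) (Eoo : (mu E < +oo)%E).
Hypothesis Etv : (TV E < +oo)%E.

Lemma vertical_variation_fin : {ae nu, forall y, vertical_variation E y \is a fin_num}.
Proof.
have mW := measurable_vertical_variation mE Eoo.
have Wi : nu.-integrable setT (vertical_variation E).
  apply/integrableP; split => //.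
  rewrite (eq_integral (vertical_variation E)); last first.
    by move=> y _; rewrite gee0_abs// vertical_variation_ge0.
  exact: le_lt_trans (integral_vertical_variation mE EO Eoo) Etv.
by apply: filterS (integrable_ae measurableT Wi) => y; apply.
Qed.

(* Otherwise [E] and its complement both meet every [ ]0, d[ ] on the line over
   [y], and the vertical variation collects infinitely many unit jumps. *)
Lemma low_null_dichotomy : {ae nu, forall y,
  (exists k, low_null E (h k) y) \/ (exists k, low_null (~` E) (h k) y)}.
Proof.
have mG := measurable_vertical_density_line mE Eoo.
apply: filterS2 vertical_variation_fin (ae_regular_at mE) => y Wfin ry.
apply: contrapT => /not_orP[/forallNP nE /forallNP nC].
have osc N : ((N%:R / 2)%:E <= vertical_variation E y)%E.
  apply: (@oscillation_einf _ (fun k s => (vertical_density E k (rV_snoc (y, s)))%:E)).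
  - by move=> k; exact: mG.
  - by move=> k s; rewrite lee_fin vertical_density_ge0.
  move=> d /h_lt[k kd].
  have mI A : measurable A -> measurable (slice A y `&` `]0, h k[).
    by move=> mA; apply: measurableI => //; exact: measurable_slice.
  have [s [Es]] : exists2 s, (slice E y `&` `]0, h k[) s & regular_at E y s.
    by apply: ae_mem ry; [exact: mI|apply/eqP; exact: nE].
  rewrite /= in_itv/= => /andP[s0 sk] rs.
  have [t [nEt]] : exists2 s, (slice (~` E) y `&` `]0, h k[) s & regular_at E y s.
    apply: ae_mem ry; last by apply/eqP; exact: nC.
    by apply: mI; exact: measurableC.
  rewrite /= in_itv/= => /andP[t0 tk] rt.
  have st : slice E y s <> slice E y t by move=> H; apply: nEt; change (slice E y t); rewrite -H.
  have [lst|lts|e] := ltgtP s t.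
  - exists s, t; split; first by rewrite s0.
    by split; [exact: lt_trans kd|exact: vertical_density_jump].
  - exists t, s; split; first by rewrite t0.
    split; first exact: lt_trans kd.
    by apply: vertical_density_jump => // H; apply: st; rewrite H.
  - by case: st; rewrite e.
have := osc (Num.truncn (2 * fine (vertical_variation E y))).+1.
rewrite -[leRHS](fineK Wfin) lee_fin ler_pdivrMr// leNgt => /negP; apply.
by rewrite mulrC truncnS_gt.
Qed.

Lemma trace_ae_eq : {ae nu, forall y, trace \1_E y = \1_(trace_set E) y}.
Proof.
have d0 A : measurable A -> {ae nu, forall y, (exists k, low_null A (h k) y) ->
    half_zero_density A y}.
  move=> mA; have /ae_foralln : forall k, {ae nu, forall y, low_null A (h k) y ->
      half_zero_density A y} by move=> k; exact: low_null_density.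
  by apply: filterS => y H [k]; exact: H.
have := low_null_dichotomy; apply: filterS3 (d0 _ mE) (d0 _ (measurableC mE)) => y H0 H1 H.
have [yT|yT] := pselect (trace_set E y).
  rewrite indicE mem_set// trace_indic1//; apply: H1.
  by case: yT => k _ Ek; exists k.
rewrite indicE memNset// trace_indic0//; apply: H0.
by case: H => // -[k Ek]; case: yT; exists k.
Qed.

(** Over a trace point the line starts inside [E]; since almost every slice has finite length, it
    must leave [E] somewhere above, which costs one jump. *)
Lemma trace_set_variation : {ae nu, forall y, trace_set E y ->
  ((1 / 2)%:E <= vertical_variation E y)%E}.
Proof.
have mS := measurable_fun_slice mE.
have Si : nu.-integrable setT (fun y => leb (slice E y)).
  apply/integrableP; split => //.
  by under eq_integral do rewrite gee0_abs//; rewrite -(lebesgue_rVS mE).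
have mG := measurable_vertical_density_line mE Eoo.
have := integrable_ae measurableT Si.
apply: filterS2 (ae_regular_at mE) => y ry /(_ I) Sy [j _ yj].
have mSy := measurable_slice y mE; have mCy := measurable_slice y (measurableC mE).
have [b [nEb]] : exists2 b, (slice (~` E) y `&` `]0, +oo[) b & regular_at E y b.
  apply: ae_mem ry; first exact: measurableI.
  apply/eqP => H; have : leb `]0, +oo[%classic = +oo%E :> \bar R by rewrite lebesgue_measure_itv/= ltry.
  rewrite -(setTI `]0, +oo[%classic) -(setUv (slice E y)) setIUl => Hoo.
  have : (leb ((slice E y `&` `]0%R, +oo[) `|` (~` slice E y `&` `]0%R, +oo[)) <=
      leb (slice E y) + 0)%E.
    rewrite -H; apply: (le_trans (measureU2 _ _ _)).
    - exact: measurableI.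
    - exact: measurableI.
    - apply: leeD => //; rewrite le_measure ?inE//; exact: measurableI.
  rewrite Hoo adde0 leye_eq => /eqP Eoo'; by move: Sy; rewrite Eoo'.
rewrite /= in_itv/= andbT => b0 rb.
pose m := Num.min b (h j); have m0 : 0 < m by rewrite lt_min b0 h0.
have [a [Ea]] : exists2 a, (slice E y `&` `]0, m[) a & regular_at E y a.
  apply: ae_mem ry; first exact: measurableI.
  apply/eqP => H; apply: (low_null_setC mE m0 H).
  by apply: low_null_le yj; [exact: measurableC|rewrite ge_min lexx orbT].
rewrite /= in_itv/= lt_min => /and3P[a0 ab aj] ra.
have [K HK] := vertical_density_jump mE Eoo a0 ab ra rb ltac:(by move=> H; apply: nEb; change (slice E y b); rewrite -H).
apply: (@limn_einf_ge _ _ _ K) => k Kk; apply: le_trans (HK k Kk) _.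
apply: ge0_subset_integral => //; first exact: mG.
by move=> s _; rewrite lee_fin vertical_density_ge0.
Qed.

(** Chebyshev's inequality: each point of the trace set carries vertical variation at least 1/2.
    This makes bounded functions integrable over the trace set. *)
Lemma trace_set_lty : (nu (trace_set E) < +oo)%E.
Proof.
have mT := measurable_trace_set mE.
have : ((1 / 2)%:E * nu (trace_set E) <= TV E)%E.
  apply: le_trans (integral_vertical_variation mE EO Eoo).
  rewrite -integral_cst// integral_mkcond.
  apply: ae_ge0_le_integral => //.
  - by move=> y _; rewrite patchE; case: ifP => _ //; rewrite lee_fin.
  - by apply/measurable_restrict => //; exact: measurable_cst.
  - by move=> y _; exact: vertical_variation_ge0.
  - exact: measurable_vertical_variation.
  apply: filterS trace_set_variation => y H _; rewrite patchE; case: ifPn.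
    by rewrite inE => /H.
  by rewrite vertical_variation_ge0.
move=> /le_lt_trans/(_ Etv) H; rewrite ltey; apply/eqP => T; move: H.
by rewrite T gt0_muley// lte_fin; lra.
Qed.

End finite_perimeter.

(** A line could start in the union while alternating between [E] and [F]; the dichotomy excludes
    this almost everywhere. If it started outside both sets, it would start outside the union. *)
Lemma trace_setU E F : measurable E -> E `<=` Om -> (mu E < +oo)%E -> (TV E < +oo)%E ->
  measurable F -> F `<=` Om -> (mu F < +oo)%E -> (TV F < +oo)%E ->
  {ae nu, forall y, trace_set (E `|` F) y <-> (trace_set E `|` trace_set F) y}.
Proof.
move=> mE EO Eoo Etv mF FO Foo Ftv; have mCE := measurableC mE; have mCF := measurableC mF.
have hle i m : (i <= m)%N -> h m <= h i by move=> im; rewrite lef_pV2 ?posrE// ler_nat.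
have mU := measurableU _ _ mE mF.
have mono1 : {ae nu, forall y, trace_set E y -> trace_set (E `|` F) y}.
  by apply: trace_set_mono => //; apply: aeW => x; left.
have mono2 : {ae nu, forall y, trace_set F y -> trace_set (E `|` F) y}.
  by apply: trace_set_mono => //; apply: aeW => x; right.
have mono12 : {ae nu, forall y, (trace_set E y -> trace_set (E `|` F) y) /\
    (trace_set F y -> trace_set (E `|` F) y)} by apply: filterS2 mono1 mono2.
apply: filterS3 (low_null_dichotomy mE EO Eoo Etv)
  (low_null_dichotomy mF FO Foo Ftv) mono12 => y dE dF [m1 m2]; split; last by case.
move=> [k _ yk].
have [[i Ei]|[i Ei]] := dE; last by left; exists i.
have [[j Fj]|[j Fj]] := dF; last by right; exists j.
pose m := maxn k (maxn i j); exfalso; apply: (@low_null_setC (E `|` F) (h m) y mU (h0 m)).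
  apply/low_nullU => //; split; [apply: low_null_le Ei|apply: low_null_le Fj] => //;
  by apply: hle; rewrite /m !leq_max leqnn !orbT.
apply: low_null_le yk; [exact: measurableC|].
by apply: hle; rewrite /m leq_max leqnn.
Qed.

End trace_set.

(** * The capillary functional *)

Section ae_integral.
Context d (T : measurableType d) (R : realType) (mu : {measure set T -> \bar R}).
Local Open Scope ereal_scope.
Implicit Types f g : T -> \bar R.

(** The integral of a nonnegative function is a supremum over the simple functions below it, hence
    monotone for arbitrary functions. *)
Lemma ge0_integral_mono f g : (forall x, 0 <= f x) -> (forall x, f x <= g x) ->
  \int[mu]_x f x <= \int[mu]_x g x.
Proof.
move=> f0 fg; rewrite !ge0_integralTE//; last by move=> x; exact: le_trans (fg x).
apply: le_ereal_sup => _ [s sf <-]; exists s => // x.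
exact: le_trans (sf x) (fg x).
Qed.

Lemma ge0_ae_eq_integral f g : (forall x, 0 <= f x) -> (forall x, 0 <= g x) ->
  measurable_fun setT g -> {ae mu, forall x, f x = g x} ->
  \int[mu]_x f x = \int[mu]_x g x.
Proof.
move=> f0 g0 mg [N [mN N0 HN]].
have fgN x : ~ N x -> f x = g x by move=> nN; apply: contrapT => /HN.
have ae (g' : T -> \bar R) : measurable_fun setT g' -> (forall x, ~ N x -> g' x = g x) ->
    \int[mu]_x g' x = \int[mu]_x g x.
  move=> mg' E; apply: ae_eq_integral => //; exists N; split => // x /= H.
  by apply: contrapT => nN; apply: H => _; exact: E.
(* Taking [c] to be [0] and [+oo] encloses [f] between two measurable functions with the same
   integral as [g]. *)
pose h (c : \bar R) x := if x \in N then c else g x.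
have mh c : measurable_fun setT (h c).
  apply: measurable_fun_ifT => //; apply: (measurable_fun_bool true).
  rewrite setTI (_ : _ @^-1` _ = N)//.
  by apply/seteqP; split => x /=; [exact: set_mem|exact: mem_set].
have hE c x : ~ N x -> h c x = g x by move=> nN; rewrite /h memNset.
apply/eqP; rewrite eq_le; apply/andP; split.
  rewrite -(ae (h +oo) (mh _) (hE _)).
  apply: ge0_integral_mono => // x; rewrite /h; case: ifPn; first by rewrite leey.
  by rewrite notin_setE => /fgN ->.
rewrite -(ae (h 0) (mh _) (hE _)).
apply: ge0_integral_mono => x; rewrite /h; case: ifPn => //.
by rewrite notin_setE => /fgN ->.
Qed.

(* Unlike [ae_eq_integral], [f] need not be measurable. *)
Lemma ae_eq_integral_measurable f g : measurable_fun setT g ->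
  {ae mu, forall x, f x = g x} -> \int[mu]_x f x = \int[mu]_x g x.
Proof.
move=> mg fg; rewrite [LHS]integralE [RHS]integralE; congr (_ - _).
  apply: ge0_ae_eq_integral => //; first exact: measurable_funepos.
  by apply: filterS fg => x; rewrite !funeposE => ->.
apply: ge0_ae_eq_integral => //; first exact: measurable_funeneg.
by apply: filterS fg => x; rewrite !funenegE => ->.
Qed.

End ae_integral.

(** * The capillary energy: perimeter and trace term *)

Section capillary_energy.
Context {R : realType} {n : nat}.
Local Notation mu := (@lebesgue_rV R n.+1).
Local Notation nu := (@lebesgue_rV R n).
Local Notation V := 'rV[R]_n.+1.
Local Notation Om := (@Omega R n).
Local Notation TV E := (Defs.total_variation Om (\1_E : V -> R)).
Implicit Types (E F : set V) (beta : 'rV[R]_n -> R) (A : set 'rV[R]_n).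

(** [BV_set] without the density-one normalization, which a union may lose. *)
Definition caccioppoli E :=
  [/\ measurable E, E `<=` Om, (mu E < +oo)%E & (TV E < +oo)%E].

Lemma BV_caccioppoli E : BV_set E -> caccioppoli E.
Proof.
move=> [mE EO [/integrableP[_ Ei] tvE] _]; split => //.
apply: le_lt_trans Ei; rewrite (eq_integral (fun x => (\1_E x)%:E)); last first.
  by move=> x _; rewrite /= ger0_norm.
by rewrite integral_indic//; [rewrite (setIidl EO)|exact: measurable_Omega].
Qed.

Lemma caccioppoliI_U E F : caccioppoli E -> caccioppoli F ->
  caccioppoli (E `&` F) /\ caccioppoli (E `|` F).
Proof.
move=> [mE EO Eoo Etv] [mF FO Foo Ftv].
have mI := measurableI _ _ mE mF; have mU := measurableU _ _ mE mF.
have sub := total_variation_submod mE EO Eoo mF FO Foo.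
have sum_lty := lte_add_pinfty Etv Ftv.
split; apply: And4.
- exact: mI.
- by move=> x [/EO].
- by apply: le_lt_trans Eoo; rewrite le_measure ?inE//; exact: subIsetl.
- by apply: le_lt_trans sum_lty; apply: le_trans sub; apply: leeDl; exact: tv_ge0.
- exact: mU.
- by move=> x [/EO|/FO].
- by apply: (le_lt_trans (measureU2 _ mE mF)); exact: lte_add_pinfty.
- by apply: le_lt_trans sum_lty; apply: le_trans sub; apply: leeDr; exact: tv_ge0.
Qed.

Lemma total_variation_ae E F : measurable E -> measurable F ->
  {ae mu, forall x, E x <-> F x} -> TV E = TV F.
Proof.
move=> mE mF EF; congr ereal_sup; apply/seteqP.
have sub (A B : set V) : measurable A -> measurable B -> {ae mu, forall x, A x <-> B x} ->
    [set (\int[mu]_(x in Om) (\1_A x * divergence phi x)%:E)%E | phi in test_field Om] `<=`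
    [set (\int[mu]_(x in Om) (\1_B x * divergence phi x)%:E)%E | phi in test_field Om].
  move=> mA mB AB _ [phi tphi <-]; exists phi => //.
  have mdiv : measurable_fun setT (divergence phi).
    by have /integrableP[/measurable_EFinP] := integrable_divergence tphi.
  have mint (C : set V) : measurable C ->
      measurable_fun Om (fun x => (\1_C x * divergence phi x)%:E).
    move=> mC; apply/measurable_EFinP; apply: measurable_funTS.
    by apply: measurable_funM => //; exact: measurable_indic.
  apply: ae_eq_integral => //; [exact: measurable_Omega|exact: mint|exact: mint|].
  apply: filterS AB => x ABx _; rewrite !indicE; congr (_ * _)%:E; congr (_%:R).
  by congr nat_of_bool; apply/idP/idP; rewrite !inE => /ABx.
split; first exact: sub.
by apply: sub => //; apply: filterS EF => x []; split.
Qed.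

Lemma Linfty_bound beta c : Linfty_le beta c -> {ae nu, forall y, `|beta y| <= c}.
Proof.
move=> [mb]; rewrite unlock ifT; last first.
  apply: (@lt_le_trans _ _ (nu (ball (0 : 'rV[R]_n) 1))).
    by rewrite [ltRHS]lebesgue_rV_ball// lte_fin exprn_gt0// mulr_gt0.
  by rewrite le_measure ?inE//; exact: measurable_rV_ball.
by move=> /ess_supP; apply: filterS => y; rewrite /= lee_fin.
Qed.

Lemma integrable_trace_term beta c A : Linfty_le beta c -> measurable A ->
  (nu A < +oo)%E -> nu.-integrable setT (EFin \o (fun y => beta y * \1_A y)).
Proof.
move=> hb mA Aoo; have [mb _] := hb.
have mf : measurable_fun setT (fun y => beta y * \1_A y).
  by apply: measurable_funM => //; exact: measurable_indic.
apply/integrableP; split; first exact/measurable_EFinP.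
have ci : nu.-integrable setT (EFin \o (fun y => c * \1_A y)).
  by apply: integrable_scale; exact: integrable_indic_lty.
have /integrableP[mc] := ci; apply: le_lt_trans.
apply: ae_ge0_le_integral => //.
- by apply: measurableT_comp => //; exact/measurable_EFinP.
- exact: measurableT_comp.
apply: filterS (Linfty_bound hb) => y hy _; rewrite /= lee_fin !normrM ler_wpM2r//.
exact: le_trans (ler_norm _).
Qed.

Definition trace_term beta A : R := \int[nu]_y (beta y * \1_A y).

Lemma trace_term_ae beta A A' : measurable_fun setT beta -> measurable A ->
  measurable A' -> {ae nu, forall y, A y <-> A' y} -> trace_term beta A = trace_term beta A'.
Proof.
move=> mb mA mA' AA'; congr fine; apply: ae_eq_integral => //.
- apply/measurable_EFinP; apply: measurable_funM => //; exact: measurable_indic.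
- apply/measurable_EFinP; apply: measurable_funM => //; exact: measurable_indic.
apply: filterS AA' => x AAx _; rewrite !indicE; congr (_ * _)%:E; congr (_%:R).
by congr nat_of_bool; apply/idP/idP; rewrite !inE => /AAx.
Qed.

(** Exchanges the chosen trace for the indicator of [trace_set], and shows that the energy is a real
    number. *)
Lemma C_functionalE beta c E : Linfty_le beta c -> caccioppoli E ->
  C_functional beta E = (fine (TV E) - trace_term beta (trace_set E))%:E.
Proof.
move=> hb [mE EO Eoo Etv]; have mT := measurable_trace_set mE.
have Tf : TV E \is a fin_num by rewrite ge0_fin_numE ?tv_ge0.
rewrite /C_functional /perimeter -[X in (X - _)%E](fineK Tf) EFinB; congr (_ - _)%E.
have Ti := integrable_trace_term hb mT (trace_set_lty mE EO Eoo Etv).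
rewrite /trace_term EFin_Rintegral//; apply: ae_eq_integral_measurable.
  by have /integrableP[] := Ti.
by apply: filterS (trace_ae_eq mE EO Eoo Etv) => y /= ->.
Qed.

Lemma C_functional_ae beta c E F : Linfty_le beta c -> caccioppoli E ->
  caccioppoli F -> {ae mu, forall x, E x <-> F x} ->
  C_functional beta E = C_functional beta F.
Proof.
move=> hb cE cF EF; rewrite (C_functionalE hb cE) (C_functionalE hb cF).
have [mE _ _ _] := cE; have [mF _ _ _] := cF; have [mb _] := hb.
rewrite (total_variation_ae mE mF EF); congr (_ - _)%:E.
apply: trace_term_ae => //; [exact: measurable_trace_set|exact: measurable_trace_set|].
have h1 : {ae mu, forall x, E x -> F x} by apply: filterS EF => x [].
have h2 : {ae mu, forall x, F x -> E x} by apply: filterS EF => x [].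
by apply: filterS2 (trace_set_mono mE mF h1) (trace_set_mono mF mE h2) => y; split.
Qed.

(** With [D] the part of [A] outside [B], the right side exceeds the left one by the integral of
    [beta2 - beta1] over [D]. *)
Lemma trace_term_supermod beta1 beta2 c A B :
  Linfty_le beta1 c -> Linfty_le beta2 c ->
  {ae nu, forall y, beta1 y <= beta2 y} ->
  measurable A -> (nu A < +oo)%E -> measurable B -> (nu B < +oo)%E ->
  trace_term beta1 A + trace_term beta2 B <=
  trace_term beta1 (A `&` B) + trace_term beta2 (A `|` B).
Proof.
move=> h1 h2 b12 mA Aoo mB Boo; pose D := A `\` B.
have [mb1 _] := h1; have [mb2 _] := h2.
have mD : measurable D by exact: measurableD.
have mI := measurableI _ _ mA mB; have mU := measurableU _ _ mA mB.
have Doo : (nu D < +oo)%E.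
  by apply: le_lt_trans Aoo; rewrite le_measure ?inE//; exact: subDsetl.
have Ioo : (nu (A `&` B) < +oo)%E.
  by apply: le_lt_trans Aoo; rewrite le_measure ?inE//; exact: subIsetl.
have Uoo : (nu (A `|` B) < +oo)%E.
  by apply: (le_lt_trans (measureU2 _ mA mB)); exact: lte_add_pinfty.
have EA : trace_term beta1 A = trace_term beta1 (A `&` B) + trace_term beta1 D.
  have i1 := integrable_trace_term h1 mI Ioo; have i2 := integrable_trace_term h1 mD Doo.
  apply: etrans (RintegralD measurableT i1 i2); apply: eq_Rintegral => y _.
  rewrite -mulrDr /D !indicE in_setI in_setD.
  by case: (y \in A); case: (y \in B); rewrite /= ?addr0 ?add0r.
have EU : trace_term beta2 (A `|` B) = trace_term beta2 B + trace_term beta2 D.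
  have i1 := integrable_trace_term h2 mB Boo; have i2 := integrable_trace_term h2 mD Doo.
  apply: etrans (RintegralD measurableT i1 i2); apply: eq_Rintegral => y _.
  rewrite -mulrDr /D !indicE in_setU in_setD.
  by case: (y \in A); case: (y \in B); rewrite /= ?addr0 ?add0r.
(* The order of [beta1] and [beta2] holds only a.e.; the maximum gives a pointwise inequality. *)
have ED : trace_term beta2 D = \int[nu]_y (Num.max (beta1 y) (beta2 y) * \1_D y).
  congr fine; apply: ae_eq_integral => //.
  - apply/measurable_EFinP; apply: measurable_funM => //; exact: measurable_indic.
  - apply/measurable_EFinP; apply: measurable_funM; last exact: measurable_indic.
    exact: measurable_maxr.
  by apply: filterS b12 => y hy _; rewrite max_r.
suff : trace_term beta1 D <= trace_term beta2 D by rewrite EA EU; lra.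
rewrite ED; have i1 := integrable_trace_term h1 mD Doo; have i2 := integrable_trace_term h2 mD Doo.
apply: le_Rintegral => //.
  have /integrableP[_ i2oo] := i2; apply/integrableP; split.
    apply/measurable_EFinP; apply: measurable_funM; last exact: measurable_indic.
    exact: measurable_maxr.
  rewrite (ae_eq_integral_measurable (g := fun y => `|(beta2 y * \1_D y)%:E|%E))//.
    by apply: measurableT_comp => //; have /integrableP[] := i2.
  by apply: filterS b12 => y hy /=; rewrite max_r.
by move=> y _; rewrite ler_wpM2r// le_max lexx.
Qed.

Lemma C_functional_submod beta1 beta2 c E F :
  Linfty_le beta1 c -> Linfty_le beta2 c ->
  {ae nu, forall y, beta1 y <= beta2 y} -> caccioppoli E -> caccioppoli F ->
  (C_functional beta1 (E `&` F) + C_functional beta2 (E `|` F) <=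
   C_functional beta1 E + C_functional beta2 F)%E.
Proof.
move=> h1 h2 b12 cE cF; have [cI cU] := caccioppoliI_U cE cF.
rewrite (C_functionalE h1 cI) (C_functionalE h2 cU) (C_functionalE h1 cE) (C_functionalE h2 cF).
have [mE EO Eoo Etv] := cE; have [mF FO Foo Ftv] := cF.
have [mI _ _ Itv] := cI; have [mU _ _ Utv] := cU.
have [mb2 _] := h2.
have mTE := measurable_trace_set mE; have mTF := measurable_trace_set mF.
have EU : trace_term beta2 (trace_set (E `|` F)) =
    trace_term beta2 (trace_set E `|` trace_set F).
  apply: trace_term_ae => //; [exact: measurable_trace_set|exact: measurableU|].
  exact: trace_setU.
have tr := trace_term_supermod h1 h2 b12 mTE (trace_set_lty mE EO Eoo Etv)
  mTF (trace_set_lty mF FO Foo Ftv).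
have : (fine (TV (E `&` F)) + fine (TV (E `|` F)) <= fine (TV E) + fine (TV F)).
  have fin (X : set V) : (TV X < +oo)%E -> TV X \is a fin_num.
    by move=> Xoo; rewrite ge0_fin_numE// tv_ge0.
  rewrite -lee_fin (EFinD (fine (TV (E `&` F)))) (EFinD (fine (TV E))).
  rewrite (fineK (fin _ Itv)) (fineK (fin _ Utv)) (fineK (fin _ Etv)) (fineK (fin _ Ftv)).
  exact: total_variation_submod.
rewrite -!EFinD lee_fin EU trace_setI//; move: tr; clear.
set a := trace_term _ _; set b := trace_term _ _; set x := trace_term _ _; set y := trace_term _ _.
by lra.
Qed.

End capillary_energy.

(** * The distance term *)

Section distance.
Context {R : realType} {n : nat}.
Local Notation V := 'rV[R]_n.+1.
Local Notation Om := (@Omega R n).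
Local Notation dist A x := (edist_set x (Om `&` boundary A)).
Implicit Types (A E F : set V) (x y z : V).

Definition segment x y (t : R) : V := x + t *: (y - x).

Lemma continuous_segment x y : continuous (segment x y).
Proof.
move=> t; apply: cvgD; first exact: cvg_cst.
by apply: cvgZr_tmp; exact: cvg_id.
Qed.

Lemma segment0 x y : segment x y 0 = x.
Proof. by rewrite /segment scale0r addr0. Qed.

Lemma segment1 x y : segment x y 1 = y.
Proof. by rewrite /segment scale1r addrC subrK. Qed.

(** The last parameter at which the segment is in the closure of [A] is a boundary point: from an
    interior one, the segment could be followed a little further inside [A]. *)
Lemma segment_boundary A x y : closure A x -> ~ interior A y ->
  exists2 t, 0 <= t <= 1 & boundary A (segment x y t).
Proof.
move=> Ax Ay; pose T : set R := [set t | 0 <= t <= 1 /\ closure A (segment x y t)].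
have T0 : T 0 by split; rewrite ?lexx ?ler01// segment0.
have supT : has_sup T by split; [exists 0|exists 1 => t [/andP[]]].
have cT : closed T.
  rewrite (_ : T = `[0, 1]%classic `&` segment x y @^-1` closure A); last first.
    by apply/seteqP; split => t; rewrite /T /= in_itv.
  apply: closedI; first exact: itv_closed.
  by apply: closed_comp; [move=> t _; exact: continuous_segment|exact: closed_closure].
have [/andP[t0 t1] Ct] : T (sup T) by apply: cT; apply: closure_sup; [exists 0|case: supT].
set t := sup T in t0 t1 Ct *.
exists t; first by rewrite t0.
split => // It; have tlt1 : t < 1.
  rewrite lt_neqAle t1 andbT; apply/eqP => te; apply: Ay.
  by rewrite -(segment1 x y) -te.
have /nbhs_ballP[e /= e0 He] : nbhs t (segment x y @^-1` A).
  by apply: continuous_segment; exact: It.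
pose s := t + Num.min (e / 2) (1 - t).
have m0 : 0 < Num.min (e / 2) (1 - t) by rewrite lt_min divr_gt0//= subr_gt0.
have Ts : T s.
  split; first by rewrite /s addr_ge0 ?(ltW m0)//= -lerBrDl ge_min lexx orbT.
  apply: subset_closure; apply: He; rewrite /ball /= /s opprD addrA subrr sub0r normrN.
  rewrite gtr0_norm// (@le_lt_trans _ _ (e / 2))// ?ge_min ?lexx//.
  by rewrite ltr_pdivrMr// ltr_pMr// ltr1n.
have := sup_upper_bound supT Ts; rewrite -/t /s.
by rewrite gerDl leNgt m0.
Qed.

Lemma enormZ m (a : R) (x : 'rV[R]_m) : enorm (a *: x) = `|a| * enorm x.
Proof.
rewrite /enorm -sqrtr_sqr -sqrtrM ?sqr_ge0//; congr Num.sqrt.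
by rewrite mulr_sumr; apply: eq_bigr => i _; rewrite mxE exprMn.
Qed.

Lemma enorm_ge0 m (x : 'rV[R]_m) : 0 <= enorm x.
Proof. exact: sqrtr_ge0. Qed.

Lemma Omega_segment x y t : Om x -> Om y -> 0 <= t <= 1 -> Om (segment x y t).
Proof.
rewrite /Omega /= !mxE => x0 y0 /andP[t0 t1].
rewrite (_ : _ + _ = (1 - t) * x ord0 ord_max + t * y ord0 ord_max); last by ring.
have [->|tn0] := eqVneq t 0; first by rewrite subr0 mul1r mul0r addr0.
apply: ltr_wpDl; first by rewrite mulr_ge0 ?subr_ge0// ltW.
by rewrite mulr_gt0// lt_neqAle eq_sym tn0.
Qed.

Lemma le_edist E F x : (forall y, (Om `&` boundary F) y ->
    exists2 z, (Om `&` boundary E) z & enorm (z - x) <= enorm (y - x)) ->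
  (dist E x <= dist F x)%E.
Proof.
move=> H; apply: le_ereal_inf_tmp => _ [y Fy <-]; have [z Ez zy] := H y Fy.
apply: (@le_trans _ _ (enorm (z - x))%:E); last by rewrite lee_fin.
by apply: ereal_inf_lbound; exists z.
Qed.

(** Only boundary points inside [Om] count; convexity of the half-space keeps the crossing point
    there, here and in [edist_outer]. *)
Lemma edist_inner E F x : E `<=` F -> F `<=` Om -> E x -> (dist E x <= dist F x)%E.
Proof.
move=> EF FO Ex; apply: le_edist => y [Oy [_ Fy]].
have Ey : ~ interior E y by move=> Ey; apply: Fy; exact: interiorS Ey.
have [t t01 Et] := segment_boundary (subset_closure Ex) Ey.
exists (segment x y t); first by split => //; apply: Omega_segment => //; apply: FO; exact: EF.
rewrite /segment addrAC subrr add0r enormZ; case/andP: t01 => t0 t1.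
by rewrite ger0_norm// ler_piMl// enorm_ge0.
Qed.

Lemma edist_outer E F x : E `<=` F -> Om x -> ~ F x -> (dist F x <= dist E x)%E.
Proof.
move=> EF Ox nFx; apply: le_edist => y [Oy [Ey _]].
have Fx : ~ interior F x by move=> /interior_subset.
have [t t01 Et] := segment_boundary (closureS EF Ey) Fx.
exists (segment y x t); first by split => //; exact: Omega_segment.
have -> : segment y x t - x = (1 - t) *: (y - x).
  by apply/rowP => i; rewrite /segment !mxE; ring.
case/andP: t01 => t0 t1; rewrite enormZ ger0_norm ?subr_ge0//.
by rewrite ler_piMl// ?enorm_ge0// gerBl.
Qed.

Lemma continuous_enorm m (y : 'rV[R]_m) : continuous (fun x : 'rV[R]_m => enorm (y - x)).
Proof.
have cs (s : seq 'I_m) : continuous (fun x : 'rV[R]_m => \sum_(i <- s) (y - x) ord0 i ^+ 2).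
  elim: s => [|i s IH].
    by under eq_fun do rewrite big_nil; exact: cst_continuous.
  under eq_fun do rewrite big_cons expr2.
  have ci : continuous (fun x : 'rV[R]_m => (y - x) ord0 i).
    under eq_fun do rewrite !mxE.
    apply: continuous_sub; first exact: cst_continuous.
    exact: coord_continuous.
  by apply: continuous_add => //; exact: continuous_mul.
by move=> x; apply: (continuous_comp (cs _ x)); exact: sqrt_continuous.
Qed.

Lemma measurable_edist m (A : set 'rV[R]_m) :
  measurable_fun setT (fun x : 'rV[R]_m => edist_set x A).
Proof.
apply: (measurability _ (ErealGenInftyO.measurableE R)) => _ [_ [a ->] <-].
rewrite setTI; apply: open_measurable_rV.
rewrite (_ : _ @^-1` _ = \bigcup_(y in A) ((fun x : 'rV[R]_m => enorm (y - x)) @^-1` [set r | r < a])).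
  apply: bigcup_open => y _; apply: open_comp; last exact: open_lt.
  by move=> x _; exact: continuous_enorm.
apply/seteqP; split => x /=.
  rewrite in_itv/= => /ereal_inf_lt[_ [y Ay <-]]; rewrite lte_fin => ya.
  by exists y.
move=> [y Ay /= ya]; rewrite in_itv/=; apply: (@le_lt_trans _ _ (enorm (y - x))%:E).
  by apply: ereal_inf_lbound; exists y.
by rewrite lte_fin.
Qed.

Lemma edist_ge0 m (A : set 'rV[R]_m) (x : 'rV[R]_m) : (0 <= edist_set x A)%E.
Proof.
by apply: le_ereal_inf_tmp => _ [y _ <-]; rewrite lee_fin enorm_ge0.
Qed.

End distance.

(** * The integral of the distance over the symmetric difference *)

Section deviation.
Context {R : realType} {n : nat}.
Local Notation mu := (@lebesgue_rV R n.+1).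
Local Notation V := 'rV[R]_n.+1.
Local Notation Om := (@Omega R n).
Implicit Types (A B E F : set V).

Definition deviation A E : \bar R :=
  (\int[mu]_(x in A `+` E) edist_set x (Om `&` boundary E))%E.

Lemma deviationE A E : deviation A E =
  (\int[mu]_x ((fun x => edist_set x (Om `&` boundary E)) \_ (A `+` E)) x)%E.
Proof. exact: integral_mkcond. Qed.

Lemma measurable_setY A E : measurable A -> measurable E -> measurable (A `+` E).
Proof. by move=> mA mE; rewrite setY_def; apply: measurableU; exact: measurableD. Qed.

Lemma deviation_ge0 A E : (0 <= deviation A E)%E.
Proof. by apply: integral_ge0 => x _; exact: edist_ge0. Qed.

Lemma deviation_self E : deviation E E = 0%E.
Proof. by rewrite /deviation setYK integral_set0. Qed.

Lemma deviation_ae A B E : measurable A -> measurable B -> measurable E ->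
  {ae mu, forall x, A x <-> B x} -> deviation A E = deviation B E.
Proof.
move=> mA mB mE AB; rewrite !deviationE.
apply: ae_eq_integral_measurable.
  apply/measurable_restrict => //; first exact: measurable_setY.
  by apply: measurable_funTS; exact: measurable_edist.
apply: filterS AB => x ABx; rewrite !patchE; congr (if _ then _ else _).
by apply/idP/idP; rewrite !inE !setY_def => -[[h1 h2]|[h1 h2]];
  (by left; split => //; apply/ABx) || (by right; split => // /ABx).
Qed.

(** The integrands compare pointwise. Only [x] in [A] outside [B] matters: for [x] in [E] this is
    [edist_inner], for [x] outside [F] it is [edist_outer] (with [x] in [Om] because of [A]), and in
    between the left side is 0. *)
Lemma deviation_submod A B E F : measurable A -> measurable B ->
  measurable E -> measurable F -> A `<=` Om -> E `<=` F -> F `<=` Om ->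
  (deviation (A `&` B) E + deviation (A `|` B) F <= deviation A E + deviation B F)%E.
Proof.
move=> mA mB mE mF AO EF FO.
have mr C D : measurable C -> measurable D -> measurable_fun setT
    ((fun x => edist_set x (Om `&` boundary D)) \_ (C `+` D)).
  move=> mC mD; apply/measurable_restrict => //; first exact: measurable_setY.
  by apply: measurable_funTS; exact: measurable_edist.
have r0 C D x : (0 <= ((fun x => edist_set x (Om `&` boundary D)) \_ (C `+` D)) x)%E.
  by apply: erestrict_ge0 => y _; exact: edist_ge0.
have mI := measurableI _ _ mA mB; have mU := measurableU _ _ mA mB.
rewrite !deviationE -!ge0_integralD//; try exact: mr.
apply: ge0_le_integral => //.
- by move=> x _; apply: adde_ge0.
- by apply: emeasurable_funD; exact: mr.
- by apply: emeasurable_funD; exact: mr.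
move=> x _; rewrite !patchE !setY_def !in_setU !in_setD !in_setI.
have := @edist_inner _ _ E F x EF FO; have := @edist_outer _ _ E F x EF.
have := AO x; have := EF x.
have d0 D : (0 <= edist_set x (Om `&` boundary D))%E by exact: edist_ge0.
rewrite in_setU.
have [Ax|Ax] := boolP (x \in A); have [Bx|Bx] := boolP (x \in B);
have [Ex|Ex] := boolP (x \in E); have [Fx|Fx] := boolP (x \in F);
rewrite ?inE ?notin_setE in Ax Bx Ex Fx; rewrite /= ?addr0 ?add0r ?adde0 ?add0e//.
all: move=> h1 h2 h3 h4; do ?[exact: leeD|exact: h4|exact: adde_ge0|exact: lexx].
all: do ?[by case: Fx; exact: h1].
all: try (by apply: h3 => //; exact: h2).
Qed.

End deviation.

(** * Points of density one *)

Section density_points.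
Context {R : realType} {m : nat}.
Local Notation mu := (@lebesgue_rV R m).
Local Notation V := 'rV[R]_m.
Implicit Types (A B : set V) (x y : V).

Lemma eball_sub_ball x r : 0 < r -> eball x r `<=` ball x r.
Proof.
move=> r0 y xy; apply/rV_ballP => // i; rewrite distrC.
by have := enorm_coor (y - x) i; rewrite !mxE => /le_lt_trans; exact.
Qed.

Lemma eball_le x r : 0 < r -> (mu (eball x r) <= ((2 * r) ^+ m)%:E)%E.
Proof.
move=> r0; rewrite -(lebesgue_rV_ball x r0) le_measure ?inE//.
- exact: measurable_eball.
- exact: measurable_rV_ball.
exact: eball_sub_ball.
Qed.

Lemma eball_ge x r : 0 < r -> (((2 * (r / m.+1%:R)) ^+ m)%:E <= mu (eball x r))%E.
Proof.
move=> r0; pose p := r / m.+1%:R; have p0 : 0 < p by rewrite divr_gt0.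
rewrite -(lebesgue_rV_ball x p0) le_measure ?inE//.
- exact: measurable_rV_ball.
- exact: measurable_eball.
move=> y /(rV_ballP _ _ p0) xy; apply: (le_lt_trans (enorm_le_sum _)).
apply: (@le_lt_trans _ _ (\sum_(i < m) p)).
  by apply: ler_sum => i _; rewrite !mxE distrC ltW.
rewrite sumr_const card_ord -mulr_natr /p mulrAC ltr_pdivrMr// ltr_pM2l//.
by rewrite ltr_nat.
Qed.

Lemma eball_fin x r : mu (eball x r) \is a fin_num.
Proof.
rewrite ge0_fin_numE//; have [r0|r0] := ltP 0 r.
  by rewrite (le_lt_trans (eball_le x r0))// ltry.
rewrite (_ : eball x r = set0) ?measure0//; apply/seteqP; split => // y.
by rewrite /eball /= ltNge (le_trans r0)// enorm_ge0.
Qed.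

Lemma fin_num_setI_eball B x r : measurable B -> mu (B `&` eball x r) \is a fin_num.
Proof.
move=> mB; rewrite ge0_fin_numE//; apply: (@le_lt_trans _ _ (mu (eball x r))).
  rewrite le_measure ?inE//; [|exact: measurable_eball].
  by apply: measurableI => //; exact: measurable_eball.
by rewrite -ge0_fin_numE// eball_fin.
Qed.

Lemma eball_gt0 x r : 0 < r -> 0 < fine (mu (eball x r)).
Proof.
move=> r0; rewrite -lte_fin fineK ?eball_fin//.
by apply: lt_le_trans (eball_ge x r0); rewrite lte_fin exprn_gt0// mulr_gt0// divr_gt0.
Qed.

Definition mostly A (e : R) x r := (mu (~` A `&` eball x r) <= e%:E * mu (eball x r))%E.

Lemma density_oneP A x : measurable A -> density_one A x <->
  forall e : R, 0 < e -> exists2 d, 0 < d & forall r, 0 < r < d -> mostly A e x r.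
Proof.
move=> mA; have mB r := measurable_eball x r.
have mAB r : measurable (A `&` eball x r) by exact: measurableI.
have mnAB r : measurable (~` A `&` eball x r) by apply: measurableI => //; exact: measurableC.
have mC := measurableC mA; have fin := fin_num_setI_eball.
have split_ball r : fine (mu (eball x r)) =
    fine (mu (A `&` eball x r)) + fine (mu (~` A `&` eball x r)).
  rewrite -fineD ?fin// -measureU//.
    by rewrite -setIUl setUv setTI.
  by rewrite setIACA setICr set0I.
have E (e : R) r : 0 < r -> mostly A e x r <->
    `|1 - fine (mu (A `&` eball x r)) / fine (mu (eball x r))| <= e.
  move=> r0; have b0 := eball_gt0 x r0.
  have -> : 1 - fine (mu (A `&` eball x r)) / fine (mu (eball x r)) =
      fine (mu (~` A `&` eball x r)) / fine (mu (eball x r)).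
    apply: (mulIf (lt0r_neq0 b0)); rewrite mulrBl mul1r !divfK ?lt0r_neq0//.
    by rewrite split_ball addrC addKr.
  rewrite ger0_norm ?divr_ge0 ?fine_ge0// ler_pdivrMr// -lee_fin EFinM.
  by rewrite !fineK ?fin ?eball_fin.
split=> [H e e0|H].
  have /cvgrPdist_le/(_ _ e0)/near_right0P[d d0 Hd] := H.
  by exists d => // r rd; apply/E; [case/andP: rd|exact: Hd].
apply/cvgrPdist_le => e e0; apply/near_right0P; have [d d0 Hd] := H e e0.
by exists d => // r rd; apply/E; [case/andP: rd|exact: Hd].
Qed.

Lemma density_one_mono A B : measurable A -> measurable B ->
  {ae mu, forall x, A x -> B x} -> density_one A `<=` density_one B.
Proof.
move=> mA mB AB x /(density_oneP _ mA) H; apply/density_oneP => // e e0.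
have [d d0 Hd] := H e e0; exists d => // r rd; apply: le_trans (Hd r rd).
have mBr := measurable_eball x r.
have mC C : measurable C -> measurable (~` C `&` eball x r).
  by move=> mC; apply: measurableI => //; exact: measurableC.
apply: ae_le_measure; [exact: mC..|].
by apply: filterS AB => y ABy [nBy yr]; split => // /ABy.
Qed.

Lemma density_one_ae_eq A B : measurable A -> measurable B ->
  {ae mu, forall x, A x <-> B x} -> density_one A = density_one B.
Proof.
move=> mA mB AB; apply/seteqP.
by split; apply: density_one_mono => //; apply: filterS AB => x [].
Qed.

Lemma density_oneI A B : measurable A -> measurable B ->
  density_one A `&` density_one B `<=` density_one (A `&` B).
Proof.
move=> mA mB x [/(density_oneP _ mA) HA /(density_oneP _ mB) HB].
apply/density_oneP => [|e e0]; first exact: measurableI.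
have e20 : 0 < e / 2 by rewrite divr_gt0.
have [d1 d10 H1] := HA _ e20; have [d2 d20 H2] := HB _ e20.
exists (Num.min d1 d2) => [|r]; first by rewrite lt_min d10.
rewrite lt_min => /and3P[r0 r1 r2]; have mBr := measurable_eball x r.
have mC C : measurable C -> measurable (~` C `&` eball x r).
  by move=> mC; apply: measurableI => //; exact: measurableC.
rewrite /mostly setCI setIUl; apply: (le_trans (measureU2 _ (mC _ mA) (mC _ mB))).
rewrite [in leRHS](splitr e) EFinD ge0_muleDl; [|by rewrite lee_fin ltW|by rewrite lee_fin ltW].
by apply: leeD; [apply: H1; rewrite r0|apply: H2; rewrite r0].
Qed.

Lemma density_one_setC A x : measurable A -> density_one A x ->
  density_one (~` A) x -> False.
Proof.
move=> mA /(density_oneP _ mA) H1 /(density_oneP _ (measurableC mA)) H2.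
have e0 : 0 < 1 / 4 :> R by rewrite divr_gt0.
have [d1 d10 {}H1] := H1 _ e0; have [d2 d20 {}H2] := H2 _ e0.
pose r := Num.min d1 d2 / 2.
have m0 : 0 < Num.min d1 d2 by rewrite lt_min d10.
have r0 : 0 < r by rewrite divr_gt0.
have rm : r < Num.min d1 d2 by rewrite /r ltr_pdivrMr// ltr_pMr// ltr1n.
move: rm; rewrite lt_min => /andP[r1 r2].
have {}H1 := H1 r ltac:(by rewrite r0); have {}H2 := H2 r ltac:(by rewrite r0).
rewrite /mostly setCK in H1 H2; have b0 := eball_gt0 x r0.
have : (mu (eball x r) <= (1 / 4)%:E * mu (eball x r) + (1 / 4)%:E * mu (eball x r))%E.
  apply: le_trans (leeD H1 H2); rewrite -[X in (mu X <= _)%E](setTI (eball x r)) -(setUv (~` A)).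
  rewrite setCK setIUl; apply: (measureU2 mu); apply: measurableI => //.
  - exact: measurableC.
  - exact: measurable_eball.
  - exact: measurable_eball.
by rewrite -(fineK (eball_fin x r)) -EFinM -EFinD lee_fin; move: b0; clear; lra.
Qed.

(** Passes from cubes to Euclidean balls: a ball of radius [r] lies in the cube of the same radius
    and contains the one of radius [r / m.+1], which has measure [c * r ^+ m]. *)
Lemma ae_density_one A : measurable A -> {ae mu, forall x, A x -> density_one A x}.
Proof.
move=> mA; apply: filterS (zero_density_setC mA) => x H Ax.
apply/density_oneP => // e e0; pose c : R := (2 / m.+1%:R) ^+ m.
have c0 : 0 < c by rewrite exprn_gt0// divr_gt0.
have [d d0 Hd] := H Ax (e * c) (mulr_gt0 e0 c0); exists d => // r rd.
have /andP[r0 _] := rd.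
apply: (@le_trans _ _ (mu (~` A `&` ball x r))).
  rewrite le_measure ?inE//.
  - by apply: measurableI; [exact: measurableC|exact: measurable_eball].
  - by apply: measurableI; [exact: measurableC|exact: measurable_rV_ball].
  by apply: setIS; exact: eball_sub_ball.
apply: (le_trans (Hd r rd)); apply: le_trans (lee_wpmul2l _ (eball_ge x r0)); last first.
  by rewrite lee_fin ltW.
rewrite -EFinM lee_fin -mulrA ler_pM2l// /c -exprMn.
by rewrite (_ : 2 / m.+1%:R * r = 2 * (r / m.+1%:R))// mulrAC mulrA.
Qed.

Lemma ae_density_oneP A : measurable A -> {ae mu, forall x, density_one A x <-> A x}.
Proof.
move=> mA; have mC := measurableC mA.
apply: filterS2 (ae_density_one mA) (ae_density_one mC) => x H1 H2; split => //.
by move=> dA; apply: contrapT => /H2; exact: density_one_setC.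
Qed.

Lemma measurable_fun_eball B r : measurable B ->
  measurable_fun setT (fun x => mu (B `&` eball x r)).
Proof.
move=> mB; pose S : set (V * V) := [set p | B p.2 /\ enorm (p.2 - p.1) < r].
have mS : measurable S.
  rewrite (_ : S = (setT `*` B) `&` (fun p : V * V => p.2 - p.1) @^-1` eball 0 r); last first.
    apply/seteqP; split => p; rewrite /S /eball /= subr0; first by move=> [].
    by move=> [[]].
  apply: measurableI; first exact: measurableX.
  rewrite -[X in measurable X]setTI.
  have mf : measurable_fun setT (fun p : V * V => p.2 - p.1).
    exact: (measurableT_comp (@measurable_rV_sub_pair R m)
      (measurable_fun_pair measurable_snd measurable_fst)).
  by apply: mf => //; exact: measurable_eball.
apply: (eq_measurable_fun (mu \o xsection S)) (measurable_fun_xsection mu mS).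
move=> x _; congr (mu _); apply/seteqP; split => y.
  by rewrite /xsection /= inE.
by move=> [By xy]; rewrite /xsection /= inE.
Qed.

Lemma measurable_mostly A (e r : R) : measurable A -> 0 <= e -> measurable [set x | mostly A e x r].
Proof.
move=> mA e0; have m1 := measurable_fun_eball r (measurableC mA).
have m2 : measurable_fun setT (fun x => e%:E * mu (eball x r))%E.
  apply: emeasurable_funM => //.
  by have := measurable_fun_eball r (@measurableT _ V); under eq_fun do rewrite setTI.
rewrite -[X in measurable X]setTI.
have := emeasurable_fun_c_infty measurableT (emeasurable_funB m2 m1) 0%E.
congr measurable; congr (_ `&` _); apply/seteqP; split => x;
  by rewrite /mostly /= sube_ge0// fin_num_setI_eball//; exact: measurableC.
Qed.

(* The measure of a ball is left continuous in the radius. *)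
Lemma mostly_rat A (e d : R) x : measurable A -> 0 <= e ->
  (forall q : rat, 0 < (ratr q : R) < d -> mostly A e x (ratr q)) ->
  forall r, 0 < r < d -> mostly A e x r.
Proof.
move=> mA e0 H r /andP[r0 rd].
have mB s := measurable_eball x s.
have mCB s : measurable (~` A `&` eball x s) by apply: measurableI => //; exact: measurableC.
pose s k : R := r * (1 - k.+2%:R^-1).
have E : ~` A `&` eball x r = \bigcup_k (~` A `&` eball x (s k)).
  rewrite -setI_bigcupr; congr (_ `&` _); apply/seteqP; split => y; rewrite /eball /=.
    move=> yr; pose t := (r - enorm (y - x)) / r.
    have t0 : 0 < t by rewrite divr_gt0// subr_gt0.
    exists (Num.truncn t^-1) => //=; rewrite /s.
    have tk : (Num.truncn t^-1).+2%:R^-1 < t.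
      rewrite invf_plt ?posrE//; apply: lt_trans (truncnS_gt _) _.
      by rewrite ltr_nat.
    have -> : enorm (y - x) = r * (1 - t).
      by rewrite mulrBr mulr1 /t mulrCA mulfV ?gt_eqF// mulr1 subKr.
    by rewrite ltr_pM2l// ltrD2l ltrN2.
  move=> [k _ /= yk]; apply: (lt_le_trans yk); rewrite /s mulrBr mulr1 lerBlDr lerDl.
  by rewrite mulr_ge0 ?invr_ge0// ltW.
have hs : {homo (fun k => ~` A `&` eball x (s k)) : i j / (i <= j)%N >-> (i <= j)%O}.
  move=> i j ij; apply/subsetPset; apply: setIS => y /lt_le_trans; apply.
  by rewrite /s ler_pM2l// lerD2l lerN2 lef_pV2 ?posrE// ler_nat.
have := nondecreasing_cvg_mu (mu := mu) (fun k => mCB (s k)) ltac:(by rewrite -E) hs.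
rewrite -E => cv; rewrite /mostly -(cvg_lim (@ereal_hausdorff _) cv).
apply: lime_le; first by apply/cvg_ex; eexists; exact: cv.
apply: nearW => k /=; have sr : s k < r.
  by rewrite /s -[ltRHS]mulr1 ltr_pM2l// gtrBl invr_gt0.
have s0 : 0 < s k by rewrite mulr_gt0// subr_gt0 invf_lt1// ltr1n.
have [q] := rat_in_itvoo sr; rewrite in_itv/= => /andP[sq qr].
have {}H := H q ltac:(by rewrite (lt_trans s0 sq) (lt_trans qr)).
apply: le_trans (le_trans H _).
  by rewrite le_measure ?inE//; apply: setIS => y /lt_trans; exact.
apply: lee_wpmul2l; first by rewrite lee_fin.
by rewrite le_measure ?inE// => y /lt_trans; exact.
Qed.

(** Reduces the three quantifiers to countable ones: [e] and [d] run through inverses of integers,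
    and [r] through rationals by [mostly_rat]. It is required for [density_one] of a union to be an
    admissible competitor. *)
Lemma measurable_density_one A : measurable A -> measurable (density_one A).
Proof.
move=> mA; pose h (k : nat) : R := k.+1%:R^-1.
have h0 k : 0 < h k by rewrite invr_gt0.
have h_lt (e : R) : 0 < e -> exists k, h k < e.
  move=> e0; exists (Num.truncn e^-1); rewrite invf_plt ?posrE//; exact: truncnS_gt.
rewrite (_ : density_one A = \bigcap_j \bigcup_k
    (~` \bigcup_(q : rat) (if 0 < (ratr q : R) < h k then ~` [set x | mostly A (h j) x (ratr q)] else set0))).
  apply: bigcap_measurable => // j _; apply: bigcup_measurable => k _.
  apply: measurableC; apply: bigcupT_measurable_rat => q.
  case: ifPn => // _; apply: measurableC; apply: measurable_mostly => //; exact: ltW.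
apply/seteqP; split => x.
  move=> /(density_oneP _ mA) H j _; have [d d0 Hd] := H (h j) (h0 j).
  have [k kd] := h_lt _ d0; exists k => // -[q _]; case: ifPn => // /andP[q0 qk]; apply.
  by apply: Hd; rewrite q0 (lt_trans qk).
move=> H; apply/density_oneP => // e e0; have [j je] := h_lt _ e0.
have [k _ Hk] := H j I; exists (h k) => // r rk.
have : mostly A (h j) x r.
  apply: (@mostly_rat _ _ (h k)) => //; first exact: ltW.
  move=> q qk; apply: contrapT => nq; apply: Hk; exists q => //.
  by rewrite qk.
move=> /le_trans; apply; apply: lee_wpmul2r => //; rewrite lee_fin; exact: ltW.
Qed.

Lemma density_one_idem A : measurable A -> density_one (density_one A) = density_one A.
Proof.
move=> mA; apply: density_one_ae_eq => //; first exact: measurable_density_one.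
exact: ae_density_oneP.
Qed.

End density_points.

(** * Comparison of minimizers *)

Section comparison.
Context {R : realType} {n : nat}.
Local Notation mu := (@lebesgue_rV R n.+1).
Local Notation nu := (@lebesgue_rV R n).
Local Notation V := 'rV[R]_n.+1.
Local Notation Om := (@Omega R n).
Implicit Types (A E F G H : set V) (beta : 'rV[R]_n -> R).

(** Around a point of nonpositive height, a cube shifted downwards lies in the Euclidean ball and
    outside [Om]; it fills at least the fraction [c] of the enclosing cube, which contradicts
    density one. *)
Lemma density_one_Omega A : measurable A -> A `<=` Om -> density_one A `<=` Om.
Proof.
move=> mA AO x /(density_oneP _ mA) Hx; apply: contrapT => nOx.
pose c : R := (n.+3%:R^-1) ^+ n.+1.
have c0 : 0 < c by rewrite exprn_gt0// invr_gt0.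
have [d d0 Hd] := Hx (c / 2) ltac:(by rewrite divr_gt0).
pose r := d / 2; have r0 : 0 < r by rewrite divr_gt0.
have {Hd} := Hd r ltac:(by rewrite r0 /= /r ltr_pdivrMr// ltr_pMr// ltr1n).
rewrite /mostly; pose p := r / n.+3%:R; have p0 : 0 < p by rewrite divr_gt0.
have x0 : x ord0 ord_max <= 0 by rewrite leNgt; apply/negP.
have lb : (((2 * p) ^+ n.+1)%:E <= mu (~` A `&` eball x r))%E.
  rewrite -(lebesgue_rV_ball (x + (-1 * p) *: delta_mx ord0 ord_max : V) p0).
  rewrite le_measure ?inE//; first exact: measurable_rV_ball.
    by apply: measurableI; [exact: measurableC|exact: measurable_eball].
  move=> y xy; split; last by apply: (shifted_ball_sub (s := -1)) xy; rewrite ?normrN1.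
  move=> /AO; rewrite /Omega /=; have /(rV_ballP _ _ p0)/(_ ord_max) := xy.
  rewrite !mxE !eqxx mulr1 mulN1r ltr_norml => /andP[h _] y0.
  by move: h; rewrite ltNge => /negP; apply; lra.
have ub := lee_wpmul2l (ltac:(by rewrite lee_fin divr_ge0// ltW) : (0 <= (c / 2)%:E)%E) (eball_le x r0).
move=> /(le_trans lb)/le_trans/(_ ub); rewrite -EFinM lee_fin.
have -> : (2 * p) ^+ n.+1 = c * (2 * r) ^+ n.+1.
  by rewrite /c -exprMn; congr (_ ^+ _); rewrite /p; ring.
rewrite ler_pM2r ?exprn_gt0 ?mulr_gt0// leNgt => /negP; apply.
by rewrite ltr_pdivrMr// ltr_pMr// ltr1n.
Qed.

Lemma caccioppoli_BV E : caccioppoli E -> density_one E = E -> BV_set E.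
Proof.
move=> [mE EO Eoo Etv] dE; split => //; split => //.
apply: (integrableS measurableT) => //; first exact: measurable_Omega.
exact: integrable_indic_lty.
Qed.

Lemma BV_setI E F : BV_set E -> BV_set F -> BV_set (E `&` F).
Proof.
move=> bE bF; have cE := BV_caccioppoli bE; have cF := BV_caccioppoli bF.
have [cI _] := caccioppoliI_U cE cF; apply: caccioppoli_BV => //.
have [mE _ _ dE] := bE; have [mF _ _ dF] := bF; have mI := measurableI _ _ mE mF.
apply/seteqP; split => [x xI|]; last by rewrite -[in X in X `<=` _]dE -[in X in X `<=` _]dF; exact: density_oneI.
split; [rewrite -dE|rewrite -dF];
  by apply: density_one_mono xI => //; apply: aeW => y [].
Qed.

Lemma BV_density_one E : caccioppoli E -> caccioppoli (density_one E) /\ BV_set (density_one E).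
Proof.
move=> [mE EO Eoo Etv]; have md := measurable_density_one mE.
have ae := ae_density_oneP mE.
have cd : caccioppoli (density_one E).
  apply: And4; [exact: md|exact: density_one_Omega| |].
  - apply: le_lt_trans Eoo; apply: ae_le_measure => //.
    by apply: filterS ae => x [].
  - by rewrite (total_variation_ae md mE ae).
split; first exact: cd.
by apply: caccioppoli_BV; [exact: cd|exact: density_one_idem].
Qed.

Lemma C_functional_fin beta c E : Linfty_le beta c -> caccioppoli E ->
  C_functional beta E \is a fin_num.
Proof. by move=> hb cE; rewrite (C_functionalE hb cE). Qed.

Lemma A_functionalE beta E F lambda :
  A_functional beta E F lambda = (C_functional beta E + lambda%:E * deviation E F)%E.
Proof. by []. Qed.

(** Null sets may be changed in [A] and [B] only: [E] and [F] enter through their topological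
    boundaries, and are kept as they are. *)
Lemma A_functional_submod beta1 beta2 c lambda A B E F :
  Linfty_le beta1 c -> Linfty_le beta2 c ->
  {ae nu, forall y, beta1 y <= beta2 y} -> 0 <= lambda ->
  BV_set A -> BV_set B -> BV_set E -> BV_set F -> E `<=` F ->
  (A_functional beta1 (A `&` B) E lambda +
   A_functional beta2 (density_one (A `|` B)) F lambda <=
   A_functional beta1 A E lambda + A_functional beta2 B F lambda)%E.
Proof.
move=> h1 h2 b12 l0 bA bB bE bF EF.
have cA := BV_caccioppoli bA; have cB := BV_caccioppoli bB.
have [cI cU] := caccioppoliI_U cA cB; have [cD _] := BV_density_one cU.
have [mA AO _ _] := cA; have [mB _ _ _] := cB; have [mU _ _ _] := cU; have [mD _ _ _] := cD.
have [mE _ _ _] := bE; have [mF FO _ _] := bF.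
have aeU := ae_density_oneP mU.
rewrite !A_functionalE (C_functional_ae h2 cD cU aeU) (deviation_ae mD mU mF aeU).
rewrite addeACA [leRHS]addeACA; apply: leeD.
  exact: (C_functional_submod h1 h2 b12 cA cB).
rewrite -!ge0_muleDr ?deviation_ge0//; apply: lee_wpmul2l; first by rewrite lee_fin.
exact: deviation_submod.
Qed.

(** The competitor [G] has deviation 0 from itself, so the minimum is at most the finite energy of
    [G], even where the distance to its boundary is infinite. *)
Lemma minimizer_fin beta c lambda G E : Linfty_le beta c -> 0 <= lambda ->
  BV_set G -> minimizer beta lambda G E -> A_functional beta E G lambda \is a fin_num.
Proof.
move=> hb l0 bG [bE Emin].
have cE := BV_caccioppoli bE; have cG := BV_caccioppoli bG.
have AG : A_functional beta G G lambda = C_functional beta G.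
  by rewrite A_functionalE (deviation_self G) mule0; exact: adde0.
have := Emin G bG; rewrite AG A_functionalE.
have := C_functional_fin hb cE; have := C_functional_fin hb cG.
move: (C_functional beta G) (C_functional beta E) => cG' cE' fG fE H.
rewrite fin_numD fE /=.
have d0 : (0 <= lambda%:E * deviation E G)%E by rewrite mule_ge0 ?deviation_ge0.
rewrite ge0_fin_numE// ltey; apply/eqP => oo; move: H; rewrite oo addey.
  by rewrite leye_eq => /eqP Goo; move: fG; rewrite Goo.
by move: fE; rewrite fin_numE => /andP[].
Qed.

(** If the sum does not increase while neither term can fall below its minimum, both terms stay
    minimal; finiteness justifies the cancellation. *)
Lemma step_minimizers beta1 beta2 c lambda E F E' F' :
  Linfty_le beta1 c -> Linfty_le beta2 c ->
  {ae nu, forall y, beta1 y <= beta2 y} -> 0 <= lambda ->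
  BV_set E -> BV_set F -> E `<=` F ->
  minimizer beta1 lambda E E' -> minimizer beta2 lambda F F' ->
  minimizer beta1 lambda E (E' `&` F') /\
  minimizer beta2 lambda F (density_one (E' `|` F')).
Proof.
move=> h1 h2 b12 l0 bE bF EF mE' mF'.
have [bE' minE] := mE'; have [bF' minF] := mF'.
have cE' := BV_caccioppoli bE'; have cF' := BV_caccioppoli bF'.
have [_ cU] := caccioppoliI_U cE' cF'; have [_ bU] := BV_density_one cU.
have bI := BV_setI bE' bF'.
have fE := minimizer_fin h1 l0 bE mE'; have fF := minimizer_fin h2 l0 bF mF'.
have sub := A_functional_submod h1 h2 b12 l0 bE' bF' bE bF EF.
have minI := minE _ bI; have minU := minF _ bU.
split; (split; [by []|move=> H bH]).
  apply: le_trans (minE H bH); rewrite -(leeD2rE _ _ fF).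
  by apply: le_trans sub; exact: leeD2l.
apply: le_trans (minF H bH); rewrite -(leeD2lE _ _ fE).
by apply: le_trans sub; exact: leeD2r.
Qed.

Lemma minimal_step_mono beta1 beta2 c lambda E F E' F' :
  Linfty_le beta1 c -> Linfty_le beta2 c ->
  {ae nu, forall y, beta1 y <= beta2 y} -> 0 <= lambda ->
  BV_set E -> BV_set F -> E `<=` F ->
  minimal_minimizer beta1 lambda E E' -> minimal_minimizer beta2 lambda F F' ->
  E' `<=` F'.
Proof.
move=> h1 h2 b12 l0 bE bF EF [mE' minE] [mF' _].
have [mI _] := step_minimizers h1 h2 b12 l0 bE bF EF mE' mF'.
by move=> x /(minE _ mI)[].
Qed.

Lemma maximal_step_mono beta1 beta2 c lambda E F E' F' :
  Linfty_le beta1 c -> Linfty_le beta2 c ->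
  {ae nu, forall y, beta1 y <= beta2 y} -> 0 <= lambda ->
  BV_set E -> BV_set F -> E `<=` F ->
  maximal_minimizer beta1 lambda E E' -> maximal_minimizer beta2 lambda F F' ->
  E' `<=` F'.
Proof.
move=> h1 h2 b12 l0 bE bF EF [mE' _] [mF' maxF].
have [_ mU] := step_minimizers h1 h2 b12 l0 bE bF EF mE' mF'.
have [[mE _ _ dE] _] := mE'; have [[mF _ _ _] _] := mF'.
(* Maximality speaks of [density_one] of the union, which contains [E'] because [E'] consists of its
   own density-one points. *)
rewrite -dE => x xE; apply: (maxF _ mU); apply: density_one_mono xE => //.
  exact: measurableU.
by apply: aeW => y; left.
Qed.

Lemma discrete_flow_mono (step1 step2 : R -> set V -> set V -> Prop) lambda E0 F0 (E F : nat -> set V) :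
  (forall A A', step1 lambda A A' -> BV_set A') ->
  (forall A A', step2 lambda A A' -> BV_set A') ->
  (forall A B A' B', BV_set A -> BV_set B -> A `<=` B ->
    step1 lambda A A' -> step2 lambda B B' -> A' `<=` B') ->
  BV_set E0 -> BV_set F0 -> E0 `<=` F0 ->
  discrete_flow step1 lambda E0 E -> discrete_flow step2 lambda F0 F ->
  forall k, [/\ BV_set (E k), BV_set (F k) & E k `<=` F k].
Proof.
move=> bv1 bv2 mono bE0 bF0 EF0 [E00 stepE] [F00 stepF].
elim=> [|k [bE bF EF]]; first by rewrite E00 F00.
split; [exact: bv1 (stepE k)|exact: bv2 (stepF k)|].
exact: mono (stepE k) (stepF k).
Qed.

(** Where [E] holds and [F] fails, [A j] cannot contain the point without [B j] containing it, so
    one of the two differences of indicators has absolute value 1. The measure of this set is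
    therefore bounded by two vanishing L^1 distances, and [density_one] turns a.e. inclusion into
    inclusion. *)
Lemma L1_limit_mono (A B : nat -> set V) E F :
  (forall j, measurable (A j)) -> (forall j, measurable (B j)) ->
  (forall j, A j `<=` B j) ->
  measurable E -> measurable F -> E `<=` Om ->
  L1_limit A E -> L1_limit B F -> density_one E `<=` density_one F.
Proof.
move=> mA mB AB mE mF EO AE BF; apply: density_one_mono => //.
have mD := measurableD mE mF; have mO := @measurable_Omega R n.
have mi C : measurable C -> measurable_fun Om (\1_C : V -> R).
  by move=> mC; apply: measurable_funTS; exact: measurable_indic.
have md C D : measurable C -> measurable D ->
    measurable_fun Om (fun x => `|\1_C x - \1_D x : R|%:E).
  move=> mC mD'; apply/measurable_EFinP; apply: measurableT_comp => //.
  by apply: measurable_funB; exact: mi.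
suff D0 : mu (E `\` F) = 0%E.
  exists (E `\` F); split => // x /= H; apply: contrapT => nD; apply: H => Ex.
  by apply: contrapT => nF; apply: nD.
apply/eqP; rewrite -measure_le0.
have := cvgeD _ AE BF; rewrite adde0 => /(_ _ isT) cvD.
rewrite -(cvg_lim (@ereal_hausdorff _) cvD).
apply: lime_ge; first by apply/cvg_ex; eexists; exact: cvD.
apply: nearW => j /=; rewrite -ge0_integralD//; [|exact: md|exact: md].
have -> : mu (E `\` F) = (\int[mu]_(x in Om) (\1_(E `\` F) x)%:E)%E.
  by rewrite integral_indic// setIidl// => x [/EO].
apply: ge0_le_integral => //.
- by apply/measurable_EFinP; exact: mi.
- by apply: emeasurable_funD; exact: md.
move=> x _; rewrite -EFinD lee_fin !indicE in_setD.
have ABx : x \in A j -> x \in B j by rewrite !inE; exact: AB.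
case: (x \in E); case: (x \in F); rewrite /= ?addr_ge0//.
case: (x \in A j) ABx => [->//|_]; first by rewrite subrr normr0 add0r subr0 normr1.
by rewrite sub0r normrN normr1 lerDl.
Qed.

(** The step relations are abstract so that minimal and maximal flows are treated at once. A common
    [lambda] makes both flows reach time [t] at the same index. *)
Lemma GMM_mono (step1 step2 : R -> set V -> set V -> Prop) E0 F0 (lambda : nat -> R)
    (E F : R -> set V) :
  (forall l A A', step1 l A A' -> BV_set A') ->
  (forall l A A', step2 l A A' -> BV_set A') ->
  (forall l A B A' B', 0 <= l -> BV_set A -> BV_set B -> A `<=` B ->
    step1 l A A' -> step2 l B B' -> A' `<=` B') ->
  BV_set E0 -> BV_set F0 -> E0 `<=` F0 ->
  GMM step1 E0 lambda E -> GMM step2 F0 lambda F ->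
  forall t, 0 <= t -> E t `<=` F t.
Proof.
move=> bv1 bv2 mono bE0 bF0 EF0 [[l1 _] [Ed flowE limE]] [_ [Fd flowF limF]] t t0.
have [mE EO dE EL] := limE t t0; have [mF FO dF FL] := limF t t0.
have flow j := discrete_flow_mono (bv1 (lambda j)) (bv2 (lambda j))
  (fun A B A' B' => mono (lambda j) A B A' B' (le_trans ler01 (l1 j)))
  bE0 bF0 EF0 (flowE j) (flowF j).
rewrite -dE -dF; apply: L1_limit_mono EL FL => // j.
- by have [[]] := flow j (Num.truncn (lambda j * t)).
- by have [_ []] := flow j (Num.truncn (lambda j * t)).
- by have [_ _] := flow j (Num.truncn (lambda j * t)).
Qed.

End comparison.

Theorem theorem7p3 (R : realType) (n : nat) (hn : (1 <= n)%N)
  (E0 F0 : set 'rV[R]_n.+1) (beta1 beta2 : 'rV[R]_n -> R) (kappa : R)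
  (hE0 : BV_set E0) (hF0 : BV_set F0)
  (E0_neq0 : E0 !=set0) (F0_neq0 : F0 !=set0)
  (E0_bounded : bounded_set E0) (F0_bounded : bounded_set F0)
  (kappa_gt0 : 0 < kappa) (kappa_le : kappa <= 1 / 2)
  (hbeta1 : Linfty_le beta1 (1 - 2 * kappa))
  (hbeta2 : Linfty_le beta2 (1 - 2 * kappa))
  (E0F0 : E0 `<=` F0)
  (beta12 : {ae lebesgue_rV n, forall y, beta1 y <= beta2 y}) :
  (forall (lambda : nat -> R) (E F : R -> set 'rV[R]_n.+1),
     minimal_GMM beta1 E0 lambda E -> minimal_GMM beta2 F0 lambda F ->
     forall t : R, 0 <= t -> E t `<=` F t) /\
  (forall (lambda' : nat -> R) (E F : R -> set 'rV[R]_n.+1),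
     maximal_GMM beta1 E0 lambda' E -> maximal_GMM beta2 F0 lambda' F ->
     forall t : R, 0 <= t -> E t `<=` F t).
Proof.
split=> lambda E F HE HF.
  apply: GMM_mono HE HF => //.
  - by move=> l A A' [[]].
  - by move=> l A A' [[]].
  - move=> l A B A' B' l0.
    exact: (minimal_step_mono hbeta1 hbeta2 beta12 l0).
apply: GMM_mono HE HF => //.
- by move=> l A A' [[]].
- by move=> l A A' [[]].
- move=> l A B A' B' l0.
  exact: (maximal_step_mono hbeta1 hbeta2 beta12 l0).
Qed.
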